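(* Let $\overline{X}=(X_0,X_1)$ be a compatible (quasi-)Banach couple and let $0<\theta_0<\theta_1<1$. Let $E,E_0,E_1,F_0,F_1$ be r.i. spaces and let $a_0,a_1,b,b_0,b_1\in SV$ be such that $\|b_0\|_{\widetilde{E}_0(0,1)}<\infty$ and $\|b_1\|_{\widetilde{E}_1(0,1)}<\infty$. Put $$\rho(u)=u^{\theta_1-\theta_0}\frac{a_0(u)\|b_0\|_{\widetilde{E}_0(0,u)}}{a_1(u)\|b_1\|_{\widetilde{E}_1(0,u)}},\qquad u>0.$$ (a) If $0<\theta<1$, then $$\big(\overline{X}^{\mathcal R}_{\theta_0,b_0,E_0,a_0,F_0},\overline{X}^{\mathcal R}_{\theta_1,b_1,E_1,a_1,F_1}\big)_{\theta,b,E}=\overline{X}_{\tilde\theta,B_\theta,E},$$ where $\tilde\theta=(1-\theta)\theta_0+\theta\theta_1$ and $B_\theta(u)=\big(a_0(u)\|b_0\|_{\widetilde{E}_0(0,u)}\big)^{1-\theta}\big(a_1(u)\|b_1\|_{\widetilde{E}_1(0,u)}\big)^{\theta}\,b(\rho(u))$, $u>0$. (b) If $\theta=0$ and $\|b\|_{\widetilde{E}(1,\infty)}<\infty$, then $$\big(\overline{X}^{\mathcal R}_{\theta_0,b_0,E_0,a_0,F_0},\overline{X}^{\mathcal R}_{\theta_1,b_1,E_1,a_1,F_1}\big)_{0,b,E}=\overline{X}^{\mathcal R,\mathcal L}_{\theta_0,b\circ\rho,E,b_0,E_0,a_0,F_0}.$$ (c) If $\theta=1$ and $\|b\|_{\widetilde{E}(0,1)}<\infty$,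 then $$\big(\overline{X}^{\mathcal R}_{\theta_0,b_0,E_0,a_0,F_0},\overline{X}^{\mathcal R}_{\theta_1,b_1,E_1,a_1,F_1}\big)_{1,b,E}=\overline{X}^{\mathcal R}_{\theta_1,B_1,E,a_1,F_1}\cap\overline{X}^{\mathcal R,\mathcal R}_{\theta_1,b\circ\rho,E,b_1,E_1,a_1,F_1},$$ where $B_1(u)=\|b_1\|_{\widetilde{E}_1(0,u)}\,b(\rho(u))$, $u>0$.
   Context: R.i. spaces: an ''r.i. space'' $E$ is a rearrangement invariant Banach function space on $(0,\infty)$ (Lebesgue measure) with the Fatou property. $\widetilde{E}$ denotes the corresponding r.i. space with respect to the measure $dt/t$ on $(0,\infty)$: if $E=\mathcal F(L_1,L_\infty)$ for an interpolation functor $\mathcal F$, then $\widetilde{E}=\mathcal F(\widetilde L_1,L_\infty)$ with $\widetilde L_1=L_1((0,\infty),dt/t)$; concretely $\|f\|_{\widetilde E}=\|f^\star\|_E$, where $f^\star$ is the non-increasing rearrangement of $f$ with respect to $dt/t$. For an interval $I\subset(0,\infty)$, $\|f\|_{\widetilde E(I)}=\|f\chi_I\|_{\widetilde E}$. Slowly varying functions: a positive (finite) measurable function $b$ on $(0,\infty)$ belongs to $SV$ if for every $\varepsilon>0$, $t^{\varepsilon}b(t)$ is equivalent to a non-decreasing function and $t^{-\varepsilon}b(t)$ is equivalent to a non-increasing function on $(0,\infty)$ (equivalent: each bounded by a constant multiple of the other). Spaces: for a compatible (quasi-)Banach couple $\overline X=(X_0,X_1)$, $K(t,f)=\inf\{\|f_0\|_{X_0}+t\|f_1\|_{X_1}: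 f=f_0+f_1,\ f_i\in X_i\}$. The following spaces consist of all $f\in X_0+X_1$ for which the indicated (quasi-)norm is finite (the innermost norm is taken in the variable $s$, the next in $t$, the outermost in $u$, when present): - $\overline X_{\theta,b,E}$ (also written $(X_0,X_1)_{\theta,b,E}$): $\|t^{-\theta}b(t)K(t,f)\|_{\widetilde E}$, $0\le\theta\le1$; - $\overline X^{\mathcal R}_{\theta,b,E,a,F}$: $\big\|b(t)\|s^{-\theta}a(s)K(s,f)\|_{\widetilde F(t,\infty)}\big\|_{\widetilde E}$; - $\overline X^{\mathcal R,\mathcal R}_{\theta,c,E,b,F,a,G}$: $\Big\|c(u)\big\|b(t)\|s^{-\theta}a(s)K(s,f)\|_{\widetilde G(t,\infty)}\big\|_{\widetilde F(u,\infty)}\Big\|_{\widetilde E}$; - $\overline X^{\mathcal R,\mathcal L}_{\theta,c,E,b,F,a,G}$: $\Big\|c(u)\big\|b(t)\|s^{-\theta}a(s)K(s,f)\|_{\widetilde G(t,u)}\big\|_{\widetilde F(0,u)}\Big\|_{\widetilde E}$. Equality of spaces means equality as sets with equivalent (quasi-)norms; an intersection carries the maximum of the two (quasi-)norms. *)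

(* Defs.v *)
From HB Require Import structures.
From mathcomp Require Import all_boot all_order all_algebra.
From mathcomp Require Import all_classical all_reals all_analysis.
From mathcomp Require Import measurable_realfun.

Set Implicit Arguments.
Unset Strict Implicit.
Unset Printing Implicit Defensive.

Import Order.TTheory GRing.Theory Num.Theory.
Import numFieldNormedType.Exports.

Local Open Scope classical_set_scope.
Local Open Scope ring_scope.

(* The real line with its Lebesgue (rather than Borel) sigma-algebra, on which
   [completed_lebesgue_measure] is defined; it is convertible to [R]. *)
Notation lebesgueType R := (caratheodory_type (wlength (@idfun R))^*%mu).

(* Functions on (0, +oo) are encoded as functions on [R], whose values outside
   of [halfline] are irrelevant. *)
Definition halfline {R : realType} : set R := `]0, +oo[.

Definition lebesgue_mfun {R : realType} d (T : measurableType d) (f : R -> T) :=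
  measurable_fun (halfline : set (lebesgueType R)) (f : lebesgueType R -> T).

Section ri_spaces.
Context {R : realType}.
Local Notation mu := (@completed_lebesgue_measure R).
Local Open Scope ereal_scope.
Implicit Types (f g : R -> \bar R) (A : set R).

Definition nneg_mfun f :=
  lebesgue_mfun f /\ forall t, halfline t -> 0 <= f t.

Definition finite_mset A :=
  [/\ measurable (A : set (lebesgueType R)), A `<=` halfline & mu A < +oo].

(* Rearrangement invariant Banach function norms on (0, +oo), in the sense of
   Bennett and Sharpley (so that the Fatou property is part of the axioms); the
   space is the set of the measurable [f] with [N (abse \o f) < +oo]. *)
Record is_ri_norm (N : (R -> \bar R) -> \bar R) : Prop := {
  ri_ge0 : forall f, nneg_mfun f -> 0 <= N f ;
  ri_eq0 : forall f, nneg_mfun f ->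
    N f = 0 <-> {ae mu, forall t, halfline t -> f t = 0} ;
  ri_scale : forall (c : R) f, (0 <= c)%R -> nneg_mfun f ->
    N (fun t => c%:E * f t) = c%:E * N f ;
  ri_add : forall f g, nneg_mfun f -> nneg_mfun g ->
    N (fun t => f t + g t) <= N f + N g ;
  ri_mono : forall f g, nneg_mfun f -> nneg_mfun g ->
    {ae mu, forall t, halfline t -> f t <= g t} -> N f <= N g ;
  ri_fatou : forall (f_ : nat -> R -> \bar R) f,
    (forall n, nneg_mfun (f_ n)) -> nneg_mfun f ->
    {ae mu, forall t, halfline t -> nondecreasing_seq (f_ ^~ t)} ->
    {ae mu, forall t, halfline t -> f_ n t @[n --> \oo] --> f t} ->
    N (f_ n) @[n --> \oo] --> N f ;
  ri_indic : forall A, finite_mset A -> N (fun t => (\1_A t)%:E) < +oo ;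
  ri_integral : forall A, finite_mset A ->
    exists2 C : R, (0 < C)%R &
      forall f, nneg_mfun f -> \int[mu]_(t in A) f t <= C%:E * N f ;
  ri_equimeasurable : forall f g, nneg_mfun f -> nneg_mfun g ->
    (forall l : R, (0 <= l)%R ->
      mu (halfline `&` [set t | l%:E < f t]) =
      mu (halfline `&` [set t | l%:E < g t])) ->
    N f = N g
}.

Record ri_space := RISpace {
  ri_norm : (R -> \bar R) -> \bar R ;
  ri_normP : is_ri_norm ri_norm
}.

(* the measure dt/t on (0, +oo) *)
Definition dtt A : \bar R := \int[mu]_(t in A `&` halfline) ((t : R)^-1)%:E.

(* the non-increasing rearrangement with respect to dt/t *)
Definition rearr f (x : R) : \bar R :=
  ereal_inf [set l%:E | l in
    [set l : R | (0 <= l)%R /\ dtt [set t | l%:E < `|f t|] <= x%:E]].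

Definition tnorm (E : ri_space) f : \bar R := ri_norm E (rearr f).

Definition tnorm_on (E : ri_space) (I : interval R) f : \bar R :=
  tnorm E (f \_ [set` I]).

End ri_spaces.
Arguments ri_space R : clear implicits.

Section slowly_varying.
Context {R : realType}.
Implicit Types f g b : R -> R.

Definition equivalent_fun f g := exists2 C : R, 0 < C &
  forall t : R, 0 < t -> f t <= C * g t /\ g t <= C * f t.

Record SV b : Prop := {
  SV_measurable : lebesgue_mfun b ;
  SV_gt0 : forall t : R, 0 < t -> 0 < b t ;
  SV_incr : forall e : R, 0 < e -> exists2 g : R -> R,
    {in `]0, +oo[ &, nondecreasing_fun g} &
    equivalent_fun (fun t => t `^ e * b t) g ;
  SV_decr : forall e : R, 0 < e -> exists2 g : R -> R,
    {in `]0, +oo[ &, nonincreasing_fun g} &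
    equivalent_fun (fun t => t `^ (- e) * b t) g
}.

End slowly_varying.

Section spaces.
Context {R : realType} {V : lmodType R}.
Local Open Scope ereal_scope.

(* A set of vectors with a gauge; the values of [qnorm] outside of [carrier]
   are irrelevant. *)
Record qspace := QSpace {
  carrier : set V ;
  qnorm : V -> \bar R
}.

Implicit Types (X Y : qspace) (XX : qspace * qspace) (k : R -> \bar R).

Definition same_space X Y :=
  carrier X = carrier Y /\
  exists2 C : R, (0 < C)%R & forall f, carrier X f ->
    qnorm X f <= C%:E * qnorm Y f /\ qnorm Y f <= C%:E * qnorm X f.

Definition qspaceI X Y := QSpace (carrier X `&` carrier Y)
  (fun f => maxe (qnorm X f) (qnorm Y f)).

Definition decomp XX (f : V) : set (V * V) :=
  [set p | [/\ carrier XX.1 p.1, carrier XX.2 p.2 & f = (p.1 + p.2)%R]].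

Definition Kfun XX (t : R) (f : V) : \bar R :=
  ereal_inf [set qnorm XX.1 p.1 + t%:E * qnorm XX.2 p.2 | p in decomp XX f].

(* all f in X_0 + X_1 such that Phi (K(., f)) is finite *)
Definition Kspace XX (Phi : (R -> \bar R) -> \bar R) := QSpace
  [set f | decomp XX f !=set0 /\ Phi (Kfun XX ^~ f) < +oo]
  (fun f => Phi (Kfun XX ^~ f)).

Definition Kweight (th : R) (a : R -> R) k (s : R) : \bar R :=
  (s `^ (- th) * a s)%:E * k s.

Definition spaceK XX th b (E : ri_space R) :=
  Kspace XX (fun k => tnorm E (Kweight th b k)).

Definition spaceR XX th b (E : ri_space R) a (F : ri_space R) :=
  Kspace XX (fun k =>
    tnorm E (fun t => (b t)%:E * tnorm_on F `]t, +oo[ (Kweight th a k))).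

Definition spaceRR XX th c (E : ri_space R) b (F : ri_space R) a
    (G : ri_space R) :=
  Kspace XX (fun k =>
    tnorm E (fun u => (c u)%:E *
      tnorm_on F `]u, +oo[ (fun t => (b t)%:E *
        tnorm_on G `]t, +oo[ (Kweight th a k)))).

Definition spaceRL XX th c (E : ri_space R) b (F : ri_space R) a
    (G : ri_space R) :=
  Kspace XX (fun k =>
    tnorm E (fun u => (c u)%:E *
      tnorm_on F `]0%R, u[ (fun t => (b t)%:E *
        tnorm_on G `]t, u[ (Kweight th a k)))).

End spaces.
Arguments qspace {R} V.

(* [X] is a quasi-Banach space continuously embedded in [V]. Scalars are real;
   a complex space is covered through its underlying real space. *)
Record quasi_Banach (R : realType) (V : topologicalLmodType R)
    (X : qspace V) : Prop := {
  qb_0 : carrier X 0 ;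
  qb_D : forall x y, carrier X x -> carrier X y -> carrier X (x + y) ;
  qb_Z : forall (a : R) x, carrier X x -> carrier X (a *: x) ;
  qb_fin : forall x, carrier X x -> (0 <= qnorm X x < +oo)%E ;
  qb_eq0 : forall x, carrier X x -> qnorm X x = 0%E -> x = 0 ;
  qb_normZ : forall (a : R) x, carrier X x ->
    qnorm X (a *: x) = (`|a|%:E * qnorm X x)%E ;
  qb_normD : exists C : R, forall x y, carrier X x -> carrier X y ->
    (qnorm X (x + y) <= C%:E * (qnorm X x + qnorm X y))%E ;
  qb_complete : forall x_ : nat -> V, (forall n, carrier X (x_ n)) ->
    (forall e : R, 0 < e -> exists N : nat, forall m n, (N <= m)%N ->
      (N <= n)%N -> (qnorm X (x_ m - x_ n)%R < e%:E)%E) ->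
    exists2 x, carrier X x & qnorm X (x_ n - x)%R @[n --> \oo] --> 0%E ;
  qb_embedding : forall U : set V, nbhs (0 : V) U ->
    exists2 d : R, 0 < d &
      forall x, carrier X x -> (qnorm X x < d%:E)%E -> U x
}.

Record compatible_couple (R : realType) (V : topologicalLmodType R)
    (XX : qspace V * qspace V) : Prop := {
  cc_hausdorff : hausdorff_space V ;
  cc_X0 : quasi_Banach XX.1 ;
  cc_X1 : quasi_Banach XX.2
}.

(* Main.v *)
Require Import Defs.
From HB Require Import structures.
From mathcomp Require Import all_boot all_order all_algebra.
From mathcomp Require Import all_classical all_reals all_analysis.
From mathcomp Require Import measurable_realfun.
From mathcomp Require Import ring lra zify.
Set Implicit Arguments.
Unset Strict Implicit.
Unset Printing Implicit Defensive.
Import Order.TTheory GRing.Theory Num.Theory.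
Import numFieldNormedType.Exports.
Local Open Scope classical_set_scope.
Local Open Scope ring_scope.

(** Cut the half-line into the blocks [[e^k, e^(k+1)[], k an integer; each has
    mass one for dt/t. A K-functional and a slowly varying weight are constant
    on a block up to a factor which does not depend on the block, and so are the
    inner norms of the statement. Hence every (quasi-)norm of the statement is
    equivalent to a norm of two-sided sequences, iterated once, twice or three
    times ([spaceK_es], [spaceR_es], [spaceRR_es], [spaceRL_es]). The sequence
    norm [seqnorm E] is monotone, homogeneous, countably subadditive, does not
    increase when indices are moved injectively, and is finite and positive on a
    unit sequence; nothing else is used about r.i. spaces. In particular Hardy's
    inequality [hardy] is a sum of shifts with geometric coefficients.

    Let [Y0], [Y1] be the two spaces which are interpolated, [K_k] the
    K-functional of f for the original couple at [e^k], [n_i(k)] the norm of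
    [b_i] on [(0, e^k)] and [w_i(k) = e^(- theta_i k) a_i(e^k) n_i(k)], so that
    [rho = w_0 / w_1]. The heart of the proof is a Holmstedt formula ([Kfun_YY]):
    the K-functional of [(Y0, Y1)] at [rho(e^j)] is equivalent to
    [lowpart f j + rho(e^j) highpart f j], where [lowpart] is the [Y0] norm of
    the part of the sequence K below j, and [highpart] is the [Y1] norm of the
    part above j.
    - Above ([holmstedt_upper]): split f almost optimally at [e^j] in the
      original couple. The K-functional of each piece is at most that of f on
      its own side of j and is given by [K_j] on the other side, where the
      powers [e^(- theta_i k)] make a convergent geometric series.
    - Below ([holmstedt_lower]): on its own side each piece of a splitting of f
      is trivially controlled; on the other side the norm of [Y_i] controls
      [w_i(k) K_k], and the exponential growth of rho makes the sum over k
      geometric ([lowpart_le_Y1], [highpart_le_Y0]).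

    The outer norm of the interpolation space is then sampled at the points
    [rho(e^j)] instead of [e^k]: ln rho is linear up to a small error, so at most
    N of these points fall in one block and no long run of blocks is missed
    ([change_var]). It remains to compare the two terms with [w_0(j) K_j]. Both
    [lowpart f j] and [rho highpart f j] dominate it; conversely they are sums of
    its values below, respectively above j. With the weight
    [rho^(- theta) b(rho)] in front, Hardy's inequality applies to the first sum
    when theta > 0 and to the second when theta < 1. So for theta strictly
    between 0 and 1 only [w_0 K] remains; for theta = 0 only [lowpart] remains,
    which is the norm of the space of type (R,L); for theta = 1 only [highpart]
    remains, and cutting its outer norm at j gives the intersection. *)

(** * The measure dt/t and the norm of an r.i. space for it *)

Section measure.
Context {R : realType}.
Local Notation mu := (@completed_lebesgue_measure R).
Local Open Scope ereal_scope.

Lemma borel_lebesgue (A : set R) : @measurable _ (measurableTypeR R) A ->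
  measurable (A : set (lebesgueType R)).
Proof.
move=> mA.
exact: (@sub_caratheodory _ (ocitv_type R) R (@wlength R idfun)).
Qed.

Lemma halflineE (t : R) : halfline t = (0 < t)%R.
Proof. by rewrite /halfline /= in_itv /= andbT. Qed.

(** The composition of b with rho may fail to be measurable, so monotonicity is
    needed for arbitrary sets: the integral of a nonnegative function is a
    supremum over the simple functions below it. *)
Lemma dtt_le (A B : set R) : A `&` halfline `<=` B -> dtt A <= dtt B.
Proof.
move=> AB; rewrite /dtt integral_mkcond [leRHS]integral_mkcond.
have p0 (C : set R) x : 0 <= ((fun t : R => (t^-1)%:E) \_ (C `&` halfline)) x.
  rewrite patchE; case: ifPn => //; rewrite inE => -[_].
  by rewrite halflineE => x0; rewrite lee_fin invr_ge0 ltW.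
rewrite !ge0_integralTE//.
apply: le_ereal_sup => _ /= [h hle <-]; exists h => // x.
apply: le_trans (hle x) _; rewrite !patchE.
case: ifPn => [|_]; last by case: ifPn => //; rewrite inE => -[_];
  rewrite halflineE => x0; rewrite lee_fin invr_ge0 ltW.
rewrite inE => xA; rewrite ifT// inE; split; first exact: AB.
by case: xA.
Qed.

Lemma dtt_itv (a b : R) : (0 < a)%R -> (a < b)%R ->
  dtt `[a, b[ = (ln b - ln a)%:E.
Proof.
move=> a0 ab.
rewrite /dtt setIidl; last first.
  by move=> x /=; rewrite halflineE !in_itv/= => /andP[/(lt_le_trans a0)].
have mid : measurable_fun [set: lebesgueType R] (id : lebesgueType R -> measurableTypeR R).
  by move=> _ Y mY; rewrite setTI; exact: sub_caratheodory.
have cinv : {within `[a, b], continuous (fun t : R => (t^-1)%R)}.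
  apply: (@continuous_in_subspaceT R R) => x.
  rewrite inE/= in_itv/= => /andP[ax _].
  by apply: (@inv_continuous R); rewrite gt_eqF// (lt_le_trans a0).
have minv : measurable_fun (`[a, b] : set (measurableTypeR R)) (fun t : R => (t^-1)%:E).
  apply/measurable_EFinP; apply: subspace_continuous_measurable_fun => //.
have := @ge0_integral_pushforward _ _ (lebesgueType R) (measurableTypeR R) R id mid mu
  `[a, b[ (fun t => (t^-1)%:E).
move=> /(_ (measurable_itv _)); rewrite preimage_id => <-; last 2 first.
- by apply: measurable_funS minv => // x /=; rewrite !in_itv/= => /andP[->/ltW].
- move=> x; rewrite inE/= in_itv/= => /andP[ax _].
  by rewrite lee_fin invr_ge0 (le_trans (ltW a0)).
rewrite (eq_measure_integral (@lebesgue_measure R)); last by [].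
rewrite integral_itv_bndo_bndc; last first.
  by apply: measurable_funS minv => // x /=; rewrite !in_itv/= => /andP[->/ltW].
rewrite (continuous_FTC2 ab cinv _ _ (F := @ln R)) ?EFinB//.
- split.
  + move=> x; rewrite in_itv/= => /andP[ax _].
    by have [] := is_derive1_ln (lt_trans a0 ax).
  + by apply: cvg_at_right_filter; apply: continuous_ln.
  + by apply: cvg_at_left_filter; apply: continuous_ln; exact: lt_trans ab.
- move=> x; rewrite in_itv/= => /andP[ax _].
  by rewrite derive1E; have [_ ->] := is_derive1_ln (lt_trans a0 ax).
Qed.

Definition int_of_code (n : nat) : int := if odd n then Negz n./2 else Posz n./2.
Definition code_of_int (z : int) : nat :=
  match z with Posz m => m.*2 | Negz m => m.*2.+1 end.

Lemma int_of_codeK : cancel int_of_code code_of_int.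
Proof.
move=> n; rewrite -{2}(odd_double_half n) /int_of_code.
by case: (odd n).
Qed.

Lemma code_of_intK : cancel code_of_int int_of_code.
Proof.
by case=> m; rewrite /int_of_code/= ?odd_double/= ?uphalf_double ?doubleK.
Qed.

Definition card_ereal (A : set int) : \bar R := \esum_(k in A) 1.

Lemma card_ereal_series (A : set int) :
  card_ereal A = \sum_(n <oo | int_of_code n \in A) 1.
Proof.
rewrite /card_ereal nneseries_esum; last by [].
rewrite (reindex_esum [set n | int_of_code n \in A] A int_of_code) //.
split.
- by move=> n /=; rewrite inE.
- by move=> m n _ _; apply: (can_inj int_of_codeK).
- move=> k Ak; exists (code_of_int k) => /=; rewrite ?code_of_intK//.
  by rewrite inE.
Qed.

Lemma card_ereal_inj (A B : set int) (f : int -> int) :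
  {in A &, injective f} -> (forall k, A k -> B (f k)) ->
  card_ereal A <= card_ereal B.
Proof.
move=> finj fAB; rewrite /card_ereal -[leLHS](esum_image A f (fun=> 1)); last first.
  exact: finj.
rewrite (esum_mkcond B) (esum_mkcond [set f x | x in A]).
apply: le_esum => k _; case: ifPn => [|_]; last by case: ifPn.
by rewrite inE => -[j Aj <-]; rewrite ifT// inE; exact: fAB.
Qed.

Definition block_index (t : R) : int := Num.floor (ln t).

Lemma block_index_eq (t : R) (k : int) : (0 < t)%R ->
  (block_index t == k) = (t \in `[expR k%:~R, expR (k + 1)%:~R[%R).
Proof.
move=> t0; rewrite in_itv/= /block_index floor_eq.
by rewrite -{3 4}(lnK t0) ler_expR ltr_expR.
Qed.

Lemma block_index_bigcup (A : set int) :
  [set t | A (block_index t)] `&` halfline =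
  \bigcup_n (if int_of_code n \in A then
    `[expR (int_of_code n)%:~R, expR (int_of_code n + 1)%:~R[%classic : set R
    else set0).
Proof.
apply/seteqP; split => [t [/= At]|t [n _]].
- rewrite halflineE => t0; exists (code_of_int (block_index t)) => //.
  by rewrite code_of_intK ifT ?inE//= -block_index_eq.
- case: ifPn => // /[1!inE] An /= tn.
  have t0 : (0 < t)%R by move: tn; rewrite in_itv/= => /andP[+ _]; exact/lt_le_trans/expR_gt0.
  split; last by rewrite halflineE.
  by move: tn; rewrite -block_index_eq// => /eqP ->.
Qed.

Let minv_halfline : measurable_fun (halfline : set (lebesgueType R))
  (fun t : lebesgueType R => ((t : R)^-1)%:E).
Proof.
have mid : measurable_fun (halfline : set (lebesgueType R))
    (id : lebesgueType R -> measurableTypeR R).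
  move=> mh Y mY; apply: measurableI; first exact: mh.
  exact: sub_caratheodory.
have cinv : {in (halfline : set R), continuous (fun t : R => (t^-1)%R)}.
  move=> x; rewrite inE halflineE => x0.
  by apply: (@inv_continuous R); rewrite gt_eqF.
have oh : open (halfline : set R) by exact: interval_open.
have minv : measurable_fun (halfline : set (measurableTypeR R)) (fun t : R => (t^-1)%:E).
  by apply/measurable_EFinP; apply: open_continuous_measurable_fun.
apply: (@measurable_comp _ _ _ (lebesgueType R) (measurableTypeR R) _
  halfline (fun t : R => (t^-1)%:E) halfline id _ _ minv mid).
- exact: measurable_itv.
- by move=> x [y hy <-].
Qed.

Lemma mu_itv (i : interval R) : mu [set` i] = (if i.1 < i.2 then (i.2 : \bar R) - i.1 else 0).
Proof.
by rewrite -lebesgue_measure_itv.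
Qed.

(** Every block has mass one, so the measure dt/t of a union of blocks counts
    them. *)
Lemma dtt_block_index (A : set int) : dtt [set t | A (block_index t)] = card_ereal A.
Proof.
rewrite card_ereal_series /dtt block_index_bigcup.
set F := (F in \bigcup_n F n).
have tF : trivIset setT F.
  apply/trivIsetP => m n _ _ mn; rewrite /F.
  case: ifPn; case: ifPn; rewrite ?set0I ?setI0// => _ _.
  apply/seteqP; split => // t [/= tm tn].
  have t0 : (0 < t)%R by move: tn; rewrite in_itv/= => /andP[+ _]; exact/lt_le_trans/expR_gt0.
  move: tm tn; rewrite -!block_index_eq// => /eqP -> /eqP /(can_inj int_of_codeK) mn'.
  by rewrite mn' eqxx in mn.
have mF k : measurable (F k : set (lebesgueType R)).
  by rewrite /F; case: ifPn => _; [apply: borel_lebesgue; exact: measurable_itv|exact: measurable0].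
have := @ge0_integral_bigcup _ (lebesgueType R) R mu F (fun t : R => (t^-1)%:E) mF.
rewrite /= => ->; last 3 first.
- apply: (measurable_funS _ _ minv_halfline); last by rewrite -block_index_bigcup.
  by apply: borel_lebesgue; exact: measurable_itv.
- move=> x [n _]; rewrite /F; case: ifPn => // _ /=.
  rewrite in_itv/= => /andP[+ _] => /(lt_le_trans (expR_gt0 _)) x0.
  by rewrite lee_fin invr_ge0 ltW.
- exact: tF.
rewrite [in RHS]eseries_mkcond; apply: eq_eseriesr => n _.
rewrite /F; case: ifPn => _; last by rewrite integral_set0.
have := @dtt_itv (expR (int_of_code n)%:~R) (expR (int_of_code n + 1)%:~R).
rewrite expR_gt0 ltr_expR ltr_int ltzD1 => /(_ isT (lexx _)).
rewrite /dtt setIidl ?expRK//; last first.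
  by move=> x /=; rewrite halflineE in_itv/= => /andP[+ _]; exact/lt_le_trans/expR_gt0.
by rewrite intrD addrAC subrr add0r => ->.
Qed.

(** The intervals [[n, n+1[], labelled by an enumeration of the integers, are for
    Lebesgue measure what the exponential blocks are for dt/t. *)
Lemma mu_truncn (A : set int) :
  mu (halfline `&` [set x | A (int_of_code (Num.truncn x))]) = card_ereal A.
Proof.
rewrite card_ereal_series.
pose F n := if int_of_code n \in A then
  halfline `&` `[n%:R, n.+1%:R[%classic else set0 : set R.
have -> : halfline `&` [set x | A (int_of_code (Num.truncn x))] = \bigcup_n F n.
  apply/seteqP; split => [t [/= ht At]|t [n _]].
  - have := ht; rewrite halflineE => /ltW t0; exists (Num.truncn t) => //.
    rewrite /F ifT ?inE//=; split => //=.
    by rewrite in_itv/= truncn_itv.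
  - rewrite /F; case: ifPn => // /[1!inE] An [ht /=]; rewrite in_itv/= => tn.
    split => //=; move: ht; rewrite halflineE => /ltW t0.
    by move: tn; rewrite -truncn_eq// => /eqP ->.
have tF : trivIset setT F.
  apply/trivIsetP => m n _ _ mn; rewrite /F.
  case: ifPn; case: ifPn; rewrite ?set0I ?setI0// => _ _.
  apply/seteqP; split => // t [/= [ht tm] [_ tn]].
  move: ht; rewrite halflineE => /ltW t0.
  move: tm tn; rewrite !in_itv/= -!truncn_eq// => /eqP -> /eqP mn'.
  by rewrite mn' eqxx in mn.
have mF k : measurable (F k : set (lebesgueType R)).
  rewrite /F; case: ifPn => _; [apply: borel_lebesgue|exact: measurable0].
  by apply: measurableI; exact: measurable_itv.
rewrite measure_bigcup//= (eq_eseriesl (Q := xpredT)); last by move=> n; rewrite in_setT.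
rewrite [in RHS]eseries_mkcond; apply: eq_eseriesr => n _.
rewrite /F; case: ifPn => _; last by rewrite measure0.
apply/eqP; rewrite eq_le; apply/andP; split.
- apply: (@le_trans _ _ (mu `[n%:R, n.+1%:R[%classic)).
    apply: le_measure; rewrite ?inE; last exact: subIsetr.
      by apply: borel_lebesgue; apply: measurableI; exact: measurable_itv.
    by apply: borel_lebesgue; exact: measurable_itv.
  by rewrite mu_itv/= lte_fin ltr_nat ltnS leqnn -EFinB -natrB// subSnn.
- apply: (@le_trans _ _ (mu `]n%:R, n.+1%:R[%classic)).
    by rewrite mu_itv/= lte_fin ltr_nat ltnS leqnn -EFinB -natrB// subSnn.
  apply: le_measure; rewrite ?inE.
  + by apply: borel_lebesgue; exact: measurable_itv.
  + by apply: borel_lebesgue; apply: measurableI; exact: measurable_itv.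
  + move=> x /=; rewrite halflineE !in_itv/= => /andP[nx ->].
    by rewrite (ltW nx) (le_lt_trans _ nx).
Qed.

Lemma mu_ltE (D : \bar R) : 0 <= D -> mu (halfline `&` [set x : R | x%:E < D]) = D.
Proof.
case: D => [r| |//]; rewrite ?lee_fin => r0.
- rewrite (_ : _ `&` _ = `]0%R, r[%classic); last first.
    by apply/seteqP; split => x /=; rewrite halflineE in_itv/= lte_fin;
      [move=> [-> ->]|move=> /andP[-> ->]].
  rewrite mu_itv/= lte_fin; case: ltP; rewrite ?subr0// => r0'.
    by rewrite -EFinD oppr0 addr0.
  by congr (_%:E); apply/eqP; rewrite eq_le r0 r0'.
- rewrite (_ : _ `&` _ = halfline); first by rewrite mu_itv/= ltry.
  by apply/seteqP; split => [x []//|x h]; split => //=; rewrite ltry.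
Qed.

(** The superlevel sets are intervals. *)
Lemma mfun_nonincreasing (f : R -> \bar R) :
  {homo f : x y / (x <= y)%R >-> y <= x} -> lebesgue_mfun f.
Proof.
move=> fd; apply: (measurability _ (ErealGenCInfty.measurableE R)).
move=> _ [_ [y ->] <-]; apply: borel_lebesgue.
apply: measurableI; first exact: measurable_itv.
apply: is_interval_measurable => a b /=; rewrite !in_itv/= !andbT => ya yb c.
by move=> /andP[_ cb]; rewrite in_itv/= andbT (le_trans yb)// fd.
Qed.

Lemma rearr_nonincreasing (f : R -> \bar R) :
  {homo rearr f : x y / (x <= y)%R >-> y <= x}.
Proof.
move=> x y xy; apply: le_ereal_inf => _ [l [l0 lx] <-]; exists l => //; split=> //.
by apply: le_trans lx _; rewrite lee_fin.
Qed.

Lemma rearr_ge0 (f : R -> \bar R) x : 0 <= rearr f x.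
Proof. by apply: le_ereal_inf_tmp => _ [l [l0 _] <-]; rewrite lee_fin. Qed.

Lemma nneg_mfun_rearr (f : R -> \bar R) : nneg_mfun (rearr f).
Proof.
split; last by move=> *; exact: rearr_ge0.
exact/mfun_nonincreasing/rearr_nonincreasing.
Qed.

Variable E : ri_space R.

Lemma tnorm_ge0 (f : R -> \bar R) : 0 <= tnorm E f.
Proof. exact/(ri_ge0 (ri_normP E))/nneg_mfun_rearr. Qed.

Lemma rearr_le (f g : R -> \bar R) x : (forall t, (0 < t)%R -> `|f t| <= `|g t|) ->
  rearr f x <= rearr g x.
Proof.
move=> fg; apply: le_ereal_inf => _ [l [l0 lx] <-]; exists l => //; split=> //.
apply: le_trans lx; apply: dtt_le => t [/= lf]; rewrite halflineE => /fg.
exact: lt_le_trans.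
Qed.

(** The rearrangement of any function is non-increasing, hence measurable, so
    the norm compares functions which need not be measurable. *)
Lemma tnorm_le (f g : R -> \bar R) : (forall t, (0 < t)%R -> `|f t| <= `|g t|) ->
  tnorm E f <= tnorm E g.
Proof.
move=> fg; apply: (ri_mono (ri_normP E)); [exact: nneg_mfun_rearr..|].
by apply: aeW => x _; exact: rearr_le.
Qed.

Lemma tnormZ_le (r : R) (f : R -> \bar R) : (0 < r)%R ->
  tnorm E (fun t => r%:E * f t) <= r%:E * tnorm E f.
Proof.
move=> r0; rewrite -(ri_scale (ri_normP E) (ltW r0) (nneg_mfun_rearr f)).
apply: (ri_mono (ri_normP E)); first exact: nneg_mfun_rearr.
- split; last by move=> *; rewrite mule_ge0 ?rearr_ge0// lee_fin ltW.
  apply: mfun_nonincreasing => x y xy.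
  by apply: lee_wpmul2l; [rewrite lee_fin ltW|exact: rearr_nonincreasing].
apply: aeW => x _; rewrite muleC -lee_pdivrMr//.
apply: le_ereal_inf_tmp => _ [l [l0 lx] <-]; rewrite lee_pdivrMr//.
apply: ereal_inf_lbound; exists (l * r)%R; last by rewrite EFinM.
split; first by rewrite mulr_ge0// ltW.
apply: le_trans lx; apply: dtt_le => t [/= lf _]; move: lf.
by rewrite abseM gee0_abs ?lee_fin ?(ltW r0)// EFinM muleC lte_pmul2l// ltry.
Qed.

End measure.

(** * Norms of two-sided sequences *)

Section seqnorm.
Context {R : realType}.
Local Notation mu := (@completed_lebesgue_measure R).
Local Open Scope ereal_scope.
Implicit Types c d : int -> \bar R.

Definition seqnorm (E : ri_space R) c := tnorm E (fun t => c (block_index t)).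

(** A copy of the step function with values c on intervals of Lebesgue measure
    one. It has the same distribution, and unlike the rearrangement it is linear
    in c: this is how the triangle inequality and the Fatou property of the r.i.
    norm reach [seqnorm]. *)
Definition spread c (x : R) : \bar R := c (int_of_code (Num.truncn x)).

Lemma nneg_mfun_spread c : (forall k, 0 <= c k) -> nneg_mfun (spread c).
Proof.
move=> c0; split; last by move=> t _; exact: c0.
move=> _ Y _.
rewrite (_ : _ `&` _ = \bigcup_n (if c (int_of_code n) \in Y then
   halfline `&` `[n%:R, n.+1%:R[%classic else set0 : set R)); last first.
  apply/seteqP; split => [t [/= ht At]|t [n _]].
  - have := ht; rewrite halflineE => /ltW t0; exists (Num.truncn t) => //.
    rewrite ifT ?inE//=; split => //=.
    by rewrite in_itv/= truncn_itv.
  - case: ifPn => // /[1!inE] An [ht /=]; rewrite in_itv/= => tn.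
    split => //=; move: ht; rewrite halflineE => /ltW t0.
    by move: tn; rewrite -truncn_eq// /spread => /eqP ->.
apply: bigcup_measurable => n _.
case: ifPn => _; last exact: measurable0.
apply: borel_lebesgue; apply: measurableI; exact: measurable_itv.
Qed.

Variable E : ri_space R.

(** The rearrangement exceeds l exactly on an initial interval whose length is
    the measure of the set where the function exceeds l. *)
Lemma seqnorm_spread c : (forall k, 0 <= c k) -> seqnorm E c = ri_norm E (spread c).
Proof.
move=> c0; apply: (ri_equimeasurable (ri_normP E)).
- exact: nneg_mfun_rearr.
- exact: nneg_mfun_spread.
move=> l l0.
set f := fun t : R => c (block_index t).
have DE l' : dtt [set t | l'%:E < `|f t|] = mu (halfline `&` [set x | l'%:E < spread c x]).
  rewrite (mu_truncn [set k | l'%:E < c k]) -dtt_block_index; congr dtt.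
  by apply/seteqP; split => t /=; rewrite /f gee0_abs.
rewrite -DE; set D := fun l => dtt [set t | l%:E < `|f t|].
transitivity (mu (halfline `&` [set x : R | x%:E < D l])); last first.
  by rewrite mu_ltE// /D DE measure_ge0.
congr (mu (_ `&` _)); apply/seteqP; split => x /=.
  move=> lx; rewrite ltNge; apply/negP => Dx; move: lx; rewrite ltNge => /negP; apply.
  by apply: ereal_inf_lbound; exists l.
(* The distribution function is continuous from the right, because mu is
   continuous along the increasing sets U n. *)
pose U n := halfline `&` [set x | (l + n.+1%:R^-1)%:E < spread c x].
have mU n : measurable (U n : set (lebesgueType R)).
  have [ms _] := nneg_mfun_spread c0.
  rewrite /U (_ : [set x | _] = spread c @^-1` `](l + n.+1%:R^-1)%:E, +oo[); last first.
    by apply/seteqP; split => y /=; rewrite in_itv/= andbT.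
  by apply: ms; [apply: borel_lebesgue; exact: measurable_itv|exact: emeasurable_itv].
have -> : D l = mu (\bigcup_n U n).
  rewrite /D DE; congr (mu _); apply/seteqP; split => y.
    move=> [hy /= ly]; have [n ln] : exists n, (l + n.+1%:R^-1)%:E < spread c y.
      move: ly; case: (spread c y) => [r| |//].
      + rewrite lte_fin -subr_gt0 => lr.
        have [n _ /(_ n (leqnn _))] := near_infty_natSinv_lt (PosNum lr).
        by move=> /= nr; exists n; rewrite lte_fin addrC -ltrBrDr.
      + by exists 0%N; rewrite ltry.
    by exists n.
  move=> [n _ [hy /= ly]]; split => //=; apply: lt_trans ly.
  by rewrite lte_fin ltrDl invr_gt0.
have Ucvg : mu (U n) @[n --> \oo] --> mu (\bigcup_n U n).
  apply: nondecreasing_cvg_mu => //; first exact: bigcup_measurable.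
  move=> m n mn; apply/subsetPset => y [hy /= ly]; split=> //=.
  apply: le_lt_trans ly; rewrite lee_fin lerD2l lef_pV2 ?posrE// ler_nat.
  exact: mn.
move=> xD.
have [n xn] : exists n, x%:E < mu (U n).
  apply/not_existsP => h; move: xD; apply/negP; rewrite -leNgt.
  rewrite -(cvg_lim _ Ucvg)//; apply: lime_le; first by apply: cvgP Ucvg.
  by apply: nearW => n; rewrite leNgt; apply/negP; exact: h.
apply: (@lt_le_trans _ _ (l + n.+1%:R^-1)%:E); first by rewrite lte_fin ltrDl invr_gt0.
apply: le_ereal_inf_tmp => _ [l' [l'0 l'x] <-].
rewrite lee_fin leNgt; apply/negP => l'l.
move: xn; rewrite /U -DE ltNge => /negP; apply; apply: le_trans l'x.
apply: dtt_le => t [/= + _]; apply: lt_trans.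
by rewrite lte_fin.
Qed.

Lemma seqnorm_ge0 c : 0 <= seqnorm E c.
Proof. exact: tnorm_ge0. Qed.

Lemma seqnorm_le c d : (forall k, 0 <= c k) -> (forall k, c k <= d k) ->
  seqnorm E c <= seqnorm E d.
Proof.
by move=> c0 cd; apply: tnorm_le => t _; rewrite !gee0_abs// (le_trans (c0 _) (cd _)).
Qed.

Lemma seqnormZ (r : R) c : (0 <= r)%R -> (forall k, 0 <= c k) ->
  seqnorm E (fun k => r%:E * c k) = r%:E * seqnorm E c.
Proof.
move=> r0 c0; rewrite !seqnorm_spread//; last first.
  by move=> k; rewrite mule_ge0// lee_fin.
by rewrite -(ri_scale (ri_normP E))//; exact: nneg_mfun_spread.
Qed.

(** Restricting and moving the indices injectively lowers the distribution
    function. *)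
Lemma seqnorm_inj (D : pred int) (f : int -> int) c : (forall k, 0 <= c k) ->
  {in D &, injective f} ->
  seqnorm E (fun k => if D k then c (f k) else 0) <= seqnorm E c.
Proof.
move=> c0 finj; apply: (ri_mono (ri_normP E)); [exact: nneg_mfun_rearr..|].
apply: aeW => x _; apply: le_ereal_inf => _ [l [l0 lx] <-]; exists l => //.
split=> //; apply: le_trans lx.
pose g k : \bar R := if D k then c (f k) else 0.
rewrite (dtt_block_index [set k | l%:E < `|g k|]) (dtt_block_index [set k | l%:E < `|c k|]).
have Dg k : l%:E < `|g k| -> D k.
  by rewrite /g; case: ifP => //; rewrite abse0 lte_fin ltNge l0.
apply: (card_ereal_inj (f := f)).
  move=> i j; rewrite !inE/= => /Dg Di /Dg Dj; exact: finj.
by move=> k /= lk; move: (lk); rewrite /g (Dg _ lk).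
Qed.

Lemma seqnormD c d : (forall k, 0 <= c k) -> (forall k, 0 <= d k) ->
  seqnorm E (fun k => c k + d k) <= seqnorm E c + seqnorm E d.
Proof.
move=> c0 d0; rewrite !seqnorm_spread//; last by move=> k; exact: adde_ge0.
by apply: (ri_add (ri_normP E)); exact: nneg_mfun_spread.
Qed.

Lemma seqnorm_sum (c : nat -> int -> \bar R) n : (forall n k, 0 <= c n k) ->
  seqnorm E (fun k => \sum_(i < n) c i k) <= \sum_(i < n) seqnorm E (c i).
Proof.
move=> c0; elim: n => [|n IHn].
  rewrite big_ord0 (_ : (fun k => _) = (fun k : int => 0%R%:E * 0)); last first.
    by apply/funext => k; rewrite big_ord0 mul0e.
  by rewrite seqnormZ// mul0e.
rewrite big_ord_recr/=; apply: (le_trans _ (leeD2r _ IHn)).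
under [in leLHS]eq_fun do rewrite big_ord_recr.
by apply: seqnormD => // k; exact: sume_ge0.
Qed.

(** The finite sums increase to the series, so the Fatou property applies. *)
Lemma seqnorm_series (c : nat -> int -> \bar R) : (forall n k, 0 <= c n k) ->
  seqnorm E (fun k => \sum_(n <oo) c n k) <= \sum_(n <oo) seqnorm E (c n).
Proof.
move=> c0; have s0 n k : 0 <= \sum_(i < n) c i k by apply: sume_ge0.
rewrite seqnorm_spread; last by move=> k; exact: nneseries_ge0.
have cv : ri_norm E (spread (fun k => \sum_(i < n) c i k)) @[n --> \oo] -->
    ri_norm E (spread (fun k => \sum_(n <oo) c n k)).
  apply: (ri_fatou (ri_normP E)).
  - by move=> n; exact: nneg_mfun_spread.
  - by apply: nneg_mfun_spread => k; exact: nneseries_ge0.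
  - apply: aeW => x _; apply/nondecreasing_seqP => n.
    by rewrite /spread big_ord_recr/= leeDl.
  - apply: aeW => x _; rewrite /spread.
    have := @is_cvg_nneseries R (fun n => c n (int_of_code (Num.truncn x))) xpredT 0.
    move=> /(_ (fun _ _ _ => c0 _ _)); under eq_fun do rewrite big_mkord; exact.
rewrite -(cvg_lim _ cv)//; apply: lime_le; first by apply: cvgP cv.
apply: nearW => n; rewrite -seqnorm_spread//; apply: le_trans (seqnorm_sum n c0) _.
rewrite -(big_mkord xpredT (fun i => seqnorm E (c i))).
by apply: nneseries_lim_ge => *; exact: seqnorm_ge0.
Qed.

Definition unit_seq (j k : int) : \bar R := (k == j)%:R%:E.

Lemma spread_unit x : (0 <= x)%R -> spread (unit_seq 0) x = (x < 1)%R%:R%:E.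
Proof.
move=> x0; rewrite /spread /unit_seq.
have -> : (int_of_code (Num.truncn x) == 0%R) = (Num.truncn x == 0%N).
  by rewrite -(inj_eq (can_inj code_of_intK)) int_of_codeK.
by rewrite truncn_eq// x0.
Qed.

Lemma seqnorm_unit_lty : seqnorm E (unit_seq 0) < +oo.
Proof.
rewrite seqnorm_spread; last by move=> k; rewrite lee_fin.
have := @ri_indic _ _ (ri_normP E) `]0%R, 1%R[%classic.
have fin : finite_mset (`]0%R, 1%R[%classic : set R).
  split.
  - by apply: borel_lebesgue; exact: measurable_itv.
  - by move=> x /=; rewrite halflineE in_itv/= => /andP[].
  - by rewrite mu_itv/= lte_fin ltr01 -EFinD ltry.
move=> /(_ fin); apply: le_lt_trans; apply: (ri_mono (ri_normP E)).
- by apply: nneg_mfun_spread => k; rewrite lee_fin.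
- split; last by move=> *; rewrite lee_fin.
  apply/measurable_EFinP; apply: measurable_indic.
  by apply: borel_lebesgue; exact: measurable_itv.
apply: aeW => x; rewrite halflineE => x0; rewrite spread_unit ?(ltW x0)//.
rewrite lee_fin indicE ler_nat; case: ltP => //= x1.
by rewrite lt0b inE/= in_itv/= x0.
Qed.

Lemma seqnorm_unit_gt0 : 0 < seqnorm E (unit_seq 0).
Proof.
have u0 (k : int) : 0 <= unit_seq 0 k by rewrite lee_fin.
rewrite lt0e seqnorm_ge0 andbT; apply/eqP.
rewrite seqnorm_spread//.
move/(ri_eq0 (ri_normP E) (nneg_mfun_spread u0)) => [N [mN N0 sN]].
have : mu `]0%R, 1%R[%classic <= mu N.
  apply: le_measure; rewrite ?inE//.
    by apply: borel_lebesgue; exact: measurable_itv.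
  move=> x /=; rewrite in_itv/= => /andP[x0 x1]; apply: sN => /=.
  rewrite halflineE spread_unit ?(ltW x0)// x1 => /(_ x0) /eqP.
  by rewrite eqe oner_eq0.
by rewrite N0 mu_itv/= lte_fin ltr01 -EFinD subr0 lee_fin ler10.
Qed.

End seqnorm.

(** * Domination up to a constant *)

(** The parameter x gathers everything the constant is independent of: vectors,
    indices and real variables are all put in the type [T]. *)
Definition lesssim {R : realType} {T : Type} (f g : T -> \bar R) :=
  exists2 C : R, 0 < C & forall x, (f x <= C%:E * g x)%E.

Notation "f <~ g" := (lesssim f g) (at level 70, no associativity).

Section lesssim.
Context {R : realType}.
Local Open Scope ereal_scope.

Section basics.
Context {T : Type}.
Implicit Types f g h : T -> \bar R.

Lemma ls_le f g : (forall x, f x <= g x) -> f <~ g.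
Proof. by move=> fg; exists 1%R => // x; rewrite mul1e. Qed.

Lemma ls_refl f : f <~ f.
Proof. exact: ls_le. Qed.

Lemma ls_trans f g h : f <~ g -> g <~ h -> f <~ h.
Proof.
move=> [C C0 fg] [D D0 gh]; exists (C * D)%R; first exact: mulr_gt0.
move=> x; apply: (le_trans (fg x)); rewrite EFinM -muleA.
by rewrite lee_wpmul2l// lee_fin ltW.
Qed.

Lemma lsD f g h : f <~ h -> g <~ h -> (fun x => f x + g x) <~ h.
Proof.
move=> [C C0 fh] [D D0 gh]; exists (C + D)%R; first exact: addr_gt0.
have C0' : 0 <= C%:E by rewrite lee_fin ltW.
have D0' : 0 <= D%:E by rewrite lee_fin ltW.
by move=> x; rewrite EFinD ge0_muleDl//; apply: leeD; [exact: fh|exact: gh].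
Qed.

Lemma lsM f f' g g' : (forall x, 0 <= f x) -> (forall x, 0 <= g x) ->
  f <~ f' -> g <~ g' -> (fun x => f x * g x) <~ (fun x => f' x * g' x).
Proof.
move=> f0 g0 [C C0 ff] [D D0 gg]; exists (C * D)%R; first exact: mulr_gt0.
by move=> x; rewrite EFinM muleACA; apply: lee_pmul.
Qed.

Lemma ls_fin (r s : T -> R) (C : R) : (0 < C)%R -> (forall x, (r x <= C * s x)%R) ->
  (fun x => (r x)%:E) <~ (fun x => (s x)%:E).
Proof. by move=> C0 rs; exists C => // x; rewrite -EFinM lee_fin. Qed.

Lemma ls_comp {T' : Type} (p : T' -> T) f g :
  f <~ g -> (fun x => f (p x)) <~ (fun x => g (p x)).
Proof. by move=> [C C0 fg]; exists C. Qed.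

End basics.

Definition eqsim {T : Type} (f g : T -> \bar R) := f <~ g /\ g <~ f.

Lemma es_trans T (f g h : T -> \bar R) : eqsim f g -> eqsim g h -> eqsim f h.
Proof. by move=> [fg gf] [gh hg]; split; [exact: ls_trans gh|exact: ls_trans gf]. Qed.

Lemma es_sym T (f g : T -> \bar R) : eqsim f g -> eqsim g f.
Proof. by case. Qed.

Lemma es_refl T (f : T -> \bar R) : eqsim f f.
Proof. by split; exact: ls_refl. Qed.

Lemma es_comp T T' (p : T' -> T) (f g : T -> \bar R) :
  eqsim f g -> eqsim (fun x => f (p x)) (fun x => g (p x)).
Proof. by move=> [? ?]; split; exact: ls_comp. Qed.

Lemma esM T (f f' g g' : T -> \bar R) : (forall x, 0 <= f x) -> (forall x, 0 <= g x) ->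
  (forall x, 0 <= f' x) -> (forall x, 0 <= g' x) ->
  eqsim f f' -> eqsim g g' -> eqsim (fun x => f x * g x) (fun x => f' x * g' x).
Proof. by move=> f0 g0 f'0 g'0 [? ?] [? ?]; split; exact: lsM. Qed.

Section norms.
Context {T : Type} (E : ri_space R).
Implicit Types u v : T -> int -> \bar R.

Lemma ls_seqnorm u v : (forall x k, 0 <= u x k) -> (forall x k, 0 <= v x k) ->
  (fun p : T * int => u p.1 p.2) <~ (fun p => v p.1 p.2) ->
  (fun x => seqnorm E (u x)) <~ (fun x => seqnorm E (v x)).
Proof.
move=> u0 v0 [C C0 uv]; exists C => // x.
rewrite -(seqnormZ E (ltW C0) (v0 x)); apply: seqnorm_le => // k.
exact: (uv (x, k)).
Qed.

Lemma es_seqnorm u v : (forall x k, 0 <= u x k) -> (forall x k, 0 <= v x k) ->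
  eqsim (fun p : T * int => u p.1 p.2) (fun p => v p.1 p.2) ->
  eqsim (fun x => seqnorm E (u x)) (fun x => seqnorm E (v x)).
Proof. by move=> u0 v0 [uv vu]; split; exact: ls_seqnorm. Qed.

(** This is the invariance of dt/t under dilations. *)
Lemma seqnorm_shift (c : int -> \bar R) (z : int) : (forall k, 0 <= c k) ->
  seqnorm E (fun k => c (k + z)%R) = seqnorm E c.
Proof.
have le (c' : int -> \bar R) z' : (forall k, 0 <= c' k) ->
    seqnorm E (fun k => c' (k + z')%R) <= seqnorm E c'.
  move=> c0; apply: (@seqnorm_inj _ _ predT (fun k => k + z')%R c' c0).
  by move=> i j _ _ /addIr.
move=> c0; apply/eqP; rewrite eq_le; apply/andP; split; first exact: le.
have := le (fun k => c (k + z)%R) (- z)%R (fun k => c0 _).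
by under eq_fun do rewrite addrNK.
Qed.

Lemma geometric_le (e : R) : (0 < e)%R -> exists2 G : R, (0 < G)%R &
  forall y : \bar R, 0 <= y -> \sum_(m <oo) (expR (- e * m%:R))%:E * y <= G%:E * y.
Proof.
move=> e0; have z1 : (0 < 1 - expR (- e))%R by rewrite subr_gt0 expR_lt1 oppr_lt0.
exists ((1 - expR (- e))^-1)%R; first by rewrite invr_gt0.
move=> y y0; apply: lime_le.
  by apply: is_cvg_nneseries => n _ _; rewrite mule_ge0// lee_fin expR_ge0.
apply: nearW => n; rewrite -ge0_sume_distrl; last by move=> *; rewrite lee_fin expR_ge0.
apply: lee_wpmul2r => //; rewrite sumEFin lee_fin big_mkord.
rewrite -[leRHS]mul1r ler_pdivlMr//.
under eq_bigr do rewrite mulrC expRM_natl.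
have := subrX1 (expR (- e)) n; set S := (\sum_(i < n) _)%R => h.
rewrite (_ : S * _ = 1 - expR (- e) ^+ n)%R; last by rewrite -[RHS]opprB h -mulNr opprB mulrC.
by rewrite gerDl oppr_le0 exprn_ge0// expR_ge0.
Qed.

(** Hardy's inequality: the right-hand side is a series of shifts of v, all of
    the same norm, with summable coefficients. *)
Lemma hardy (sg : nat -> int) (e : R) u v : (0 < e)%R ->
  (forall x k, 0 <= u x k) -> (forall x k, 0 <= v x k) ->
  (fun p : T * int => u p.1 p.2) <~
    (fun p => \sum_(m <oo) (expR (- e * m%:R))%:E * v p.1 (p.2 + sg m)%R) ->
  (fun x => seqnorm E (u x)) <~ (fun x => seqnorm E (v x)).
Proof.
move=> e0 u0 v0 uv.
have t0 x k m : 0 <= (expR (- e * m%:R))%:E * v x (k + sg m)%R.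
  by rewrite mule_ge0// lee_fin expR_ge0.
pose v' x k := \sum_(m <oo) (expR (- e * m%:R))%:E * v x (k + sg m)%R.
apply: (@ls_trans _ _ (fun x => seqnorm E (v' x))).
  by apply: ls_seqnorm => // x k; exact: nneseries_ge0.
have [G G0 geo] := geometric_le e0; exists G => // x.
apply: (le_trans (seqnorm_series _ (fun m k => t0 x k m))).
apply: (le_trans _ (geo _ (seqnorm_ge0 _ _))).
apply: lee_nneseries => [m _ _|m _]; first exact: seqnorm_ge0.
rewrite (seqnormZ E (expR_ge0 _) (fun k => v0 x (k + sg m)%R)).
by rewrite (@seqnorm_shift (v x) (sg m)).
Qed.

End norms.

Lemma seqnorm_unit (E : ri_space R) : exists2 U : R, (0 < U)%R &
  forall j, seqnorm E (unit_seq j) = U%:E.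
Proof.
have U0 := seqnorm_unit_gt0 E.
have UE : seqnorm E (unit_seq 0) = (fine (seqnorm E (unit_seq 0)))%:E.
  by rewrite fineK// ge0_fin_numE ?seqnorm_unit_lty// ltW.
exists (fine (seqnorm E (unit_seq 0))) => [|j]; first by rewrite -lte_fin -UE.
rewrite -UE -(@seqnorm_shift E (unit_seq j) j); last by move=> k; rewrite lee_fin.
by congr (seqnorm E _); apply/funext => k; rewrite /unit_seq -subr_eq0 addrK.
Qed.

(** On each residue class modulo N the map t is injective, and N classes cover
    the integers. *)
Lemma seqnorm_fiber (E : ri_space R) (t : int -> int) (N : nat) (c : int -> \bar R) :
  (forall k, 0 <= c k) ->
  (forall i j, t i = t j -> (`|i - j| < N)%N) ->
  seqnorm E (fun k => c (t k)) <= N%:R%:E * seqnorm E c.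
Proof.
move=> c0 tN.
have N0 : (0 < N)%N by apply: leq_trans (tN 0%R 0%R erefl).
pose D (r : nat) (k : int) := (k %% Posz N)%Z == Posz r.
pose u r k := if D r k then c (t k) else 0.
apply: (@le_trans _ _ (seqnorm E (fun k => \sum_(r < N) u r k))).
  apply: seqnorm_le => // k.
  have [r kr] : exists r : 'I_N, (k %% Posz N)%Z = Posz r.
    have : (`|(k %% Posz N)%Z| < N)%N by rewrite -ltz_nat gez0_abs ?modz_ge0 ?ltz_pmod; lia.
    by move=> h; exists (Ordinal h) => /=; rewrite gez0_abs// modz_ge0; lia.
  rewrite (bigD1 r)//= /u /D kr eqxx leeDl//; apply: sume_ge0 => i _.
  by case: ifP.
apply: (le_trans (seqnorm_sum E N _)); first by move=> n k; rewrite /u; case: ifP.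
apply: (@le_trans _ _ (\sum_(r < N) seqnorm E c)).
  apply: lee_sum => r _; apply: seqnorm_inj => // i j; rewrite !unfold_in /D => /eqP ir /eqP jr ij.
  have := tN _ _ ij; have := divz_eq i N; have := divz_eq j N.
  rewrite ir jr => -> ->.
  set q := (i %/ N)%Z; set q' := (j %/ N)%Z.
  have -> : (q * N + r - (q' * N + r) = (q - q') * N)%R by lia.
  rewrite abszM/= => qN; have : (`|q - q'| < 1)%N by rewrite -(ltn_pmul2r N0) mul1n.
  by rewrite ltnS leqn0 absz_eq0 subr_eq0 => /eqP ->.
by rewrite sumr_const card_ord mule_natl.
Qed.

End lesssim.

(** * Regularly varying weights *)

Section regvar.
Context {R : realType}.
Implicit Types (w : R -> R) (g e : R).

(** Regular variation of index g, for weights written in the logarithmic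
    variable [s = ln t]. Slowly varying weights have index 0 and the power [t^g]
    has index g; the class is closed under products, inverses and the
    composition of [regvar_comp]. *)
Definition regvar g w := (forall s, 0 < w s) /\
  forall e, 0 < e -> exists2 C, 0 < C &
    forall s r, w s <= C * expR (g * (s - r) + e * `|s - r|) * w r.

Lemma regvar_ext g w w' : (forall s, w s = w' s) -> regvar g w -> regvar g w'.
Proof. by move=> /funext ->. Qed.

Lemma regvarM g1 g2 w1 w2 : regvar g1 w1 -> regvar g2 w2 ->
  regvar (g1 + g2) (fun s => w1 s * w2 s).
Proof.
move=> [w10 h1] [w20 h2]; split=> [s|e e0]; first exact: mulr_gt0.
have e2 : 0 < e / 2 by rewrite divr_gt0.
have [C C0 hC] := h1 _ e2; have [D D0 hD] := h2 _ e2.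
exists (C * D) => [|s r]; first exact: mulr_gt0.
apply: (le_trans (ler_pM (ltW (w10 _)) (ltW (w20 _)) (hC s r) (hD s r))).
rewrite mulrACA [X in X * _]mulrACA -expRD le_eqVlt; apply/orP; left; apply/eqP.
by congr (_ * expR _ * _); field.
Qed.

Lemma regvarV g w : regvar g w -> regvar (- g) (fun s => (w s)^-1).
Proof.
move=> [w0 h]; split=> [s|e e0]; first by rewrite invr_gt0.
have [C C0 hC] := h _ e0; exists C => // s r.
rewrite ler_pdivlMr// mulrC ler_pdivrMr//.
by have := hC r s; rewrite distrC (_ : g * (r - s) = - g * (s - r)); [|ring].
Qed.

Lemma regvar_expR g : regvar g (fun s => expR (g * s)).
Proof.
split=> [s|e e0]; first exact: expR_gt0.
exists 1 => // s r; rewrite mul1r -expRD ler_expR.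
have : 0 <= e * `|s - r| by rewrite mulr_ge0// ltW.
by lra.
Qed.

(** The logarithm is linear of slope g up to an arbitrarily small linear error. *)
Lemma regvar_ln g w : regvar g w -> forall e, 0 < e -> exists2 C, 0 < C &
  forall s r, `|ln (w s) - ln (w r) - g * (s - r)| <= e * `|s - r| + C.
Proof.
move=> [w0 h] e e0; have [C C0 hC] := h e e0.
have le s r : ln (w s) - ln (w r) - g * (s - r) <= e * `|s - r| + `|ln C| + 1.
  have := hC s r; rewrite -ler_ln ?posrE ?mulr_gt0 ?expR_gt0//.
  rewrite !lnM ?posrE ?mulr_gt0 ?expR_gt0// expRK.
  have := ler_norm (ln C); lra.
exists (`|ln C| + 1) => [|s r]; first by rewrite ltr_wpDl.
rewrite ler_norml addrA le andbT.
by have := le r s; rewrite (distrC r s); lra.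
Qed.

(** By [regvar_ln] the argument of b moves by d times the increment, and its
    error costs an arbitrarily small exponent. *)
Lemma regvar_comp g d b w : regvar g b -> regvar d w -> regvar (g * d) (fun s => b (ln (w s))).
Proof.
move=> [b0 hb] hw; split=> [s|e e0]; first exact: b0.
have n0 : 0 < `|g| + `|d| + 2 by rewrite ltr_wpDl// addr_ge0.
pose e1 := Num.min (e / (`|g| + `|d| + 2)) 1.
have e10 : 0 < e1 by rewrite lt_min ltr01 divr_gt0.
have e11 : e1 <= 1 by rewrite ge_min lexx orbT.
have e1e : e1 * (`|g| + `|d| + 2) <= e.
  by rewrite -ler_pdivlMr// ge_min lexx.
have [C C0 hC] := hb _ e10; have [D D0 hD] := regvar_ln hw e10.
exists (C * expR (`|g| * D + e1 * D)) => [|s r].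
  by rewrite mulr_gt0// expR_gt0.
apply: (le_trans (hC _ (ln (w r)))); rewrite /= ler_pM2r// -mulrA ler_pM2l// -expRD ler_expR.
have := hD s r; set L := ln (w s) - ln (w r); set x := s - r => hL.
have -> : g * L = g * (L - d * x) + g * d * x by ring.
have h1 : g * (L - d * x) <= `|g| * (e1 * `|x| + D).
  apply: (le_trans (ler_norm _)); rewrite normrM; exact: ler_wpM2l.
have h2 : `|L| <= `|d| * `|x| + (e1 * `|x| + D).
  have -> : L = d * x + (L - d * x) by ring.
  by apply: (le_trans (ler_normD _ _)); rewrite normrM lerD2l.
have h3 : e1 * `|L| <= e1 * (`|d| * `|x| + (e1 * `|x| + D)) by rewrite ler_pM2l.
have h4 : e1 * (e1 * `|x|) <= e1 * `|x|.
  by rewrite ler_pM2l// ler_piMl.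
have h5 : e1 * (`|g| + `|d| + 2) * `|x| <= e * `|x| by rewrite ler_wpM2r.
have h6 : 0 <= e1 * `|x| by rewrite mulr_ge0// ltW.
nra.
Qed.

Lemma regvar_near g w (D : R) : regvar g w -> exists2 C, 0 < C &
  forall s r, `|s - r| <= D -> w s <= C * w r.
Proof.
move=> [w0 h]; have [C C0 hC] := h 1 ltr01.
exists (C * expR ((`|g| + 1) * D)) => [|s r sr]; first by rewrite mulr_gt0// expR_gt0.
apply: (le_trans (hC s r)); rewrite ler_pM2r// ler_pM2l// ler_expR.
have : g * (s - r) <= `|g| * `|s - r| by rewrite (le_trans (ler_norm _))// normrM.
have : (`|g| + 1) * `|s - r| <= (`|g| + 1) * D by rewrite ler_wpM2l// addr_ge0.
lra.
Qed.

(** Half of the index absorbs the slowly varying factor. *)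
Lemma regvar_decr g w : regvar g w -> g < 0 -> exists2 C, 0 < C &
  forall s r, r <= s -> w s <= C * expR (g / 2 * (s - r)) * w r.
Proof.
move=> [w0 h] g0; have e0 : 0 < - g / 2 by lra.
have [C C0 hC] := h _ e0; exists C => // s r rs; apply: (le_trans (hC s r)).
rewrite ler_pM2r// ler_pM2l// ler_expR ger0_norm ?subr_ge0//.
nra.
Qed.

Lemma regvar_incr g w : regvar g w -> 0 < g -> exists2 C, 0 < C &
  forall s r, s <= r -> w s <= C * expR (- (g / 2) * (r - s)) * w r.
Proof.
move=> [w0 h] g0; have e0 : 0 < g / 2 by lra.
have [C C0 hC] := h _ e0; exists C => // s r rs; apply: (le_trans (hC s r)).
rewrite ler_pM2r// ler_pM2l// ler_expR distrC ger0_norm ?subr_ge0//.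
nra.
Qed.

(** Monotonicity of [t^e b(t)] controls the growth to the left, that of
    [t^(- e) b(t)] the growth to the right. *)
Lemma SV_regvar b : SV b -> regvar 0 (fun s => b (expR s)).
Proof.
move=> [_ b0 bi bd]; split=> [s|e e0]; first by apply: b0; exact: expR_gt0.
have [g1 g1i [C C0 hC]] := bi e e0; have [g2 g2i [D D0 hD]] := bd e e0.
have E0 (s : R) : expR s \in `]0, +oo[ by rewrite in_itv/= expR_gt0.
have pw (x s : R) : expR s `^ x = expR (x * s) by rewrite /powR gt_eqF ?expR_gt0// expRK.
have step (x K : R) (g : R -> R) s r : 0 < K ->
  (forall t : R, 0 < t -> t `^ x * b t <= K * g t /\ g t <= K * (t `^ x * b t)) ->
  g (expR s) <= g (expR r) -> b (expR s) <= K ^+ 2 * expR (x * (r - s)) * b (expR r).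
  move=> K0 hK gsr; have [h1 _] := hK _ (expR_gt0 s); have [_ h2] := hK _ (expR_gt0 r).
  rewrite !pw in h1 h2.
  have : expR (x * s) * b (expR s) <= K * (K * (expR (x * r) * b (expR r))).
    by apply: (le_trans h1); rewrite ler_pM2l// (le_trans gsr).
  rewrite -(ler_pM2l (expR_gt0 (- (x * s)))) [X in X <= _ -> _]mulrA -expRD addNr expR0 mul1r.
  move=> /le_trans; apply; rewrite le_eqVlt; apply/orP; left; apply/eqP.
  rewrite mulrBr [x * r - _]addrC expRD; ring.
exists (C ^+ 2 + D ^+ 2) => [|s r]; first by rewrite addr_gt0// exprn_gt0.
have b0' : 0 < b (expR r) by apply: b0; exact: expR_gt0.
rewrite /= mul0r add0r; have [sr|rs] := leP s r.
- have sr' : expR s <= expR r by rewrite ler_expR.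
  apply: (le_trans (step e C g1 s r C0 hC (g1i _ _ (E0 s) (E0 r) sr'))).
  rewrite ler_pM2r// distrC ger0_norm ?subr_ge0// ler_pM2r ?expR_gt0//.
  by rewrite lerDl sqr_ge0.
- have sr' : expR r <= expR s by rewrite ler_expR ltW.
  apply: (le_trans (step (- e) D g2 s r D0 hD (g2i _ _ (E0 r) (E0 s) sr'))).
  rewrite ler_pM2r// ger0_norm ?subr_ge0 ?(ltW rs)// mulNr -mulrN opprB ler_pM2r ?expR_gt0//.
  by rewrite lerDr sqr_ge0.
Qed.

End regvar.

(** * Iterated norms of sequences *)

Section iternorm.
Context {R : realType}.
Local Open Scope ereal_scope.
Implicit Types (g : int -> \bar R) (b : int -> R) (E F : ri_space R).

Definition restr (A : int -> bool) g (k : int) : \bar R := if A k then g k else 0.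

(** All iterated norms of the statement have this form, for a relation A which
    compares the outer index i, the inner index k and possibly a fixed index j. *)
Definition iternorm E b F (A : int -> int -> bool) g : \bar R :=
  seqnorm E (fun i => (b i)%:E * seqnorm F (restr (A i) g)).

Definition cumnorm E b (k : int) : \bar R :=
  seqnorm E (restr (fun i => i <= k)%R (fun i => (b i)%:E)).

Lemma restr_ge0 (A : int -> bool) g : (forall k, 0 <= g k) -> forall k, 0 <= restr A g k.
Proof. by move=> g0 k; rewrite /restr; case: ifP. Qed.

Lemma seqnorm_restr_le E (A A1 : int -> bool) g g1 (C : R) : (0 < C)%R ->
  (forall k, 0 <= g k) -> (forall k, 0 <= g1 k) ->
  (forall k, A k -> A1 k /\ g k <= C%:E * g1 k) ->
  seqnorm E (restr A g) <= C%:E * seqnorm E (restr A1 g1).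
Proof.
move=> C0 g0 g10 H; rewrite -(seqnormZ E (ltW C0) (restr_ge0 _ g10)).
apply: seqnorm_le => k; first exact: restr_ge0.
rewrite {1}/restr; case: ifPn => [/H[A1k gk]|_]; first by rewrite /restr A1k.
by rewrite mule_ge0 ?restr_ge0// lee_fin ltW.
Qed.

Section two.
Variables (E F : ri_space R) (b : int -> R).
Hypothesis b0 : forall k, (0 < b k)%R.

Let b0' k : 0 <= (b k)%:E. Proof. by rewrite lee_fin ltW. Qed.

Lemma iternorm_split (A A1 A2 : int -> int -> bool) g g1 g2 (C : R) : (0 < C)%R ->
  (forall k, 0 <= g k) -> (forall k, 0 <= g1 k) -> (forall k, 0 <= g2 k) ->
  (forall i k, A i k -> (A1 i k /\ g k <= C%:E * g1 k) \/
                        (A2 i k /\ g k <= C%:E * g2 k)) ->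
  iternorm E b F A g <= C%:E * (iternorm E b F A1 g1 + iternorm E b F A2 g2).
Proof.
move=> C0 g0 g10 g20 H.
have C0' : 0 <= C%:E by rewrite lee_fin ltW.
have n0 B h i : 0 <= (b i)%:E * seqnorm F (restr (B i) h).
  by rewrite mule_ge0// seqnorm_ge0.
have in1 i : seqnorm F (restr (A i) g) <=
    C%:E * (seqnorm F (restr (A1 i) g1) + seqnorm F (restr (A2 i) g2)).
  apply: (@le_trans _ _ (seqnorm F (fun k => C%:E * (restr (A1 i) g1 k + restr (A2 i) g2 k)))).
    apply: seqnorm_le => k; first exact: restr_ge0.
    have r1 := restr_ge0 (A1 i) g10 k; have r2 := restr_ge0 (A2 i) g20 k.
    rewrite ge0_muleDr//.
    rewrite {1}/restr; case: ifPn => [/H[]|_]; last by rewrite adde_ge0// mule_ge0.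
      move=> [A1k gk]; rewrite (le_trans gk)// {1}/restr A1k leeDl// mule_ge0//.
    move=> [A1k gk]; rewrite (le_trans gk)// {2}/restr A1k leeDr// mule_ge0//.
  rewrite seqnormZ ?(ltW C0)//; last by move=> k; rewrite adde_ge0// restr_ge0.
  by apply: lee_wpmul2l => //; apply: seqnormD => k; exact: restr_ge0.
apply: (@le_trans _ _ (seqnorm E (fun i => C%:E *
   ((b i)%:E * seqnorm F (restr (A1 i) g1) + (b i)%:E * seqnorm F (restr (A2 i) g2))))).
  apply: seqnorm_le => // i; rewrite -ge0_muleDr ?seqnorm_ge0// muleCA.
  exact: lee_wpmul2l.
rewrite seqnormZ ?(ltW C0)//; last by move=> k; rewrite adde_ge0.
by apply: lee_wpmul2l => //; exact: seqnormD.
Qed.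

Lemma iternorm_le (A A1 : int -> int -> bool) g g1 (C : R) : (0 < C)%R ->
  (forall k, 0 <= g k) -> (forall k, 0 <= g1 k) ->
  (forall i k, A i k -> A1 i k /\ g k <= C%:E * g1 k) ->
  iternorm E b F A g <= C%:E * iternorm E b F A1 g1.
Proof.
move=> C0 g0 g10 H; have C0' : 0 <= C%:E by rewrite lee_fin ltW.
have n0 B h i : 0 <= (b i)%:E * seqnorm F (restr (B i) h).
  by rewrite mule_ge0// seqnorm_ge0.
rewrite -(seqnormZ E (ltW C0) (n0 A1 g1)); apply: seqnorm_le => // i.
rewrite muleCA; apply: lee_wpmul2l => //.
by apply: seqnorm_restr_le => // k; exact: H.
Qed.

(** The inner norm is at most the sum of its terms; collecting the outer indices
    seen by a given inner index k leaves the norm of b up to k. *)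
Lemma iternorm_le_series : exists2 C : R, (0 < C)%R &
  forall (A : int -> int -> bool) g (sg : nat -> int), (forall k, 0 <= g k < +oo) ->
  (forall i k, A i k -> (i <= k)%R /\ exists m, k = sg m) ->
  iternorm E b F A g <= C%:E * \sum_(m <oo) (cumnorm E b (sg m) * g (sg m)).
Proof.
have [U U0 UE] := seqnorm_unit F.
exists U => // A g sg g0 H.
pose r k := fine (g k).
have gE k : g k = (r k)%:E.
  by rewrite /r fineK// ge0_fin_numE; case/andP: (g0 k).
have r0 k : (0 <= r k)%R by rewrite -lee_fin -gE; case/andP: (g0 k).
have g0' k : 0 <= g k by rewrite gE lee_fin.
have u0 j k : 0 <= unit_seq j k :> \bar R by rewrite lee_fin.
pose v i m k := (if A i (sg m) then r (sg m) else 0%R)%:E * unit_seq (sg m) k.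
have v0 i m k : 0 <= v i m k by rewrite mule_ge0// lee_fin; case: ifP.
have in1 i : seqnorm F (restr (A i) g) <=
    \sum_(m <oo) ((U * r (sg m))%:E * (if (i <= sg m)%R then 1 else 0)).
  apply: (@le_trans _ _ (seqnorm F (fun k => \sum_(m <oo) v i m k))).
    apply: seqnorm_le => k; first exact: restr_ge0.
    rewrite /restr; case: ifPn => [Aik|_]; last exact: nneseries_ge0.
    have [_ [m km]] := H _ _ Aik.
    apply: (@le_trans _ _ (\sum_(0 <= n < m.+1) v i n k)); last first.
      exact: nneseries_lim_ge.
    rewrite big_nat_recr//= /v -km Aik /unit_seq eqxx mule1 gE leeDr//.
    by apply: sume_ge0 => n _; exact: v0.
  apply: (le_trans (seqnorm_series F (v0 i))).
  apply: lee_nneseries => [m _ _|m _]; first exact: seqnorm_ge0.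
  rewrite /v; rewrite seqnormZ//; last by case: ifP.
  rewrite UE.
  case: ifPn => [/H[-> _]|_]; first by rewrite mule1 EFinM muleC.
  by rewrite mul0e mule_ge0// ?lee_fin ?mulr_ge0 ?(ltW U0)//; case: ifP.
pose w m i := (U * r (sg m))%:E * restr (fun i => i <= sg m)%R (fun i => (b i)%:E) i.
have w0 m i : 0 <= w m i by rewrite mule_ge0 ?restr_ge0// lee_fin mulr_ge0// ltW.
apply: (@le_trans _ _ (seqnorm E (fun i => \sum_(m <oo) w m i))).
  apply: seqnorm_le => i; first by rewrite mule_ge0// seqnorm_ge0.
  apply: (le_trans (lee_wpmul2l (b0' i) (in1 i))).
  rewrite -nneseriesZl; last first.
    by move=> m _; rewrite mule_ge0 ?lee_fin ?mulr_ge0 ?(ltW U0)//; case: ifP.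
  apply: lee_nneseries => [m _ _|m _].
    by rewrite mule_ge0// mule_ge0 ?lee_fin ?mulr_ge0 ?(ltW U0)//; case: ifP.
  by rewrite /w /restr muleCA; case: ifP; rewrite ?mule1 ?mule0.
apply: (le_trans (seqnorm_series E w0)).
rewrite -nneseriesZl; last by move=> m _; rewrite mule_ge0// seqnorm_ge0.
apply: lee_nneseries => [m _ _|m _]; first exact: seqnorm_ge0.
rewrite seqnormZ ?mulr_ge0 ?(ltW U0)//; last exact: restr_ge0.
by rewrite gE EFinM -muleA [X in _ * X]muleC.
Qed.

(** Keep only the index k of the inner sequence. *)
Lemma cumnorm_le_iternorm : exists2 C : R, (0 < C)%R &
  forall (A : int -> int -> bool) g k, (forall k, 0 <= g k < +oo) ->
  (forall i, (i <= k)%R -> A i k) ->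
  cumnorm E b k * g k <= C%:E * iternorm E b F A g.
Proof.
have [U U0 UE] := seqnorm_unit F.
exists (U^-1)%R; first by rewrite invr_gt0.
move=> A g k g0 H.
have gfin : g k \is a fin_num by rewrite ge0_fin_numE; case/andP: (g0 k).
have gE : g k = (fine (g k))%:E by rewrite fineK.
set r := fine _ in gE.
have r0 : (0 <= r)%R by rewrite -lee_fin -gE; case/andP: (g0 k).
have g0' j : 0 <= g j by case/andP: (g0 j).
have u0 j i : 0 <= unit_seq j i :> \bar R by rewrite lee_fin.
rewrite gE muleC -lee_pdivrMl ?invr_gt0// invrK muleA -EFinM -seqnormZ; last 2 first.
- by rewrite mulr_ge0// ltW.
- exact: restr_ge0.
apply: seqnorm_le => i.
  by rewrite mule_ge0 ?restr_ge0// lee_fin mulr_ge0// ltW.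
rewrite {1}/restr; case: ifPn => [/H Aik|_]; last by rewrite mule0 mule_ge0// seqnorm_ge0.
rewrite muleC; apply: lee_wpmul2l => //.
rewrite mulrC EFinM -(UE k) -(seqnormZ F r0 (u0 k)).
apply: seqnorm_le => j; first by rewrite mule_ge0.
rewrite /unit_seq; case: eqP => [->|_]; last by rewrite mule0 restr_ge0.
by rewrite mule1 /restr Aik gE.
Qed.

End two.
End iternorm.

(** * From functions on the half-line to sequences *)

Section conv.
Context {R : realType}.
Local Open Scope ereal_scope.

Lemma near_floor (s : R) : (`|s - (Num.floor s)%:~R| <= 1)%R.
Proof.
have /andP[h1 h2] := floor_itv s; rewrite intrD in h2.
by rewrite ger0_norm ?subr_ge0//; lra.
Qed.

Lemma regvar_floor (g : R) (w : R -> R) : regvar g w ->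
  eqsim (fun s => (w s)%:E) (fun s => (w (Num.floor s)%:~R)%:E).
Proof.
move=> hw; have [C C0 hC] := regvar_near 1 hw.
split; apply: (ls_fin C0) => s; apply: hC; first exact: near_floor.
by rewrite distrC; exact: near_floor.
Qed.

(** An open interval starting or ending inside a block contains only part of this
    block. Sequences which do not drop abruptly from one index to a neighbour
    make this harmless: a shift moves the affected indices into the interior. *)
Section shift.
Context {T : Type}.
Variables (c : T -> int -> \bar R) (q : int).
Hypothesis c0 : forall x k, 0 <= c x k.
Hypothesis cq : (fun p : T * int => c p.1 p.2) <~ (fun p => c p.1 (p.2 + q)%R).

Lemma restr_shift (E : ri_space R) (A A' : T -> int -> bool) :
  (forall x k, A x k -> A' x (k + q)%R) ->
  (fun x => seqnorm E (restr (A x) (c x))) <~ (fun x => seqnorm E (restr (A' x) (c x))).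
Proof.
move=> AA; have [C C0 hC] := cq; exists C => // x.
have r0 := restr_ge0 (A' x) (c0 x).
rewrite -(seqnorm_shift E q r0) -(seqnormZ E (ltW C0) (fun k => r0 (k + q)%R)).
apply: seqnorm_le => k; first exact: restr_ge0.
rewrite {1}/restr; case: ifPn => [/AA Ak|_].
  by rewrite /restr Ak; exact: (hC (x, k)).
by rewrite mule_ge0 ?restr_ge0// lee_fin ltW.
Qed.

Lemma iternorm_shift (E F : ri_space R) (b : int -> R) (p : int) (A A' : T -> int -> int -> bool) :
  (forall k, (0 < b k)%R) ->
  (fun k => (b k)%:E) <~ (fun k => (b (k + p)%R)%:E) ->
  (forall x i k, A x i k -> A' x (i + p)%R (k + q)%R) ->
  (fun x => iternorm E b F (A x) (c x)) <~ (fun x => iternorm E b F (A' x) (c x)).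
Proof.
move=> b0 [D D0 hD] AA.
have b0' k : 0 <= (b k)%:E by rewrite lee_fin ltW.
have [C C0 hC] := cq; exists (D * C)%R => [|x]; first exact: mulr_gt0.
pose g' i := (b i)%:E * seqnorm F (restr (A' x i) (c x)).
have g'0 i : 0 <= g' i by rewrite mule_ge0// seqnorm_ge0.
have DC0 : (0 < D * C)%R by exact: mulr_gt0.
rewrite [iternorm _ _ _ (A' x) _](_ : _ = seqnorm E g')//.
rewrite -(seqnorm_shift E p g'0) -(seqnormZ E (ltW DC0) (fun k => g'0 (k + p)%R)).
apply: seqnorm_le => i; first by rewrite mule_ge0// seqnorm_ge0.
rewrite EFinM muleACA; apply: lee_pmul; [by []|exact: seqnorm_ge0|exact: hD|].
have r0 := restr_ge0 (A' x (i + p)%R) (c0 x).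
rewrite -(seqnorm_shift F q r0) -(seqnormZ F (ltW C0) (fun k => r0 (k + q)%R)).
apply: seqnorm_le => k; first exact: restr_ge0.
rewrite {1}/restr; case: ifPn => [/AA Ak|_].
  by rewrite /restr Ak; exact: (hC (x, k)).
by rewrite mule_ge0 ?restr_ge0// lee_fin ltW.
Qed.

End shift.

(** A function and a sequence are comparable when they are so on each block;
    functions are evaluated at exponentials, which avoids a side condition on the
    sign of the variable. *)
Section discretize.
Context {T : Type} (E : ri_space R).
Variables (f : T -> R -> \bar R) (c : T -> int -> \bar R).
Hypothesis f0 : forall x t, (0 < t)%R -> 0 <= f x t.
Hypothesis c0 : forall x k, 0 <= c x k.
Implicit Types (I : T -> interval R) (A : T -> int -> bool).

Let cb x (t : R) := c x (block_index t).

Lemma tnorm_on_ls I A :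
  (fun p : T * R => f p.1 (expR p.2)) <~ (fun p => c p.1 (Num.floor p.2)) ->
  (forall x s, expR s \in I x -> A x (Num.floor s)) ->
  (fun x => tnorm_on E (I x) (f x)) <~ (fun x => seqnorm E (restr (A x) (c x))).
Proof.
move=> [C C0 fc] IA; exists C => // x.
apply: (le_trans _ (tnormZ_le E _ C0)); apply: tnorm_le => t t0.
have r0 := restr_ge0 (A x) (c0 x) (block_index t).
have C0' : 0 <= C%:E by rewrite lee_fin ltW.
rewrite (gee0_abs (mule_ge0 C0' r0)) patchE; case: ifPn => [|_]; last first.
  by rewrite abse0 mule_ge0.
rewrite inE/= -{1}(lnK t0) => /IA Ax.
rewrite gee0_abs ?f0// /restr Ax.
by have := fc (x, ln t); rewrite /= lnK.
Qed.

Lemma tnorm_on_gs I A :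
  (fun p => c p.1 (Num.floor p.2)) <~ (fun p : T * R => f p.1 (expR p.2)) ->
  (forall x s, A x (Num.floor s) -> expR s \in I x) ->
  (fun x => seqnorm E (restr (A x) (c x))) <~ (fun x => tnorm_on E (I x) (f x)).
Proof.
move=> [C C0 fc] IA; exists C => // x.
apply: (le_trans _ (tnormZ_le E _ C0)); apply: tnorm_le => t t0.
have r0 := restr_ge0 (A x) (c0 x) (block_index t).
have C0' : 0 <= C%:E by rewrite lee_fin ltW.
have p0 : 0 <= (f x \_ [set` I x]) t by rewrite patchE; case: ifPn => // _; exact: f0.
rewrite (gee0_abs r0) (gee0_abs (mule_ge0 C0' p0)).
rewrite {1}/restr; case: ifPn => [Ax|_]; last by rewrite mule_ge0.
rewrite patchE ifT; last by rewrite inE/= -{1}(lnK t0); exact: IA.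
by have := fc (x, ln t); rewrite /= lnK.
Qed.

Hypothesis fc : eqsim (fun p : T * R => f p.1 (expR p.2)) (fun p => c p.1 (Num.floor p.2)).

Lemma tnorm_es : eqsim (fun x => tnorm E (f x)) (fun x => seqnorm E (c x)).
Proof.
split.
- have [C C0 h] := fc.1; exists C => // x.
  apply: (le_trans _ (tnormZ_le E _ C0)); apply: tnorm_le => t t0.
  have C0' : 0 <= C%:E by rewrite lee_fin ltW.
  rewrite (gee0_abs (mule_ge0 C0' (c0 _ _))) gee0_abs ?f0//.
  by have := h (x, ln t); rewrite /= lnK.
- have [C C0 h] := fc.2; exists C => // x.
  apply: (le_trans _ (tnormZ_le E _ C0)); apply: tnorm_le => t t0.
  have C0' : 0 <= C%:E by rewrite lee_fin ltW.
  rewrite (gee0_abs (mule_ge0 C0' (f0 _ t0))) gee0_abs//.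
  by have := h (x, ln t); rewrite /= lnK.
Qed.

End discretize.

Lemma floor_lt (s r : R) : (Num.floor s < Num.floor r)%R -> (s < r)%R.
Proof.
move=> h; have /andP[_ h1] := floor_itv s; have /andP[h2 _] := floor_itv r.
apply: (lt_le_trans h1); apply: (le_trans _ h2); rewrite ler_int.
by rewrite addrC lez1D.
Qed.

Section tail.
Context {T : Type} (F : ri_space R).
Variables (f : T -> R -> \bar R) (c : T -> int -> \bar R).
Hypothesis f0 : forall x t, (0 < t)%R -> 0 <= f x t.
Hypothesis c0 : forall x k, 0 <= c x k.
Hypothesis fc : eqsim (fun p : T * R => f p.1 (expR p.2)) (fun p => c p.1 (Num.floor p.2)).

Definition tailnorm (F : ri_space R) (g : int -> \bar R) (i : int) : \bar R :=
  seqnorm F (restr (fun k => i <= k)%R g).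

(** The half-line after [e^s] contains the blocks after that of s and meets only
    these and the block of s itself. *)
Lemma tnorm_tail_es :
  (fun p : T * int => c p.1 p.2) <~ (fun p => c p.1 (p.2 + 1)%R) ->
  eqsim (fun p : T * R => tnorm_on F `]expR p.2, +oo[%R (f p.1))
        (fun p => tailnorm F (c p.1) (Num.floor p.2)).
Proof.
move=> c1; split.
- apply: (@tnorm_on_ls _ F (fun p : T * R => f p.1) (fun p => c p.1)
     _ _ (fun p => `]expR p.2, +oo[%R) (fun p k => (Num.floor p.2 <= k)%R)) => //.
  + by move=> *; exact: f0.
  + exact: (ls_comp (fun p : (T * R) * R => (p.1.1, p.2)) fc.1).
  + move=> [x s] r /=; rewrite in_itv/= andbT ltr_expR => sr.
    by apply: le_floor; exact: ltW.
- apply: (@ls_trans _ _ _ (fun p : T * R => seqnorm F (restr (fun k => (Num.floor p.2 < k)%R) (c p.1)))).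
    apply: (@restr_shift _ (fun p : T * R => c p.1) 1%R _ _ F
      (fun p k => (Num.floor p.2 <= k)%R) (fun p k => (Num.floor p.2 < k)%R)) => //.
    + exact: (ls_comp (fun p : (T * R) * int => (p.1.1, p.2)) c1).
    + by move=> x k; lia.
  apply: (@tnorm_on_gs _ F (fun p : T * R => f p.1) (fun p => c p.1)
     _ _ (fun p => `]expR p.2, +oo[%R) (fun p k => (Num.floor p.2 < k)%R)) => //.
  + by move=> *; exact: f0.
  + exact: (ls_comp (fun p : (T * R) * R => (p.1.1, p.2)) fc.2).
  + move=> [x s] r /= sr; rewrite in_itv/= andbT ltr_expR.
    exact: floor_lt.
Qed.

(** Both ends of the inner interval, and the end of the outer one, lie inside
    blocks. Moving the outer index by two and the inner one by one makes the
    inequalities strict. *)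
Lemma tnorm_square_es (E : ri_space R) (b : R -> R) :
  (fun p : T * int => c p.1 p.2) <~ (fun p => c p.1 (p.2 - 1)%R) ->
  (forall t, (0 < t)%R -> (0 < b t)%R) -> regvar 0 (fun s => b (expR s)) ->
  eqsim (fun p : T * R => tnorm_on E `]0%R, expR p.2[%R
           (fun t => (b t)%:E * tnorm_on F `]t, expR p.2[%R (f p.1)))
        (fun p => iternorm E (fun k => b (expR k%:~R)) F
           (fun i k => (i <= k)%R && (k <= Num.floor p.2)%R) (c p.1)).
Proof.
move=> c1 b0 hb.
have bE (x : R) : (0 < b (expR x))%R by apply: b0; exact: expR_gt0.
have bk k : 0 <= (b (expR k%:~R))%:E by rewrite lee_fin ltW.
have bp (p : int) : (fun k : int => (b (expR k%:~R))%:E) <~ (fun k => (b (expR (k + p)%:~R))%:E).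
  have [C C0 hC] := regvar_near `|p%:~R|%R hb; apply: (ls_fin C0) => k; apply: hC.
  by rewrite intrD opprD addrA subrr sub0r normrN.
split.
- have H : (fun q : (T * R) * R => (b (expR q.2))%:E * tnorm_on F `]expR q.2, expR q.1.2[%R (f q.1.1))
     <~ (fun q => (b (expR (Num.floor q.2)%:~R))%:E *
          seqnorm F (restr (fun k => (Num.floor q.2 <= k) && (k <= Num.floor q.1.2))%R (c q.1.1))).
    apply: lsM.
    + by move=> q; rewrite lee_fin ltW.
    + by move=> q; exact: tnorm_ge0.
    + exact: (ls_comp snd (regvar_floor hb).1).
    apply: (@tnorm_on_ls _ F (fun q : (T * R) * R => f q.1.1) (fun q => c q.1.1) _ _
      (fun q => `]expR q.2, expR q.1.2[%R)
      (fun q k => (Num.floor q.2 <= k) && (k <= Num.floor q.1.2))%R) => //.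
    + by move=> *; exact: f0.
    + exact: (ls_comp (fun p : ((T * R) * R) * R => (p.1.1.1, p.2)) fc.1).
    + move=> [[x r] s] u /=; rewrite in_itv/= !ltr_expR => /andP[su ur].
      by rewrite !le_floor// ltW.
  apply: (ls_trans (@tnorm_on_ls _ E
    (fun (p : T * R) t => (b t)%:E * tnorm_on F `]t, expR p.2[%R (f p.1))
    (fun (p : T * R) i => (b (expR i%:~R))%:E *
       seqnorm F (restr (fun k => (i <= k) && (k <= Num.floor p.2))%R (c p.1)))
    _ _ (fun p => `]0%R, expR p.2[%R) (fun p i => (i <= Num.floor p.2)%R) _ _)).
  + by move=> p t t0; rewrite mule_ge0 ?tnorm_ge0// lee_fin ltW// b0.
  + by move=> p i; rewrite mule_ge0 ?seqnorm_ge0.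
  + exact: H.
  + move=> [x r] s /=; rewrite in_itv/= ltr_expR => /andP[_ sr].
    by apply: le_floor; exact: ltW.
  apply: ls_le => p; apply: seqnorm_le => i.
    by apply: restr_ge0 => k; rewrite mule_ge0 ?seqnorm_ge0.
  by rewrite /restr; case: ifP => // _; rewrite mule_ge0 ?seqnorm_ge0.
- apply: (@ls_trans _ _ _ (fun p : T * R => iternorm E (fun k => b (expR k%:~R)) F
           (fun i k => (i < k)%R && (k < Num.floor p.2)%R) (c p.1))).
    apply: (@iternorm_shift _ (fun p : T * R => c p.1) (- 1)%R _ _ E F _ (- 2)%R
      (fun p i k => (i <= k)%R && (k <= Num.floor p.2)%R)
      (fun p i k => (i < k)%R && (k < Num.floor p.2)%R)) => //.
    + exact: (ls_comp (fun p : (T * R) * int => (p.1.1, p.2)) c1).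
    + by move=> p i k /andP[h1 h2]; apply/andP; split; lia.
  have H : (fun q : (T * R) * R => (b (expR (Num.floor q.2)%:~R))%:E *
          seqnorm F (restr (fun k => (Num.floor q.2 < k) && (k < Num.floor q.1.2))%R (c q.1.1)))
     <~ (fun q => (b (expR q.2))%:E * tnorm_on F `]expR q.2, expR q.1.2[%R (f q.1.1)).
    apply: lsM.
    + by move=> q; rewrite lee_fin ltW.
    + by move=> q; exact: seqnorm_ge0.
    + exact: (ls_comp snd (regvar_floor hb).2).
    apply: (@tnorm_on_gs _ F (fun q : (T * R) * R => f q.1.1) (fun q => c q.1.1) _ _
      (fun q => `]expR q.2, expR q.1.2[%R)
      (fun q k => (Num.floor q.2 < k) && (k < Num.floor q.1.2))%R) => //.
    + by move=> *; exact: f0.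
    + exact: (ls_comp (fun p : ((T * R) * R) * R => (p.1.1.1, p.2)) fc.2).
    + move=> [[x r] s] u /= /andP[su ur]; rewrite in_itv/= !ltr_expR.
      by rewrite !floor_lt.
  apply: (ls_trans _ (@tnorm_on_gs _ E
    (fun (p : T * R) t => (b t)%:E * tnorm_on F `]t, expR p.2[%R (f p.1))
    (fun (p : T * R) i => (b (expR i%:~R))%:E *
       seqnorm F (restr (fun k => (i < k) && (k < Num.floor p.2))%R (c p.1)))
    _ _ (fun p => `]0%R, expR p.2[%R) (fun p i => (i < Num.floor p.2)%R) _ _)).
  + apply: ls_le => p; apply: seqnorm_le => i.
      by rewrite mule_ge0 ?seqnorm_ge0.
    rewrite {2}/restr; case: ifPn => // ip.
    rewrite (_ : restr _ _ = (fun k : int => 0%R%:E * 0)).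
      by rewrite seqnormZ// mul0e mule0.
    apply/funext => k; rewrite mul0e /restr; case: ifPn => // /andP[h1 h2].
    by move: ip; rewrite (lt_trans h1 h2).
  + by move=> p t t0; rewrite mule_ge0 ?tnorm_ge0// lee_fin ltW// b0.
  + by move=> p i; rewrite mule_ge0 ?seqnorm_ge0.
  + exact: H.
  + move=> [x r] s /= sr; rewrite in_itv/= ltr_expR expR_gt0/=.
    exact: floor_lt.
Qed.

End tail.

Lemma tnorm_cum_es (E : ri_space R) (b : R -> R) :
  (forall t, (0 < t)%R -> (0 < b t)%R) -> regvar 0 (fun s => b (expR s)) ->
  eqsim (fun s : R => tnorm_on E `]0%R, expR s[%R (EFin \o b))
        (fun s => cumnorm E (fun k => b (expR k%:~R)) (Num.floor s)).
Proof.
move=> b0 hb.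
have bk (k : int) : 0 <= (b (expR k%:~R))%:E by rewrite lee_fin ltW// b0// expR_gt0.
split.
- apply: (@tnorm_on_ls _ E (fun (_ : R) t => (b t)%:E) (fun _ k => (b (expR k%:~R))%:E)
    _ _ (fun s => `]0%R, expR s[%R) (fun s k => (k <= Num.floor s)%R)) => //.
  + by move=> x t t0; rewrite lee_fin ltW// b0.
  + exact: (ls_comp snd (regvar_floor hb).1).
  + move=> s r /=; rewrite in_itv/= ltr_expR => /andP[_ sr].
    by apply: le_floor; exact: ltW.
- apply: (@ls_trans _ _ _ (fun s : R => seqnorm E (restr (fun k => (k < Num.floor s)%R)
      (fun k => (b (expR k%:~R))%:E)))).
    apply: (@restr_shift _ (fun (_ : R) k => (b (expR k%:~R))%:E) (- 1)%R _ _ E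
      (fun s k => (k <= Num.floor s)%R) (fun s k => (k < Num.floor s)%R)) => //.
    + have [C C0 hC] := regvar_near 1 hb; apply: (ls_fin C0) => -[x k] /=; apply: hC.
      by rewrite intrD opprD addrA subrr sub0r opprK normr1.
    + by move=> x k; lia.
  apply: (@tnorm_on_gs _ E (fun (_ : R) t => (b t)%:E) (fun _ k => (b (expR k%:~R))%:E)
    _ _ (fun s => `]0%R, expR s[%R) (fun s k => (k < Num.floor s)%R)) => //.
  + by move=> x t t0; rewrite lee_fin ltW// b0.
  + exact: (ls_comp snd (regvar_floor hb).2).
  + move=> s r /= sr; rewrite in_itv/= ltr_expR expR_gt0/=.
    exact: floor_lt.
Qed.

End conv.

(** * Change of variable *)

Section change.
Context {R : realType}.

Lemma dist_intr (i j : int) : (`|i - j|%N)%:R = `|i%:~R - j%:~R : R|.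
Proof. by rewrite natr_absz intr_norm intrD mulrNz. Qed.

(** The supremum of the points where ln w stays below y is a point near which
    ln w crosses y, and ln w has bounded jumps at unit scale. *)
Lemma regvar_onto (d : R) (w : R -> R) : 0 < d -> regvar d w ->
  exists2 D, 0 < D & forall y, exists j : int, `|ln (w j%:~R) - y| <= D.
Proof.
move=> d0 hw; have [C C0 hC] := regvar_ln hw (divr_gt0 d0 (ltr0n R 2)).
pose l s := ln (w s).
have up s r : l s <= l r + d * (s - r) + d / 2 * `|s - r| + C.
  by have := hC s r; rewrite ler_norml => /andP[_]; rewrite -/(l s) -/(l r); lra.
have lo s r : l r + d * (s - r) - d / 2 * `|s - r| - C <= l s.
  by have := hC s r; rewrite ler_norml => /andP[+ _]; rewrite -/(l s) -/(l r); lra.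
exists (2 * (3 / 2 * d + C)) => [|y]; first by lra.
pose S := [set s | l s <= y].
have S0 : S !=set0.
  pose s := Num.min 0 ((y - C - l 0) * 2 / d).
  have s0 : s <= 0 by rewrite /s ge_min lexx.
  exists s; rewrite /S/=; apply: (le_trans (up s 0)); rewrite subr0 ler0_norm//.
  have : s <= (y - C - l 0) * 2 / d by rewrite ge_min lexx orbT.
  rewrite ler_pdivlMr//; lra.
have Sb : has_ubound S.
  exists (Num.max 0 ((y + C - l 0) * 2 / d)) => s; rewrite /S/= => ls; rewrite le_max.
  have [//|s0] := leP s 0; rewrite /= ler_pdivlMr//.
  by have := lo s 0; rewrite subr0 gtr0_norm//; lra.
have [s Ss s1] := sup_adherent (ltr01 : 0 < (1 : R)) (conj S0 Sb).
have ls1 : y < l (s + 1).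
  rewrite ltNge; apply/negP => h; have := ub_le_sup Sb h; lra.
have ls2 := up (s + 1) s.
have /andP[f1 f2] := floor_itv s; rewrite intrD in f2.
exists (Num.floor s); set j := (Num.floor s)%:~R in f1 f2 *.
rewrite -/(l j).
have e1 : s + 1 - s = 1 by ring.
rewrite e1 normr1 in ls2; have := up j s; have := lo j s.
rewrite /S/= in Ss.
rewrite ler0_norm ?subr_le0// => h1 h2; rewrite ler_norml.
have : d * (s - j) <= d by rewrite -[leRHS]mulr1 ler_pM2l//; lra.
have : 0 <= d * (s - j) by rewrite mulr_ge0// ?subr_ge0// ltW.
move=> h3 h4; apply/andP; split; lra.
Qed.

Local Open Scope ereal_scope.

(** The map from k to an index j with [ln w(j)] near k, and the map from j to the
    integer part of [ln w(j)], both have fibres of bounded size. *)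
Lemma change_var (E : ri_space R) (T : Type) (H : T -> R -> \bar R) (d : R) (w : R -> R) :
  (forall x s, 0 <= H x s) ->
  (forall D : R, exists2 C : R, (0 < C)%R & forall x (s r : R), (`|s - r| <= D)%R ->
     H x s <= C%:E * H x r) ->
  (0 < d)%R -> regvar d w ->
  eqsim (fun x => seqnorm E (fun k : int => H x k%:~R))
        (fun x => seqnorm E (fun k : int => H x (ln (w k%:~R)))).
Proof.
move=> H0 HD d0 hw; split.
- have [D D0 hD] := regvar_onto d0 hw.
  have [t ht] := choice (fun k : int => hD k%:~R).
  have [C C0 hC] := HD D.
  pose N := (Num.truncn (2 * D)).+1.
  have N1 : (2 * D < N%:R)%R by exact: truncnS_gt.
  exists (C * N%:R)%R => [|x]; first by rewrite mulr_gt0.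
  pose c k := H x (ln (w k%:~R)).
  have fib : forall i j, t i = t j -> (`|i - j| < N)%N.
    move=> i j ij; rewrite -(ltr_nat R) dist_intr; apply: le_lt_trans N1.
    have := ht i; have := ht j; rewrite ij !ler_norml; set a := ln _.
    by move=> /andP[? ?] /andP[? ?]; apply/andP; split; lra.
  apply: (@le_trans _ _ (seqnorm E (fun k => C%:E * c (t k)))).
    apply: seqnorm_le => // k; apply: hC; rewrite distrC; exact: ht.
  have c0 k : 0 <= c k by exact: H0.
  rewrite (seqnormZ E (ltW C0) (fun k => c0 (t k))) EFinM -muleA.
  apply: lee_wpmul2l; first by rewrite lee_fin ltW.
  exact: seqnorm_fiber c0 fib.
- have [C C0 hC] := HD 1%R.
  have [B B0 hB] := regvar_ln hw (divr_gt0 d0 (ltr0n R 2)).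
  pose N := (Num.truncn ((1 + B) * 2 / d)).+1.
  have N1 : ((1 + B) * 2 / d < N%:R)%R by exact: truncnS_gt.
  pose t (k : int) : int := Num.floor (ln (w k%:~R)).
  exists (C * N%:R)%R => [|x]; first by rewrite mulr_gt0.
  pose c (k : int) := H x k%:~R.
  have fib : forall i j, t i = t j -> (`|i - j| < N)%N.
    move=> i j ij; rewrite -(ltr_nat R) dist_intr; apply: le_lt_trans N1.
    rewrite ler_pdivlMr//.
    have /andP[] := floor_itv (ln (w i%:~R)); have /andP[] := floor_itv (ln (w j%:~R)).
    rewrite -/(t i) -/(t j) ij intrD; have := hB i%:~R j%:~R.
    set a := ln _; set a' := ln _; set x1 := (i%:~R - j%:~R)%R; set u := (t j)%:~R.
    rewrite ler_norml => /andP[h1 h2] h3 h4 h5 h6.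
    have : (`|d * x1| <= d / 2 * `|x1| + B + 1)%R.
      by rewrite ler_norml; apply/andP; split; lra.
    by rewrite normrM gtr0_norm//; lra.
  apply: (@le_trans _ _ (seqnorm E (fun k => C%:E * c (t k)))).
    apply: seqnorm_le => // k; apply: hC.
    have /andP[] := floor_itv (ln (w k%:~R)); rewrite -/(t k) intrD => h1 h2.
    by rewrite ger0_norm ?subr_ge0//; lra.
  have c0 k : 0 <= c k by exact: H0.
  rewrite (seqnormZ E (ltW C0) (fun k => c0 (t k))) EFinM -muleA.
  apply: lee_wpmul2l; first by rewrite lee_fin ltW.
  exact: seqnorm_fiber c0 fib.
Qed.

End change.

(** * The K-functional of a compatible couple *)

Section Kfun.
Context {R : realType} {V : lmodType R}.
Local Open Scope ereal_scope.
Implicit Types (XX : qspace V * qspace V) (f g : V).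

Definition nneg_couple XX :=
  (forall f, carrier XX.1 f -> 0 <= qnorm XX.1 f) /\
  (forall f, carrier XX.2 f -> 0 <= qnorm XX.2 f).

Section nneg.
Variable XX : qspace V * qspace V.
Hypothesis X0 : nneg_couple XX.

Lemma Kfun_le (t : R) f p : decomp XX f p ->
  Kfun XX t f <= qnorm XX.1 p.1 + t%:E * qnorm XX.2 p.2.
Proof. by move=> fp; apply: ereal_inf_lbound; exists p. Qed.

Lemma Kfun_ge0 (t : R) f : (0 <= t)%R -> 0 <= Kfun XX t f.
Proof.
move=> t0; apply: le_ereal_inf_tmp => _ [p [p1 p2 _] <-].
by rewrite adde_ge0 ?mule_ge0 ?lee_fin//; [exact: X0.1|exact: X0.2].
Qed.

Lemma Kfun_mono (t s : R) f : (t <= s)%R -> Kfun XX t f <= Kfun XX s f.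
Proof.
move=> ts; apply: le_ereal_inf_tmp => _ [p fp <-].
apply: (le_trans (Kfun_le t fp)); case: fp => p1 p2 _.
by apply: leeD2l; apply: lee_wpmul2r; [exact: X0.2|rewrite lee_fin].
Qed.

Lemma Kfun_scale (t l : R) f : (0 <= t)%R -> (1 <= l)%R ->
  Kfun XX (l * t) f <= l%:E * Kfun XX t f.
Proof.
move=> t0 l1; have l0 : (0 < l)%R by exact: lt_le_trans l1.
rewrite muleC -lee_pdivrMr//; apply: le_ereal_inf_tmp => _ [p fp <-].
rewrite lee_pdivrMr//; apply: (le_trans (Kfun_le _ fp)); case: fp => p1 p2 _.
have q1 := X0.1 _ p1; have q2 := X0.2 _ p2.
have tq : 0 <= t%:E * qnorm XX.2 p.2 by rewrite mule_ge0.
rewrite [leRHS]muleC ge0_muleDr// EFinM -muleA; apply: leeD2r.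
by rewrite -[leLHS]mul1e; apply: lee_wpmul2r => //; rewrite lee_fin.
Qed.

Lemma Kfun_expR (s r : R) f :
  Kfun XX (expR s) f <= (expR (Num.max 0 (s - r)))%:E * Kfun XX (expR r) f.
Proof.
have [rs|sr] := leP 0%R (s - r)%R.
  have -> : expR s = (expR (s - r) * expR r)%R by rewrite -expRD subrK.
  apply: Kfun_scale; first exact: expR_ge0.
  by rewrite -expR0 ler_expR.
rewrite expR0 mul1e; apply: Kfun_mono; rewrite ler_expR; lra.
Qed.

Lemma Kfun_near (D s r : R) f : (`|s - r| <= D)%R ->
  Kfun XX (expR s) f <= (expR D)%:E * Kfun XX (expR r) f.
Proof.
move=> sr; apply: (le_trans (Kfun_expR s r f)); apply: lee_wpmul2r.
  by apply: Kfun_ge0; exact: expR_ge0.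
rewrite lee_fin ler_expR ge_max (le_trans _ sr)//=; apply: le_trans sr.
exact: ler_norm.
Qed.

End nneg.
End Kfun.

Section couple.
Context {R : realType} {V : topologicalLmodType R}.
Local Open Scope ereal_scope.
Variable XX : qspace V * qspace V.
Hypothesis hX : compatible_couple XX.

Lemma couple_nneg : nneg_couple XX.
Proof.
by split=> f cf; [have := qb_fin (cc_X0 hX) cf|have := qb_fin (cc_X1 hX) cf];
  move=> /andP[].
Qed.

Lemma Kfun_lty (t : R) f : decomp XX f !=set0 -> (0 <= t)%R -> Kfun XX t f < +oo.
Proof.
move=> [p fp] t0; apply: le_lt_trans (Kfun_le t fp) _; case: fp => p1 p2 _.
have /andP[h1 h2] := qb_fin (cc_X0 hX) p1.
have /andP[h3 h4] := qb_fin (cc_X1 hX) p2.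
by rewrite lte_add_pinfty// lte_mul_pinfty.
Qed.

Lemma decomp0 : decomp XX 0%R (0%R, 0%R).
Proof. by split; rewrite /= ?addr0//; [exact: qb_0 (cc_X0 hX)|exact: qb_0 (cc_X1 hX)]. Qed.

Lemma qnorm0 (X : qspace V) : quasi_Banach X -> qnorm X 0%R = 0.
Proof.
move=> hq; have := qb_normZ hq 0%R (qb_0 hq).
by rewrite scale0r normr0 mul0e.
Qed.

Lemma qnormN (X : qspace V) x : quasi_Banach X -> carrier X x ->
  carrier X (- x)%R /\ qnorm X (- x)%R = qnorm X x.
Proof.
move=> hq cx; rewrite -scaleN1r; split; first exact: qb_Z.
by rewrite qb_normZ// normrN1 mul1e.
Qed.

Lemma decompD f g : decomp XX f !=set0 -> decomp XX g !=set0 ->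
  decomp XX (f + g)%R !=set0.
Proof.
move=> [p [p1 p2 ->]] [q [q1 q2 ->]]; exists (p.1 + q.1, p.2 + q.2)%R.
split => /=; [exact: qb_D (cc_X0 hX) _ _ p1 q1|exact: qb_D (cc_X1 hX) _ _ p2 q2|].
by rewrite addrACA.
Qed.

Lemma decomp_l f : carrier XX.1 f -> decomp XX f (f, 0%R).
Proof. by move=> cf; split; rewrite /= ?addr0//; exact: qb_0 (cc_X1 hX). Qed.

Lemma decomp_r f : carrier XX.2 f -> decomp XX f (0%R, f).
Proof. by move=> cf; split; rewrite /= ?add0r//; exact: qb_0 (cc_X0 hX). Qed.

Lemma Kfun_l f (t : R) : carrier XX.1 f -> Kfun XX t f <= qnorm XX.1 f.
Proof.
move=> /decomp_l h; apply: (le_trans (Kfun_le t h)) => /=.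
by rewrite (qnorm0 (cc_X1 hX)) mule0 adde0.
Qed.

Lemma Kfun_r f (t : R) : carrier XX.2 f -> Kfun XX t f <= t%:E * qnorm XX.2 f.
Proof.
move=> /decomp_r h; apply: (le_trans (Kfun_le t h)) => /=.
by rewrite (qnorm0 (cc_X0 hX)) add0e.
Qed.

Lemma KfunD : exists2 C : R, (0 < C)%R & forall t f g, (0 <= t)%R ->
  decomp XX f !=set0 -> decomp XX g !=set0 ->
  Kfun XX t (f + g)%R <= C%:E * (Kfun XX t f + Kfun XX t g).
Proof.
have [C0 hC0] := qb_normD (cc_X0 hX); have [C1 hC1] := qb_normD (cc_X1 hX).
pose C := (`|C0| + `|C1| + 1)%R.
have Cp : (0 < C)%R by rewrite /C; have := normr_ge0 C0; have := normr_ge0 C1; lra.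
exists C => // t f g t0 df dg.
have Kf : Kfun XX t f \is a fin_num.
  by rewrite ge0_fin_numE ?Kfun_lty// Kfun_ge0//; exact: couple_nneg.
have key p q : decomp XX f p -> decomp XX g q -> Kfun XX t (f + g)%R <=
    C%:E * ((qnorm XX.1 p.1 + t%:E * qnorm XX.2 p.2) +
            (qnorm XX.1 q.1 + t%:E * qnorm XX.2 q.2)).
  move=> [p1 p2 fE] [q1 q2 gE].
  have /andP[np1 _] := qb_fin (cc_X0 hX) p1; have /andP[np2 _] := qb_fin (cc_X1 hX) p2.
  have /andP[nq1 _] := qb_fin (cc_X0 hX) q1; have /andP[nq2 _] := qb_fin (cc_X1 hX) q2.
  have dfg : decomp XX (f + g)%R (p.1 + q.1, p.2 + q.2)%R.
    split => /=; [exact: qb_D (cc_X0 hX) _ _ p1 q1|exact: qb_D (cc_X1 hX) _ _ p2 q2|].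
    by rewrite fE gE addrACA.
  apply: (le_trans (Kfun_le t dfg)) => /=.
  rewrite addeACA -ge0_muleDr//.
  have h3 := adde_ge0 np1 nq1; have h4 : 0 <= t%:E * (qnorm XX.2 p.2 + qnorm XX.2 q.2).
    by rewrite mule_ge0// adde_ge0.
  rewrite [leRHS]ge0_muleDr//.
  apply: leeD.
    apply: (le_trans (hC0 _ _ p1 q1)); apply: lee_wpmul2r; first exact: adde_ge0.
    by rewrite lee_fin /C; have := ler_norm C0; have := normr_ge0 C1; lra.
  rewrite muleCA; apply: lee_wpmul2l => //.
  apply: (le_trans (hC1 _ _ p2 q2)); apply: lee_wpmul2r; first exact: adde_ge0.
  by rewrite lee_fin /C; have := ler_norm C1; have := normr_ge0 C0; lra.
rewrite muleC -lee_pdivrMr// addeC -leeBlDr//.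
apply: le_ereal_inf_tmp => _ [q gq <-].
rewrite leeBlDr// addeC -leeBlDr; last first.
  case: (gq) => q1 q2 _.
  have /andP[h1 h2] := qb_fin (cc_X0 hX) q1; have /andP[h3 h4] := qb_fin (cc_X1 hX) q2.
  by rewrite ge0_fin_numE ?adde_ge0 ?mule_ge0// lte_add_pinfty// lte_mul_pinfty.
apply: le_ereal_inf_tmp => _ [p fp <-].
rewrite leeBlDr; last first.
  case: (gq) => q1 q2 _.
  have /andP[h1 h2] := qb_fin (cc_X0 hX) q1; have /andP[h3 h4] := qb_fin (cc_X1 hX) q2.
  by rewrite ge0_fin_numE ?adde_ge0 ?mule_ge0// lte_add_pinfty// lte_mul_pinfty.
by rewrite lee_pdivrMr// muleC; exact: key.
Qed.

(** Both pieces of f can be taken small, hence near 0 in the ambient Hausdorff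
    space. *)
Lemma Kfun_eq0 (t : R) f : (0 < t)%R -> Kfun XX t f = 0 -> f = 0%R.
Proof.
move=> t0 Kf; apply/esym/(cc_hausdorff hX) => U W U0 Wf; exists f.
split; last exact: nbhs_singleton.
have U0' : nbhs (0%R + 0%R : V)%R U by rewrite addr0.
have [[A B] /= [A0 B0] AB] := @add_continuous V (0%R, 0%R) U U0'.
have [d d0 hd] := qb_embedding (cc_X0 hX) A0.
have [e e0 he] := qb_embedding (cc_X1 hX) B0.
pose m := Num.min d (t * e)%R.
have m0 : (0 < m)%R by rewrite lt_min d0 mulr_gt0.
have : Kfun XX t f < m%:E by rewrite Kf lte_fin.
move=> /ereal_inf_lt [_ [p [p1 p2 fE] <-]] pm.
have n1 := couple_nneg.1 _ p1; have n2 := couple_nneg.2 _ p2.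
rewrite fE; apply: (AB p); split => /=; [apply: hd|apply: he] => //.
- apply: (le_lt_trans _ (lt_le_trans pm _)); last by rewrite lee_fin ge_min lexx.
  by rewrite leeDl// mule_ge0// lee_fin ltW.
- rewrite -(@lte_pmul2l _ t%:E)// -?EFinM.
  apply: (le_lt_trans _ (lt_le_trans pm _)); last by rewrite lee_fin ge_min lexx orbT.
  by rewrite leeDr.
Qed.

(** When the infimum vanishes it is attained, because f is 0. *)
Lemma Kfun_opt (t : R) f : (0 < t)%R -> decomp XX f !=set0 ->
  exists2 p, decomp XX f p & qnorm XX.1 p.1 + t%:E * qnorm XX.2 p.2 <= 2%:E * Kfun XX t f.
Proof.
move=> t0 df; have K0 : 0 <= Kfun XX t f by apply: Kfun_ge0 (ltW t0); exact: couple_nneg.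
have [K00|Kn0] := eqVneq (Kfun XX t f) 0.
  exists (0%R, 0%R); first by rewrite (Kfun_eq0 t0 K00); exact: decomp0.
  by rewrite /= (qnorm0 (cc_X0 hX)) (qnorm0 (cc_X1 hX)) mule0 add0e K00 mule0.
have Kp : 0 < Kfun XX t f by rewrite lt0e Kn0.
have Kfin : Kfun XX t f \is a fin_num by rewrite ge0_fin_numE// Kfun_lty// ltW.
have : Kfun XX t f < 2%:E * Kfun XX t f.
  rewrite -(fineK Kfin) -EFinM lte_fin ltr_pMl ?ltr1n//.
  by rewrite -lte_fin fineK.
by move=> /ereal_inf_lt [_ [p fp <-]] /ltW h; exists p.
Qed.

End couple.

Lemma es_eq {R : realType} T (f g : T -> \bar R) : (forall x, f x = g x) -> eqsim f g.
Proof. by move=> /funext ->; exact: es_refl. Qed.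

(** * The reiterated spaces in terms of sequences *)

(** The norm of a slowly varying function b on (0, u), as a function of u. *)
Section cum.
Context {R : realType} (E : ri_space R) (b : R -> R).
Local Open Scope ereal_scope.
Hypothesis hb : SV b.
Hypothesis bfin : tnorm_on E `]0%R, 1%R[ (EFin \o b) < +oo.

Let b0 (t : R) : (0 < t)%R -> (0 < b t)%R. Proof. exact: SV_gt0. Qed.
Let rvb := SV_regvar hb.
Let bs (k : int) : R := b (expR k%:~R).
Let bs0 k : 0 <= (bs k)%:E. Proof. by rewrite lee_fin ltW// b0// expR_gt0. Qed.

(** A shift by [j - k] turns the range up to j into the range up to k and changes
    b by a slowly varying factor. *)
Lemma cumnorm_slow (e : R) : (0 < e)%R -> exists2 C : R, (0 < C)%R &
  forall j k : int, cumnorm E bs j <= (C * expR (e * `|j%:~R - k%:~R|))%:E * cumnorm E bs k.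
Proof.
move=> e0; have [_ /(_ e e0) [C C0 hC]] := rvb; exists C => // j k.
have X0 : (0 <= C * expR (e * `|j%:~R - k%:~R|))%R by rewrite mulr_ge0 ?expR_ge0 ?(ltW C0).
have r0 (l : int) i : 0 <= restr (fun i => i <= l)%R (fun i => (bs i)%:E) i.
  exact: restr_ge0.
rewrite {1}/cumnorm -(seqnorm_shift E (j - k)%R (r0 j)) -(seqnormZ E X0 (r0 k)).
apply: seqnorm_le => i; first exact: r0.
rewrite /restr; have -> : (i + (j - k) <= j)%R = (i <= k)%R by apply/idP/idP; lia.
case: ifP => _; last by rewrite mule0.
rewrite -EFinM lee_fin; have := hC (i + (j - k))%:~R i%:~R.
have -> : ((i + (j - k))%:~R - i%:~R = j%:~R - k%:~R :> R)%R.
  by rewrite intrD addrAC subrr add0r intrD mulrNz.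
by rewrite mul0r add0r.
Qed.

Lemma cumnorm_gt0 k : 0 < cumnorm E bs k.
Proof.
have u0 i : 0 <= unit_seq k i :> \bar R by rewrite lee_fin.
apply: (@lt_le_trans _ _ (seqnorm E (fun i => (bs k)%:E * unit_seq k i))).
  rewrite seqnormZ//; last by rewrite -lee_fin bs0.
  have [U U0 ->] := seqnorm_unit E.
  by rewrite mule_gt0// lte_fin b0// expR_gt0.
apply: seqnorm_le => i; first by rewrite mule_ge0.
rewrite /unit_seq; case: eqP => [->|_]; last by rewrite mule0 restr_ge0.
by rewrite /restr lexx mule1.
Qed.

Lemma cumnorm_lty k : cumnorm E bs k < +oo.
Proof.
have [_ [C C0 hC]] := tnorm_cum_es E b0 rvb.
have [D D0 hD] := cumnorm_slow ltr01.
apply: (le_lt_trans (hD k 0%R)); apply: lte_mul_pinfty; [|by []|].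
  by rewrite lee_fin mulr_ge0 ?expR_ge0 ?(ltW D0).
have := hC 0%R; rewrite floor0 expR0 => /le_lt_trans; apply.
by apply: lte_mul_pinfty; [rewrite lee_fin ltW|by []|exact: bfin].
Qed.

Definition cumfun (u : R) : R := fine (tnorm_on E `]0%R, u[%R (EFin \o b)).

Lemma cumfunE s : (cumfun (expR s))%:E = tnorm_on E `]0%R, expR s[%R (EFin \o b).
Proof.
rewrite /cumfun fineK; first by [].
rewrite ge0_fin_numE; last exact: tnorm_ge0.
have [[C C0 hC] _] := tnorm_cum_es E b0 rvb.
apply: (le_lt_trans (hC s)); apply: lte_mul_pinfty.
- by rewrite lee_fin ltW.
- by [].
- exact: cumnorm_lty.
Qed.

Lemma cumfun_es : eqsim (fun s => (cumfun (expR s))%:E) (fun s => cumnorm E bs (Num.floor s)).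
Proof.
have [h1 h2] := tnorm_cum_es E b0 rvb.
by split; [have := h1|have := h2]; move=> [C C0 hC];
  (exists C; [exact: C0|]) => s; rewrite cumfunE; exact: hC.
Qed.

Lemma cumnorm_es : eqsim (cumnorm E bs) (fun k : int => (cumfun (expR k%:~R))%:E).
Proof.
apply: es_sym; have [[C C0 hC] [D D0 hD]] := cumfun_es.
split; [exists C; [exact: C0|]|exists D; [exact: D0|]] => k.
- by have := hC k%:~R; rewrite /= intrKfloor; apply.
- by have := hD k%:~R; rewrite /= intrKfloor; apply.
Qed.

Lemma cumfun_gt0 s : (0 < cumfun (expR s))%R.
Proof.
have [_ [C C0 hC]] := cumfun_es.
have := lt_le_trans (cumnorm_gt0 (Num.floor s)) (hC s).
by rewrite -EFinM lte_fin pmulr_rgt0.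
Qed.

Lemma cumfun_regvar : regvar 0 (fun s => cumfun (expR s)).
Proof.
split=> [|e e0]; first exact: cumfun_gt0.
have [D D0 hD] := cumnorm_slow e0.
have [[C C0 hC] [C' C'0 hC']] := cumfun_es.
exists (C * (D * expR e) * C')%R => [|s r]; first by rewrite !mulr_gt0// expR_gt0.
rewrite mul0r add0r -lee_fin.
apply: (le_trans (hC s)).
have h1 := hC' r; have h2 := hD (Num.floor s) (Num.floor r).
have C0' : 0 <= C%:E by rewrite lee_fin ltW.
apply: (le_trans (lee_wpmul2l C0' h2)).
have X0 : 0 <= (D * expR (e * `|(Num.floor s)%:~R - (Num.floor r)%:~R|))%:E.
  by rewrite lee_fin mulr_ge0 ?expR_ge0 ?(ltW D0).
apply: (le_trans (lee_wpmul2l C0' (lee_wpmul2l X0 h1))).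
rewrite -!EFinM lee_fin -!mulrA ler_pM2l// ler_pM2l// !mulrA ler_pM2r ?cumfun_gt0//.
rewrite -!mulrA [leRHS]mulrCA [leRHS]mulrC [leRHS]mulrAC -!mulrA.
rewrite mulrC [leRHS]mulrC -!mulrA ler_pM2l//.
rewrite -expRD ler_expR.
have /andP[f1 f2] := floor_itv s; have /andP[f3 f4] := floor_itv r.
rewrite !intrD in f2 f4.
have : (`|(Num.floor s)%:~R - (Num.floor r)%:~R| <= `|s - r| + 1)%R.
  have := ler_norm (s - r); have := ler_norm (r - s); rewrite distrC => h3 h4.
  by rewrite ler_norml; apply/andP; split; lra.
by rewrite -(ler_pM2l e0); lra.
Qed.

End cum.

Section spaces.
Context {R : realType} {V : topologicalLmodType R}.
Variable XX : qspace V * qspace V.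
Hypothesis hX : compatible_couple XX.
Local Open Scope ereal_scope.

(** Vectors which have a K-functional; bundling the condition keeps it out of
    every domination. *)
Definition ssum := {f : V | decomp XX f !=set0}.
Definition Kseq (f : ssum) (k : int) : \bar R := Kfun XX (expR k%:~R) (sval f).

Let X0 := couple_nneg hX.

Lemma Kseq_ge0 f k : 0 <= Kseq f k.
Proof. by apply: Kfun_ge0 => //; exact: expR_ge0. Qed.

Lemma Kseq_lty f k : Kseq f k < +oo.
Proof. by apply: Kfun_lty; [exact: hX|exact: (svalP f)|exact: expR_ge0]. Qed.

Section weight.
Variables (th : R) (a : R -> R).
Hypothesis ha : regvar 0 (fun s => a (expR s)).

Definition weight (s : R) : R := (expR (- th * s) * a (expR s))%R.

Lemma weight_regvar : regvar (- th) weight.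
Proof.
by have := regvarM (regvar_expR (- th)) ha; rewrite addr0.
Qed.

Let wt0 s : (0 < weight s)%R. Proof. by case: weight_regvar. Qed.
Let wtE0 s : 0 <= (weight s)%:E. Proof. by rewrite lee_fin ltW. Qed.

Definition Kweighted (f : ssum) (k : int) : \bar R := (weight k%:~R)%:E * Kseq f k.

Lemma Kweighted_ge0 f k : 0 <= Kweighted f k.
Proof. by apply: mule_ge0; [exact: wtE0|exact: Kseq_ge0]. Qed.

Lemma Kweight_expR (k : R -> \bar R) s :
  Kweight th a k (expR s) = (weight s)%:E * k (expR s).
Proof. by rewrite /Kweight /weight /powR gt_eqF ?expR_gt0// expRK. Qed.

Lemma Kweight_ge0 (f : ssum) t : (0 < t)%R -> 0 <= Kweight th a (Kfun XX ^~ (sval f)) t.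
Proof.
move=> t0; rewrite -(lnK t0) Kweight_expR; apply: mule_ge0; first exact: wtE0.
by apply: Kfun_ge0; [exact: X0|exact: expR_ge0].
Qed.

Lemma Kweight_es :
  eqsim (fun p : ssum * R => Kweight th a (Kfun XX ^~ (sval p.1)) (expR p.2))
        (fun p => Kweighted p.1 (Num.floor p.2)).
Proof.
rewrite (_ : (fun p : ssum * R => _) = (fun p => (weight p.2)%:E * Kfun XX (expR p.2) (sval p.1))); last first.
  by apply/funext => p; rewrite Kweight_expR.
apply: esM.
- by move=> p; exact: wtE0.
- by move=> p; apply: Kfun_ge0; [exact: X0|exact: expR_ge0].
- by move=> p; exact: wtE0.
- by move=> p; exact: Kseq_ge0.
- exact: (es_comp snd (regvar_floor weight_regvar)).
- split; (exists (expR 1); first exact: expR_gt0) => -[f s] /=;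
    apply: (Kfun_near X0); first exact: near_floor.
  by rewrite distrC; exact: near_floor.
Qed.

Lemma Kweighted_shift (q : int) :
  (fun p : ssum * int => Kweighted p.1 p.2) <~ (fun p => Kweighted p.1 (p.2 + q)%R).
Proof.
apply: lsM.
- by move=> p; exact: wtE0.
- by move=> p; exact: Kseq_ge0.
- have [C C0 hC] := regvar_near `|q%:~R| weight_regvar; apply: (ls_fin C0) => -[f k] /=; apply: hC.
  by rewrite intrD opprD addrA subrr sub0r normrN.
- exists (expR `|q%:~R|); first exact: expR_gt0.
  move=> -[f k] /=; apply: (Kfun_near X0).
  by rewrite intrD opprD addrA subrr sub0r normrN.
Qed.

Lemma spaceK_es (E : ri_space R) :
  eqsim (fun f : ssum => qnorm (spaceK XX th a E) (sval f)) (fun f => seqnorm E (Kweighted f)).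
Proof.
apply: (@tnorm_es _ ssum E (fun (f : ssum) t => Kweight th a (Kfun XX ^~ (sval f)) t) Kweighted).
- by move=> f t; exact: Kweight_ge0.
- exact: Kweighted_ge0.
- exact: Kweight_es.
Qed.

Section spaceR.
Variables (F : ri_space R) (b : R -> R).
Hypothesis b0 : forall t, (0 < t)%R -> (0 < b t)%R.
Hypothesis rvb : regvar 0 (fun s => b (expR s)).
Let bs (k : int) : R := b (expR k%:~R).
Let bE0 s : 0 <= (b (expR s))%:E. Proof. by rewrite lee_fin ltW// b0// expR_gt0. Qed.
Let bs0 k : 0 <= (bs k)%:E. Proof. exact: bE0. Qed.

(** The outcome is again comparable with a sequence on each block, so the step
    can be repeated, as in [spaceRR_es]. *)
Lemma tail_es :
  eqsim (fun p : ssum * R => (b (expR p.2))%:E *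
           tnorm_on F `]expR p.2, +oo[%R (Kweight th a (Kfun XX ^~ (sval p.1))))
        (fun p => (bs (Num.floor p.2))%:E * tailnorm F (Kweighted p.1) (Num.floor p.2)).
Proof.
apply: esM.
- by move=> p; exact: bE0.
- by move=> p; exact: tnorm_ge0.
- by move=> p; exact: bs0.
- by move=> p; exact: seqnorm_ge0.
- exact: (es_comp snd (regvar_floor rvb)).
- apply: (@tnorm_tail_es _ ssum F (fun (f : ssum) t => Kweight th a (Kfun XX ^~ (sval f)) t) Kweighted).
  + by move=> f t; exact: Kweight_ge0.
  + exact: Kweighted_ge0.
  + exact: Kweight_es.
  + exact: Kweighted_shift.
Qed.

Let tl_ge0 (x : ssum) t : (0 < t)%R -> 0 <= (b t)%:E *
  tnorm_on F `]t, +oo[%R (Kweight th a (Kfun XX ^~ (sval x))).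
Proof. by move=> t0; apply: mule_ge0; [rewrite lee_fin ltW// b0|exact: tnorm_ge0]. Qed.

Lemma spaceR_es (E : ri_space R) :
  eqsim (fun f : ssum => qnorm (spaceR XX th b E a F) (sval f))
        (fun f => iternorm E bs F (fun i k => i <= k)%R (Kweighted f)).
Proof.
apply: (@tnorm_es _ ssum E (fun (f : ssum) t => (b t)%:E *
     tnorm_on F `]t, +oo[%R (Kweight th a (Kfun XX ^~ (sval f))))
   (fun f i => (bs i)%:E * tailnorm F (Kweighted f) i)).
- exact: tl_ge0.
- by move=> f k; apply: mule_ge0; [by []|exact: seqnorm_ge0].
- exact: tail_es.
Qed.

Variables (c : R -> R).
Hypothesis c0 : forall t, (0 < t)%R -> (0 < c t)%R.
Hypothesis rvc : regvar 0 (fun s => c (expR s)).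
Let cs (k : int) : R := c (expR k%:~R).
Let cE0 s : 0 <= (c (expR s))%:E. Proof. by rewrite lee_fin ltW// c0// expR_gt0. Qed.
Let cs0 k : 0 <= (cs k)%:E. Proof. exact: cE0. Qed.

Lemma spaceRR_es (E G : ri_space R) :
  eqsim (fun f : ssum => qnorm (spaceRR XX th c E b G a F) (sval f))
        (fun f => seqnorm E (fun j => (cs j)%:E *
           iternorm G bs F (fun i k => (i <= k) && (j <= i))%R (Kweighted f))).
Proof.
have tail0 (f : ssum) k : 0 <= (bs k)%:E * tailnorm F (Kweighted f) k.
  by apply: mule_ge0; [exact: bs0|exact: seqnorm_ge0].
apply: (@es_trans _ _ _ (fun f => seqnorm E (fun j => (cs j)%:E *
   tailnorm G (fun i => (bs i)%:E * tailnorm F (Kweighted f) i) j))).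
  apply: (@tnorm_es _ ssum E (fun (f : ssum) u => (c u)%:E * tnorm_on G `]u, +oo[%R
     (fun t => (b t)%:E * tnorm_on F `]t, +oo[%R (Kweight th a (Kfun XX ^~ (sval f)))))).
  - by move=> f t t0; apply: mule_ge0; [rewrite lee_fin ltW// c0|exact: tnorm_ge0].
  - by move=> f k; apply: mule_ge0; [by []|exact: seqnorm_ge0].
  apply: esM.
  - by move=> p; exact: cE0.
  - by move=> p; exact: tnorm_ge0.
  - by move=> p; exact: cs0.
  - by move=> p; exact: seqnorm_ge0.
  - exact: (es_comp snd (regvar_floor rvc)).
  apply: (@tnorm_tail_es _ ssum G (fun (f : ssum) t => (b t)%:E *
      tnorm_on F `]t, +oo[%R (Kweight th a (Kfun XX ^~ (sval f))))
    (fun f i => (bs i)%:E * tailnorm F (Kweighted f) i)) => //.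
  - exact: tail_es.
  apply: lsM.
  - by move=> p; exact: bs0.
  - by move=> p; exact: seqnorm_ge0.
  - have [C C0 hC] := regvar_near 1 rvb; apply: (ls_fin C0) => -[f k] /=; apply: hC.
    by rewrite intrD opprD addrA subrr sub0r normrN normr1.
  - rewrite /tailnorm; apply: (@restr_shift _ _ (fun p : ssum * int => Kweighted p.1) 1%R _ _ F
      (fun p k => (p.2 <= k)%R) (fun p k => (p.2 + 1 <= k)%R)).
    + by move=> *; exact: Kweighted_ge0.
    + exact: (ls_comp (fun p : (ssum * int) * int => (p.1.1, p.2)) (Kweighted_shift 1)).
    + by move=> p k; lia.
apply: es_eq => f; apply: (f_equal (seqnorm E)); apply/funext => j.
apply: (f_equal (fun z => (cs j)%:E * z)); apply: (f_equal (seqnorm G)); apply/funext => i.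
rewrite {1}/restr; case: ifPn => ji.
  by congr (_ * seqnorm F _); apply/funext => k; rewrite /restr andbT.
rewrite (_ : restr _ _ = (fun k : int => 0%R%:E * 0)).
  by rewrite (seqnormZ F (lexx _) (fun=> lexx _)) mul0e mule0.
by apply/funext => k; rewrite mul0e /restr andbF.
Qed.

Lemma spaceRL_es (E G : ri_space R) :
  eqsim (fun f : ssum => qnorm (spaceRL XX th c E b G a F) (sval f))
        (fun f => seqnorm E (fun j => (cs j)%:E *
           iternorm G bs F (fun i k => (i <= k) && (k <= j))%R (Kweighted f))).
Proof.
apply: (@tnorm_es _ ssum E (fun (f : ssum) u => (c u)%:E * tnorm_on G `]0%R, u[%R
     (fun t => (b t)%:E * tnorm_on F `]t, u[%R (Kweight th a (Kfun XX ^~ (sval f)))))).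
- by move=> f t t0; apply: mule_ge0; [rewrite lee_fin ltW// c0|exact: tnorm_ge0].
- by move=> f k; apply: mule_ge0; [by []|exact: seqnorm_ge0].
apply: esM.
- by move=> p; exact: cE0.
- by move=> p; exact: tnorm_ge0.
- by move=> p; exact: cs0.
- by move=> p; exact: seqnorm_ge0.
- exact: (es_comp snd (regvar_floor rvc)).
apply: (@tnorm_square_es _ ssum F (fun (f : ssum) t => Kweight th a (Kfun XX ^~ (sval f)) t) Kweighted) => //.
- by move=> f t; exact: Kweight_ge0.
- exact: Kweighted_ge0.
- exact: Kweight_es.
- exact: Kweighted_shift.
Qed.

End spaceR.
End weight.
End spaces.

(** * The Holmstedt formula *)

Section weight_series.
Context {R : realType}.
Local Open Scope ereal_scope.

Lemma series_geo (e : R) : (0 < e)%R -> exists2 G : R, (0 < G)%R &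
  forall (v : nat -> \bar R) y (C : R), 0 <= y -> (0 < C)%R -> (forall m, 0 <= v m) ->
    (forall m, v m <= C%:E * ((expR (- e * m%:R))%:E * y)) ->
    \sum_(m <oo) v m <= (C * G)%:E * y.
Proof.
move=> e0; have [G G0 geo] := geometric_le e0; exists G => // v y C y0 C0 v0 vC.
apply: (@le_trans _ _ (\sum_(m <oo) C%:E * ((expR (- e * m%:R))%:E * y))).
  by apply: lee_nneseries => // m _; exact: vC.
rewrite nneseriesZl; last by move=> m _; rewrite mule_ge0// lee_fin expR_ge0.
rewrite EFinM -muleA; apply: lee_wpmul2l; first by rewrite lee_fin ltW.
exact: geo.
Qed.

Lemma regvar_fwd (g : R) (w : R -> R) : regvar g w -> (g < 0)%R ->
  exists2 C : R, (0 < C)%R & exists2 e : R, (0 < e)%R &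
  forall (j : int) (m : nat), (w (j + m%:Z)%:~R <= C * (expR (- e * m%:R) * w j%:~R))%R.
Proof.
move=> hw g0; have [C C0 hC] := regvar_decr hw g0; exists C => //; exists (- (g / 2))%R; first lra.
move=> j m; have := hC (j + m%:Z)%:~R j%:~R.
rewrite ler_int lerDl lez_nat leq0n => /(_ isT) /le_trans; apply.
by rewrite intrD addrAC subrr add0r opprK mulrA.
Qed.

Lemma regvar_bwd (g : R) (w : R -> R) : regvar g w -> (0 < g)%R ->
  exists2 C : R, (0 < C)%R & exists2 e : R, (0 < e)%R &
  forall (j : int) (m : nat), (w (j - m%:Z)%:~R <= C * (expR (- e * m%:R) * w j%:~R))%R.
Proof.
move=> hw g0; have [C C0 hC] := regvar_incr hw g0; exists C => //; exists (g / 2)%R; first lra.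
move=> j m; have := hC (j - m%:Z)%:~R j%:~R.
rewrite ler_int lerBlDr lerDl lez_nat leq0n => /(_ isT) /le_trans; apply.
by rewrite intrD mulrNz opprD opprK addrA subrr add0r mulrA.
Qed.

Variables (E F : ri_space R) (b a : R -> R) (th : R).
Hypotheses (hb : SV b) (ha : regvar 0 (fun s => a (expR s))).
Hypothesis bfin : tnorm_on E `]0%R, 1%R[ (EFin \o b) < +oo.
Let bs (k : int) : R := b (expR k%:~R).

(** The factor [w(k)] such that the iterated norm of the sequence reduced to its
    term of index k is [w(k) K_k]. *)
Definition cumweight (s : R) : R := (weight th a s * cumfun E b (expR s))%R.

Lemma cumweight_regvar : regvar (- th) cumweight.
Proof. by have := regvarM (weight_regvar th ha) (cumfun_regvar hb bfin); rewrite addr0. Qed.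

Let bs0 k : (0 < bs k)%R. Proof. by apply: (SV_gt0 hb); exact: expR_gt0. Qed.
Let wt0 s : (0 < weight th a s)%R. Proof. by case: (weight_regvar th ha). Qed.

Implicit Types (A : int -> int -> bool) (kap : int -> \bar R).
Definition weighted kap k := (weight th a k%:~R)%:E * kap k.

Lemma cumweightM kap k :
  (cumweight k%:~R)%:E * kap k = (cumfun E b (expR k%:~R))%:E * weighted kap k.
Proof. by rewrite /cumweight mulrC EFinM -muleA. Qed.

Lemma weighted_fin kap : (forall k, 0 <= kap k < +oo) -> forall k, 0 <= weighted kap k < +oo.
Proof.
move=> hk k; have /andP[k0 k1] := hk k; have w0 : 0 <= (weight th a k%:~R)%:E by rewrite lee_fin ltW.
apply/andP; split; first exact: mule_ge0.
by apply: lte_mul_pinfty.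
Qed.

Lemma iternorm_series_w : exists2 C : R, (0 < C)%R &
  forall A kap (sg : nat -> int), (forall k, 0 <= kap k < +oo) ->
  (forall i k, A i k -> (i <= k)%R /\ exists m, k = sg m) ->
  iternorm E bs F A (weighted kap) <= C%:E * \sum_(m <oo) (cumweight (sg m)%:~R)%:E * kap (sg m).
Proof.
have [C C0 hC] := @iternorm_le_series _ E F bs bs0.
have [[D D0 hD] _] := cumnorm_es hb bfin.
exists (C * D)%R => [|A kap sg hk hA]; first exact: mulr_gt0.
apply: (le_trans (hC A _ sg (weighted_fin hk) hA)); rewrite EFinM -muleA.
apply: lee_wpmul2l; first by rewrite lee_fin ltW.
have k0 k : 0 <= kap k by case/andP: (hk k).
have w0 k : 0 <= weighted kap k by case/andP: (weighted_fin hk k).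
have c0 s : 0 <= (cumweight s)%:E by rewrite lee_fin ltW//; case: cumweight_regvar.
rewrite -nneseriesZl; last by move=> m _; apply: mule_ge0.
apply: lee_nneseries => m _; first by move=> _; apply: mule_ge0 => //; exact: seqnorm_ge0.
apply: (le_trans (lee_wpmul2r (w0 _) (hD (sg m)))).
by rewrite cumweightM -muleA.
Qed.

Lemma iternorm_lower_w : exists2 C : R, (0 < C)%R &
  forall A kap k, (forall k, 0 <= kap k < +oo) -> (forall i, (i <= k)%R -> A i k) ->
  (cumweight k%:~R)%:E * kap k <= C%:E * iternorm E bs F A (weighted kap).
Proof.
have [C C0 hC] := @cumnorm_le_iternorm _ E F bs bs0.
have [_ [D D0 hD]] := cumnorm_es hb bfin.
exists (D * C)%R => [|A kap k hk hA]; first exact: mulr_gt0.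
have w0 : 0 <= weighted kap k by case/andP: (weighted_fin hk k).
rewrite [(D * C)%:E]EFinM -[leRHS]muleA.
apply: (@le_trans _ _ (D%:E * (cumnorm E bs k * weighted kap k))); last first.
  apply: lee_wpmul2l; first by rewrite lee_fin ltW.
  exact: (hC _ _ _ (weighted_fin hk) hA).
rewrite [leRHS]muleA cumweightM; exact: (lee_wpmul2r w0 (hD k)).
Qed.

End weight_series.

Lemma scale_step {R : realType} (r r' B D e : R) (y z : \bar R) :
  (0 <= r)%R -> (0 <= D)%R -> (0 <= y)%E -> (z <= D%:E * y)%E -> r <= B * (e * r') ->
  (r%:E * z <= (D * B)%:E * (e%:E * (r'%:E * y)))%E.
Proof.
move=> r0 D0 y0 zy rB; rewrite -lee_fin in r0.
apply: (le_trans (lee_wpmul2l r0 zy)); rewrite !muleA -!EFinM.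
apply: lee_wpmul2r => //; rewrite lee_fin [leLHS]mulrC -!mulrA.
by apply: ler_wpM2l.
Qed.

Lemma mulEE {R : realType} (r s : R) (y : \bar R) :
  (r%:E * (s%:E * y) = (r * s)%:E * y)%E.
Proof. by rewrite muleA EFinM. Qed.

Lemma scale_le {R : realType} (r C e s : R) (y : \bar R) :
  (0 <= y)%E -> r <= C * (e * s) -> (r%:E * y <= C%:E * (e%:E * (s%:E * y)))%E.
Proof.
by move=> y0 rC; rewrite !muleA -!EFinM; apply: lee_wpmul2r => //; rewrite lee_fin -mulrA.
Qed.

Lemma holmstedt_combine {R : realType} (B C D r : R) (p q p0 p1 q0 q1 y0 y1 : \bar R) :
  (0 < B)%R -> (0 < C)%R -> (0 < D)%R -> (0 <= r)%R ->
  (0 <= p0 -> 0 <= p1 -> 0 <= q0 -> 0 <= q1 -> 0 <= y0 -> 0 <= y1 ->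
  p <= (2 * B)%:E * (p0 + p1) -> q <= (2 * B)%:E * (q0 + q1) ->
  p0 <= y0 -> r%:E * q0 <= D%:E * y0 -> p1 <= C%:E * (r%:E * y1) -> q1 <= y1 ->
  p + r%:E * q <= (2 * B * (C + D + 1))%:E * (y0 + r%:E * y1))%E.
Proof.
move=> B0 C0 D0 r0 p00 p10 q00 q10 y00 y10 hp hq hp0 hq0 hp1 hq1.
rewrite -lee_fin in r0.
have B20 : (0 <= (2 * B)%:E)%E by rewrite lee_fin mulr_ge0// ltW.
have ry := mule_ge0 r0 y10.
apply: (le_trans (leeD hp (lee_wpmul2l r0 hq))).
rewrite muleCA -ge0_muleDr ?adde_ge0//; last by rewrite mule_ge0// adde_ge0.
rewrite [(2 * B * _)%:E]EFinM -[leRHS]muleA; apply: lee_wpmul2l => //.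
rewrite ge0_muleDr//.
have hq1' := lee_wpmul2l r0 hq1.
apply: (le_trans (leeD (leeD hp0 hp1) (leeD hq0 hq1'))).
move: ry; set z := (r%:E * y1)%E => z0.
have c1 : (0 <= C%:E)%E by rewrite lee_fin ltW.
have d1 : (0 <= D%:E)%E by rewrite lee_fin ltW.
have cd : (0 <= C%:E + D%:E)%E by exact: adde_ge0.
rewrite !EFinD (ge0_muleDl _ cd)// (ge0_muleDl _ c1 d1) mul1e.
rewrite [(D%:E * y0 + z)%E]addeC addeACA addeC; apply: leeD => //.
by apply: leeD; apply: lee_wpmul2l => //; rewrite ?leeDl ?leeDr.
Qed.

Section aux.
Context {R : realType}.
Local Open Scope ereal_scope.

(** Multiplying an infinite constant by 2 changes nothing; together with
    homogeneity this determines norms of sequences with infinite coefficients. *)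
Lemma double_eqy (x : \bar R) : 0 < x -> x = 2%:E * x -> x = +oo.
Proof.
case: x => [x| |//]; rewrite ?lte_fin // => x0.
by rewrite -EFinM => -[] h; exfalso; lra.
Qed.

Lemma seqnormZe (E : ri_space R) (c : int -> \bar R) (y : \bar R) :
  (forall k, 0 <= c k) -> 0 <= y -> 0 < seqnorm E c ->
  seqnorm E (fun k => y * c k) = y * seqnorm E c.
Proof.
move=> c0 y0 n0; case: y y0 => [y|_|//]; first by rewrite lee_fin => y0; rewrite seqnormZ.
rewrite gt0_mulye//.
have yc k : 0 <= +oo * c k by rewrite mule_ge0.
apply: double_eqy.
  apply: (lt_le_trans n0); apply: seqnorm_le => // k.
  have [->|ck] := eqVneq (c k) 0; first by rewrite mule0.
  by rewrite gt0_mulye ?leey// lt0e ck c0.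
rewrite -(seqnormZ E (ler0n R 2) yc); congr (seqnorm E _); apply/funext => k.
by rewrite muleA gt0_muley// lte_fin.
Qed.

Lemma seqnorm_oo (E : ri_space R) : seqnorm E (fun=> +oo) = +oo.
Proof.
apply: double_eqy.
  apply: (lt_le_trans (seqnorm_unit_gt0 E)); apply: seqnorm_le => k; first by rewrite lee_fin.
  exact: leey.
rewrite -(seqnormZ E (ler0n R 2) (fun=> le0y)); congr (seqnorm E _); apply/funext => k.
by rewrite gt0_muley// lte_fin.
Qed.

Lemma sum_scale_le (A B r : R) (y0 y1 z0 z1 : \bar R) :
  (0 < A)%R -> (0 < B)%R -> (0 <= r)%R -> 0 <= z0 -> 0 <= z1 ->
  y0 <= A%:E * z0 -> y1 <= B%:E * z1 ->
  y0 + r%:E * y1 <= (A + B)%:E * (z0 + r%:E * z1).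
Proof.
move=> A0 B0 r0 z00 z10 h0 h1; rewrite -lee_fin in r0.
have AE : 0 <= A%:E by rewrite lee_fin ltW.
have BE : 0 <= B%:E by rewrite lee_fin ltW.
have rz := mule_ge0 r0 z10.
rewrite EFinD ge0_muleDl//; apply: leeD.
  by apply: (le_trans h0); apply: lee_wpmul2l => //; exact: leeDl.
apply: (le_trans (lee_wpmul2l r0 h1)); rewrite muleCA.
by apply: lee_wpmul2l => //; exact: leeDr.
Qed.

End aux.

Section same.
Context {R : realType} {V : topologicalLmodType R}.
Local Open Scope ereal_scope.

Lemma same_space_of (XX YY : qspace V * qspace V) (X Y : qspace V) :
  (forall f, carrier X f <-> decomp YY f !=set0 /\ qnorm X f < +oo) ->
  (forall f, carrier Y f <-> decomp XX f !=set0 /\ qnorm Y f < +oo) ->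
  (forall f, decomp YY f !=set0 -> decomp XX f !=set0) ->
  (forall f, decomp XX f !=set0 -> qnorm X f < +oo -> decomp YY f !=set0) ->
  (forall f, 0 <= qnorm X f) -> (forall f, 0 <= qnorm Y f) ->
  eqsim (fun f : ssum XX => qnorm X (sval f)) (fun f => qnorm Y (sval f)) ->
  same_space X Y.
Proof.
move=> hX hY YX XY X0 Y0 [[C C0 hC] [D D0 hD]]; split.
  apply/seteqP; split => f.
    move=> /hX[dY nX]; have dX := YX _ dY; apply/hY; split=> //.
    apply: (le_lt_trans (hD (exist _ f dX))); apply: lte_mul_pinfty => //.
    by rewrite lee_fin ltW.
  move=> /hY[dX nY]; have nX : qnorm X f < +oo.
    apply: (le_lt_trans (hC (exist _ f dX))); apply: lte_mul_pinfty => //.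
    by rewrite lee_fin ltW.
  by apply/hX; split=> //; exact: XY.
exists (C + D)%R; first exact: addr_gt0.
move=> f /hX[/YX dX _]; have h1 := hC (exist _ f dX); have h2 := hD (exist _ f dX).
split.
  apply: (le_trans h1); apply: lee_wpmul2r; first exact: Y0.
  by rewrite lee_fin lerDl ltW.
apply: (le_trans h2); apply: lee_wpmul2r; first exact: X0.
by rewrite lee_fin lerDr ltW.
Qed.

Lemma qspaceI_carrier (D : V -> Prop) (X Y : qspace V) :
  (forall f, carrier X f <-> D f /\ qnorm X f < +oo) ->
  (forall f, carrier Y f <-> D f /\ qnorm Y f < +oo) ->
  forall f, carrier (qspaceI X Y) f <-> D f /\ qnorm (qspaceI X Y) f < +oo.
Proof.
move=> hX hY f; rewrite /= gt_max; split.
  by move=> [/hX[Df ->] /hY[_ ->]].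
by move=> [Df /andP[nX nY]]; split; [apply/hX|apply/hY].
Qed.

End same.

Section holmstedt.
Context {R : realType} {V : topologicalLmodType R}.
Local Open Scope ereal_scope.
Variable XX : qspace V * qspace V.
Hypothesis hX : compatible_couple XX.
Variables (th0 th1 : R).
Hypotheses (hth0 : (0 < th0)%R) (hth01 : (th0 < th1)%R) (hth1 : (th1 < 1)%R).
Variables (E0 E1 F0 F1 : ri_space R) (a0 a1 b0 b1 : R -> R).
Hypotheses (ha0 : regvar 0 (fun s => a0 (expR s))) (ha1 : regvar 0 (fun s => a1 (expR s))).
Hypotheses (hb0 : SV b0) (hb1 : SV b1).
Hypothesis b0fin : tnorm_on E0 `]0%R, 1%R[ (EFin \o b0) < +oo.
Hypothesis b1fin : tnorm_on E1 `]0%R, 1%R[ (EFin \o b1) < +oo.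

Let YY := (spaceR XX th0 b0 E0 a0 F0, spaceR XX th1 b1 E1 a1 F1).
Let w0 := cumweight E0 b0 a0 th0.
Let w1 := cumweight E1 b1 a1 th1.
Definition rho_log (s : R) : R := (w0 s / w1 s)%R.
Let T := ssum XX.
Implicit Types (f x : T) (j k : int).

Let rvw0 : regvar (- th0) w0. Proof. exact: cumweight_regvar. Qed.
Let rvw1 : regvar (- th1) w1. Proof. exact: cumweight_regvar. Qed.

Lemma rho_log_regvar : regvar (th1 - th0) rho_log.
Proof. by have := regvarM rvw0 (regvarV rvw1); rewrite opprK addrC. Qed.

Let rho0 s : (0 < rho_log s)%R. Proof. by case: rho_log_regvar. Qed.
Let d0 : (0 < th1 - th0)%R. Proof. by rewrite subr_gt0. Qed.
Let d1 : (- (th1 - th0) < 0)%R. Proof. by rewrite oppr_lt0. Qed.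
Let w00 s : (0 < w0 s)%R. Proof. by case: rvw0. Qed.
Let w10 s : (0 < w1 s)%R. Proof. by case: rvw1. Qed.

Let rhoE0 s : 0 <= (rho_log s)%:E. Proof. by rewrite lee_fin ltW. Qed.
Let w0E s : 0 <= (w0 s)%:E. Proof. by rewrite lee_fin ltW. Qed.

Let bs0 k : R := b0 (expR k%:~R).
Let bs1 k : R := b1 (expR k%:~R).
Let bs00 k : (0 < bs0 k)%R. Proof. by apply: (SV_gt0 hb0); exact: expR_gt0. Qed.
Let bs10 k : (0 < bs1 k)%R. Proof. by apply: (SV_gt0 hb1); exact: expR_gt0. Qed.

(** The two terms of the formula: the norm of [Y0] restricted to the indices below
    j, and the norm of [Y1] with the inner index restricted above j. *)
Definition lowpart f j :=
  iternorm E0 bs0 F0 (fun i k => (i <= k) && (k <= j))%R (Kweighted th0 a0 f).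
Definition highpart f j :=
  iternorm E1 bs1 F1 (fun i k => (i <= k) && (j <= k))%R (Kweighted th1 a1 f).
Let lowpart0 f j : 0 <= lowpart f j. Proof. exact: seqnorm_ge0. Qed.
Let highpart0 f j : 0 <= highpart f j. Proof. exact: seqnorm_ge0. Qed.
Let rQ0 f j : 0 <= (rho_log j%:~R)%:E * highpart f j.
Proof. apply: mule_ge0; [exact: rhoE0|exact: highpart0]. Qed.
Let Y0n f := iternorm E0 bs0 F0 (fun i k => i <= k)%R (Kweighted th0 a0 f).
Let Y1n f := iternorm E1 bs1 F1 (fun i k => i <= k)%R (Kweighted th1 a1 f).

Let Kfin f k : 0 <= Kseq f k < +oo.
Proof. by apply/andP; split; [exact: Kseq_ge0|exact: Kseq_lty]. Qed.

Let belowP (j i k : int) : (i <= k)%R && (k <= j)%R ->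
  (i <= k)%R /\ exists m : nat, k = (j - m%:Z)%R.
Proof. by move=> /andP[ik kj]; split=> //; exists `|j - k|%N; lia. Qed.

Let aboveP (j i k : int) : (i <= k)%R && (j <= k)%R ->
  (i <= k)%R /\ exists m : nat, k = (j + m%:Z)%R.
Proof. by move=> /andP[ik kj]; split=> //; exists `|k - j|%N; lia. Qed.

Lemma lowpart_series : exists2 C : R, (0 < C)%R & forall f j,
  lowpart f j <= C%:E * \sum_(m <oo) (w0 (j - m%:Z)%:~R)%:E * Kseq f (j - m%:Z)%R.
Proof.
have [C C0 hC] := iternorm_series_w F0 th0 hb0 ha0 b0fin; exists C => // f j.
by apply: (hC _ _ (fun m => j - m%:Z)%R (Kfin f)) => i k; exact: belowP.
Qed.

Lemma highpart_series : exists2 C : R, (0 < C)%R & forall f j,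
  highpart f j <= C%:E * \sum_(m <oo) (w1 (j + m%:Z)%:~R)%:E * Kseq f (j + m%:Z)%R.
Proof.
have [C C0 hC] := iternorm_series_w F1 th1 hb1 ha1 b1fin; exists C => // f j.
by apply: (hC _ _ (fun m => j + m%:Z)%R (Kfin f)) => i k; exact: aboveP.
Qed.

Lemma lowpart_ge : exists2 C : R, (0 < C)%R & forall f j,
  (w0 j%:~R)%:E * Kseq f j <= C%:E * lowpart f j.
Proof.
have [C C0 hC] := iternorm_lower_w F0 th0 hb0 ha0 b0fin; exists C => // f j.
by apply: (hC _ _ _ (Kfin f)) => i ij; rewrite ij lexx.
Qed.

Lemma highpart_ge : exists2 C : R, (0 < C)%R & forall f j,
  (w1 j%:~R)%:E * Kseq f j <= C%:E * highpart f j.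
Proof.
have [C C0 hC] := iternorm_lower_w F1 th1 hb1 ha1 b1fin; exists C => // f j.
by apply: (hC _ _ _ (Kfin f)) => i ij; rewrite ij lexx.
Qed.

(** Since [w_0 = rho w_1] and rho increases exponentially, the sum over the
    indices below j is governed by its last term. *)
Lemma lowpart_le_Y1 : exists2 C : R, (0 < C)%R & forall x j,
  lowpart x j <= C%:E * ((rho_log j%:~R)%:E * Y1n x).
Proof.
have [C C0 hC] := lowpart_series.
have [D D0 hD] := iternorm_lower_w F1 th1 hb1 ha1 b1fin.
have [B B0 [e e0 hB]] := regvar_bwd rho_log_regvar d0.
have [G G0 geo] := series_geo e0.
exists (C * (D * B * G))%R => [|x j]; first by rewrite !mulr_gt0.
apply: (le_trans (hC x j)); rewrite EFinM -muleA; apply: lee_wpmul2l; first by rewrite lee_fin ltW.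
have yy : 0 <= (rho_log j%:~R)%:E * Y1n x by rewrite mule_ge0 ?seqnorm_ge0// lee_fin ltW.
apply: geo => //; first by rewrite mulr_gt0.
  by move=> m; apply: mule_ge0; [rewrite lee_fin ltW|exact: Kseq_ge0].
move=> m; set k := (j - m%:Z)%R.
have h : (w1 k%:~R)%:E * Kseq x k <= D%:E * Y1n x.
  exact: (hD (fun i k => i <= k)%R _ k (Kfin x) (fun i h => h)).
have -> : w0 k%:~R = (rho_log k%:~R * w1 k%:~R)%R by rewrite /rho_log divfK// gt_eqF.
rewrite [X in X * _]EFinM -[leLHS]muleA.
by apply: scale_step; [exact: ltW|exact: ltW|exact: seqnorm_ge0|exact: h|exact: hB].
Qed.

(** The mirror image of [lowpart_le_Y1]: 1/rho decreases exponentially. *)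
Lemma highpart_le_Y0 : exists2 C : R, (0 < C)%R & forall x j,
  (rho_log j%:~R)%:E * highpart x j <= C%:E * Y0n x.
Proof.
have [C C0 hC] := highpart_series.
have [D D0 hD] := iternorm_lower_w F0 th0 hb0 ha0 b0fin.
have [B B0 [e e0 hB]] := regvar_fwd (regvarV rho_log_regvar) d1.
have [G G0 geo] := series_geo e0.
exists (C * (D * B * G))%R => [|x j]; first by rewrite !mulr_gt0.
have r0 s : 0 <= (rho_log s)%:E by rewrite lee_fin ltW.
apply: (le_trans (lee_wpmul2l (r0 _) (hC x j))); rewrite muleCA [(C * _)%:E]EFinM -[leRHS]muleA.
apply: lee_wpmul2l; first by rewrite lee_fin ltW.
rewrite -nneseriesZl; last by move=> m _; apply: mule_ge0; [rewrite lee_fin ltW|exact: Kseq_ge0].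
apply: geo; first exact: seqnorm_ge0.
- by rewrite mulr_gt0.
- by move=> m; apply: mule_ge0 => //; apply: mule_ge0; [rewrite lee_fin ltW|exact: Kseq_ge0].
move=> m; set k := (j + m%:Z)%R.
have h : (w0 k%:~R)%:E * Kseq x k <= D%:E * Y0n x.
  exact: (hD (fun i k => i <= k)%R _ k (Kfin x) (fun i h => h)).
have -> : w1 k%:~R = ((rho_log k%:~R)^-1 * w0 k%:~R)%R.
  by rewrite /rho_log invf_div divfK// gt_eqF.
rewrite [X in _ * (X * _)]EFinM -[X in _ * X]muleA [leLHS]muleA -[X in X * _]EFinM.
rewrite -[Y0n x]mul1e; apply: scale_step.
- by rewrite mulr_ge0 ?invr_ge0 ?(ltW (rho0 _)).
- exact: ltW.
- exact: seqnorm_ge0.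
- exact: h.
- rewrite mulr1; have := hB j m; rewrite -/k mulrA ler_pdivlMr// mulrC; exact.
Qed.

(** Each term of the formula is quasi-additive in f; a piece on its own side is
    bounded by its norm, on the other side by the two lemmas above. *)
Lemma holmstedt_lower : exists2 C : R, (0 < C)%R & forall f j x0 x1,
  sval f = (sval x0 + sval x1)%R ->
  lowpart f j + (rho_log j%:~R)%:E * highpart f j <=
    C%:E * (Y0n x0 + (rho_log j%:~R)%:E * Y1n x1).
Proof.
have [C C0 hC] := lowpart_le_Y1; have [D D0 hD] := highpart_le_Y0.
have [B B0 hB] := KfunD hX.
exists (2 * B * (C + D + 1))%R => [|f j x0 x1 fE]; first by rewrite !mulr_gt0// !addr_gt0.
have r0 : 0 <= (rho_log j%:~R)%:E by rewrite lee_fin ltW.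
have B20 : (0 < 2 * B)%R by rewrite mulr_gt0.
have alt th a k : regvar 0 (fun s => a (expR s)) -> Kweighted th a f k <= (2 * B)%:E * Kweighted th a x0 k \/
    Kweighted th a f k <= (2 * B)%:E * Kweighted th a x1 k.
  move=> ha; have wt0 : 0 <= (weight th a k%:~R)%:E by rewrite lee_fin ltW//; case: (weight_regvar th ha).
  have := hB (expR k%:~R) (sval x0) (sval x1) (expR_ge0 _) (svalP x0) (svalP x1).
  rewrite -fE -/(Kseq f k) -/(Kseq x0 k) -/(Kseq x1 k) => h.
  have BE : 0 <= B%:E by rewrite lee_fin ltW.
  have two y z : y <= z -> B%:E * (y + z) <= (2 * B)%:E * z.
    move=> yz; rewrite mulrC EFinM -muleA; apply: lee_wpmul2l => //.
    by rewrite mule_natl mule2n; apply: leeD2r.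
  have [le01|/ltW le10] := leP (Kseq x0 k) (Kseq x1 k); [right|left];
    rewrite /Kweighted muleCA; apply: lee_wpmul2l => //; apply: (le_trans h); first exact: two.
  by rewrite addeC; exact: two.
have HP : lowpart f j <= (2 * B)%:E * (lowpart x0 j + lowpart x1 j).
  apply: iternorm_split => //; [by move=> k; exact: Kweighted_ge0..|].
  by move=> i k ik; have [h|h] := alt th0 a0 k ha0; [left|right].
have HQ : highpart f j <= (2 * B)%:E * (highpart x0 j + highpart x1 j).
  apply: iternorm_split => //; [by move=> k; exact: Kweighted_ge0..|].
  by move=> i k ik; have [h|h] := alt th1 a1 k ha1; [left|right].
have P0 : lowpart x0 j <= Y0n x0.
  rewrite -[leRHS]mul1e; apply: iternorm_le => //; [by move=> k; exact: Kweighted_ge0..|].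
  by move=> i k /andP[ik _]; rewrite mul1e.
have Q1 : highpart x1 j <= Y1n x1.
  rewrite -[leRHS]mul1e; apply: iternorm_le => //; [by move=> k; exact: Kweighted_ge0..|].
  by move=> i k /andP[ik _]; rewrite mul1e.
have P1 := hC x1 j; have Q0 := hD x0 j.
have Lx (x : T) (i : int) : 0 <= lowpart x i by exact: seqnorm_ge0.
have Hx (x : T) (i : int) : 0 <= highpart x i by exact: seqnorm_ge0.
have nY0 x : 0 <= Y0n x by exact: seqnorm_ge0.
have nY1 x : 0 <= Y1n x by exact: seqnorm_ge0.
exact: (holmstedt_combine B0 C0 D0 (ltW (rho0 _)) (Lx x0 j) (Lx x1 j) (Hx x0 j) (Hx x1 j)
  (nY0 x0) (nY1 x1) HP HQ P0 Q0 P1 Q1).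
Qed.

(** Above j the first piece has a K-functional of at most about [K_j], against
    weights which decrease exponentially. *)
Lemma upper_tail : exists2 C : R, (0 < C)%R & forall f j,
  iternorm E0 bs0 F0 (fun i k => (i <= k) && (j <= k))%R (weighted a0 th0 (fun=> Kseq f j))
    <= C%:E * lowpart f j.
Proof.
have [C C0 hC] := iternorm_series_w F0 th0 hb0 ha0 b0fin.
have [D D0 hD] := lowpart_ge.
have [B B0 [e e0 hB]] := regvar_fwd rvw0 (ltac:(by rewrite oppr_lt0) : (- th0 < 0)%R).
have [G G0 geo] := series_geo e0.
exists (C * (B * G * D))%R => [|f j]; first by rewrite !mulr_gt0.
have hA (i k : int) : ((i <= k) && (j <= k))%R -> _ := @aboveP j i k.
apply: (le_trans (hC (fun i k => (i <= k) && (j <= k))%R (fun=> Kseq f j) _ (fun=> Kfin f j) hA)).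
rewrite [(C * _)%:E]EFinM -[leRHS]muleA.
apply: lee_wpmul2l; first by rewrite lee_fin ltW.
have K0 : 0 <= Kseq f j by exact: Kseq_ge0.
have w0K : 0 <= (w0 j%:~R)%:E * Kseq f j by apply: mule_ge0 => //; rewrite lee_fin ltW.
apply: (@le_trans _ _ ((B * G)%:E * ((w0 j%:~R)%:E * Kseq f j))).
  apply: geo; [exact: w0K|exact: B0|..] => m.
    by apply: mule_ge0; [rewrite lee_fin ltW|exact: K0].
  by apply: scale_le; [exact: K0|exact: hB].
rewrite [(_ * D)%:E]EFinM -[leRHS]muleA; apply: lee_wpmul2l; last exact: hD.
by rewrite lee_fin mulr_ge0// ltW.
Qed.

(** Below j the second piece has a K-functional of at most about
    [e^(k-j) K_j]; the weights times [e^k] increase exponentially as theta_1 < 1. *)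
Lemma upper_head : exists2 C : R, (0 < C)%R & forall f j,
  iternorm E1 bs1 F1 (fun i k => (i <= k) && (k <= j))%R
    (weighted a1 th1 (fun k => (expR (k%:~R - j%:~R))%:E * Kseq f j))
    <= C%:E * highpart f j.
Proof.
have [C C0 hC] := iternorm_series_w F1 th1 hb1 ha1 b1fin.
have [D D0 hD] := highpart_ge.
have d2 : (0 < - th1 + 1)%R by rewrite addrC subr_gt0.
have [B B0 [e e0 hB]] := regvar_bwd (regvarM rvw1 (regvar_expR 1)) d2.
have [G G0 geo] := series_geo e0.
exists (C * (B * G * D))%R => [|f j]; first by rewrite !mulr_gt0.
have K0 : 0 <= Kseq f j by exact: Kseq_ge0.
have kfin (k : int) : 0 <= (expR (k%:~R - j%:~R))%:E * Kseq f j < +oo.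
  have e1 : 0 <= (expR (k%:~R - j%:~R : R))%:E by rewrite lee_fin expR_ge0.
  apply/andP; split; first exact: mule_ge0.
  by apply: lte_mul_pinfty => //; exact: Kseq_lty.
have hA (i k : int) : ((i <= k) && (k <= j))%R -> _ := @belowP j i k.
apply: (le_trans (hC (fun i k => (i <= k) && (k <= j))%R _ _ kfin hA)).
rewrite [(C * _)%:E]EFinM -[leRHS]muleA.
apply: lee_wpmul2l; first by rewrite lee_fin ltW.
have w1K : 0 <= (w1 j%:~R)%:E * Kseq f j by apply: mule_ge0 => //; rewrite lee_fin ltW.
apply: (@le_trans _ _ ((B * G)%:E * ((w1 j%:~R)%:E * Kseq f j))).
  apply: geo; [exact: w1K|exact: B0|..] => m.
    by apply: mule_ge0; [rewrite lee_fin ltW|case/andP: (kfin (j - m%:Z)%R)].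
  rewrite [leLHS]mulEE; apply: scale_le; first exact: K0.
  have h := hB j m; rewrite !mul1r in h.
  rewrite expRB mulrA ler_pdivrMr ?expR_gt0//.
  rewrite -[leRHS]mulrA -[X in (_ <= B * X)%R]mulrA; exact: h.
rewrite [(_ * D)%:E]EFinM -[leRHS]muleA; apply: lee_wpmul2l; last exact: hD.
by rewrite lee_fin mulr_ge0// ltW.
Qed.

(** Take a splitting of f which is optimal at [e^j] up to a factor 2. Its first
    piece is f minus the second one, whence the bound below j, and conversely. *)
Lemma holmstedt_upper : exists2 C : R, (0 < C)%R & forall f j, exists x0 x1,
  [/\ sval f = (sval x0 + sval x1)%R, Y0n x0 <= C%:E * lowpart f j & Y1n x1 <= C%:E * highpart f j].
Proof.
have [B B0 hB] := KfunD hX.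
have [C C0 hC] := upper_tail; have [D D0 hD] := upper_head.
pose M := (3 * B + 2)%R; have M0 : (0 < M)%R by rewrite addr_gt0// mulr_gt0.
exists (M * (1 + C + D))%R => [|f j]; first by rewrite mulr_gt0// !addr_gt0.
have X0 := couple_nneg hX.
have [p fp hp] := Kfun_opt hX (expR_gt0 (j%:~R)) (svalP f).
rewrite -/(Kseq f j) in hp.
have [p1 p2 fE] := fp.
have N00 := X0.1 _ p1; have N10 := X0.2 _ p2.
set N0 := qnorm XX.1 p.1 in hp N00 *; set N1 := qnorm XX.2 p.2 in hp N10 *.
have ej0 (s : R) : 0 <= (expR s)%:E by rewrite lee_fin expR_ge0.
have hN0 : N0 <= 2%:E * Kseq f j by apply: le_trans hp; rewrite leeDl// mule_ge0.
have hN1 : (expR j%:~R)%:E * N1 <= 2%:E * Kseq f j by apply: le_trans hp; rewrite leeDr.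
have hN1k (k : int) : (expR k%:~R)%:E * N1 <= 2%:E * ((expR (k%:~R - j%:~R))%:E * Kseq f j).
  rewrite muleCA -[X in expR X](subrK j%:~R) expRD EFinM -muleA.
  exact: lee_wpmul2l.
pose x0 : T := exist _ p.1 (ex_intro _ _ (decomp_l hX p1)).
pose x1 : T := exist _ p.2 (ex_intro _ _ (decomp_r hX p2)).
have [np1 nn1] := qnormN (cc_X0 hX) p1; have [np2 nn2] := qnormN (cc_X1 hX) p2.
have k0 k : Kseq x0 k <= 2%:E * Kseq f j.
  exact: le_trans (Kfun_l hX _ p1) hN0.
have k1 k : Kseq x1 k <= 2%:E * ((expR (k%:~R - j%:~R))%:E * Kseq f j).
  exact: le_trans (Kfun_r hX _ p2) (hN1k k).
have B0' : 0 <= B%:E by rewrite lee_fin ltW.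
have Kf0 k : 0 <= Kseq f k by exact: Kseq_ge0.
have triple k : B%:E * (Kseq f k + 2%:E * Kseq f k) = (3 * B)%:E * Kseq f k.
  rewrite -[X in X + _]mul1e -ge0_muleDl// -EFinD muleA -EFinM.
  by congr (_%:E * _); ring.
have k0' k : (k <= j)%R -> Kseq x0 k <= (3 * B)%:E * Kseq f k.
  move=> kj; have := hB (expR k%:~R) (sval f) (- p.2)%R (expR_ge0 _) (svalP f)
    (ex_intro _ _ (decomp_r hX np2)).
  rewrite {1}fE addrK -/(Kseq x0 k) -/(Kseq f k) => /le_trans; apply.
  rewrite -triple; apply: lee_wpmul2l => //; apply: leeD2l.
  apply: (le_trans (Kfun_r hX _ np2)); rewrite nn2; apply: (le_trans (hN1k k)).
  apply: lee_wpmul2l => //.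
  have := Kfun_expR X0 j%:~R k%:~R (sval f); rewrite -/(Kseq f j) -/(Kseq f k).
  rewrite max_r ?subr_ge0 ?ler_int// => h.
  apply: (le_trans (lee_wpmul2l (ej0 _) h)).
  by rewrite muleA -EFinM -expRD -opprB addNr expR0 mul1e.
have k1' k : (j <= k)%R -> Kseq x1 k <= (3 * B)%:E * Kseq f k.
  move=> jk; have := hB (expR k%:~R) (sval f) (- p.1)%R (expR_ge0 _) (svalP f)
    (ex_intro _ _ (decomp_l hX np1)).
  have -> : (sval f - p.1 = p.2)%R by rewrite fE addrAC subrr add0r.
  rewrite -/(Kseq x1 k) -/(Kseq f k) => /le_trans; apply.
  rewrite -triple; apply: lee_wpmul2l => //; apply: leeD2l.
  apply: (le_trans (Kfun_l hX _ np1)); rewrite nn1; apply: (le_trans hN0).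
  by apply: lee_wpmul2l => //; apply: (Kfun_mono X0); rewrite ler_expR ler_int.
have up (c1 c2 : R) (y z : \bar R) : (c1 <= c2)%R -> 0 <= y -> z <= c1%:E * y -> z <= c2%:E * y.
  move=> c12 y0 /le_trans; apply; apply: lee_wpmul2r => //; by rewrite lee_fin.
have M3 : (3 * B <= M)%R by rewrite lerDl.
have M2 : (2 <= M)%R by rewrite lerDr mulr_ge0// ltW.
have wtE th a s : regvar 0 (fun s => a (expR s)) -> 0 <= (weight th a s)%:E.
  by move=> ha; rewrite lee_fin ltW//; case: (weight_regvar th ha).
have lft th a x k c y : regvar 0 (fun s => a (expR s)) -> Kseq x k <= c%:E * y ->
    Kweighted th a x k <= c%:E * ((weight th a k%:~R)%:E * y).
  by move=> ha h; rewrite muleCA; apply: lee_wpmul2l => //; exact: wtE.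
exists x0, x1; split=> //.
- have H : Y0n x0 <= M%:E * (lowpart f j +
     iternorm E0 bs0 F0 (fun i k => (i <= k) && (j <= k))%R (weighted a0 th0 (fun=> Kseq f j))).
    apply: iternorm_split; [exact: bs00|exact: M0|..].
    + by move=> k; exact: Kweighted_ge0.
    + by move=> k; exact: Kweighted_ge0.
    + by move=> k; apply: mule_ge0; [exact: wtE|exact: Kf0].
    move=> i k ik; have [kj|/ltW jk] := leP k j; [left|right]; split.
    + by rewrite ik.
    + apply: lft; first exact: ha0.
      by apply: up (k0' k kj); [exact: M3|exact: Kf0].
    + by rewrite ik.
    + apply: lft; first exact: ha0.
      by apply: up (k0 k); [exact: M2|exact: Kf0].
  apply: (le_trans H); rewrite [(M * _)%:E]EFinM -[leRHS]muleA.
  have P0 : 0 <= lowpart f j by exact: seqnorm_ge0.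
  apply: lee_wpmul2l; first by rewrite lee_fin ltW.
  apply: (@le_trans _ _ (lowpart f j + C%:E * lowpart f j)); first by apply: leeD2l; exact: hC.
  rewrite -[X in X + _]mul1e -ge0_muleDl ?lee_fin ?ler01 ?(ltW C0)// -EFinD.
  by apply: lee_wpmul2r => //; rewrite lee_fin lerDl ltW.
- have H : Y1n x1 <= M%:E * (highpart f j +
     iternorm E1 bs1 F1 (fun i k => (i <= k) && (k <= j))%R
       (weighted a1 th1 (fun k => (expR (k%:~R - j%:~R))%:E * Kseq f j))).
    apply: iternorm_split; [exact: bs10|exact: M0|..].
    + by move=> k; exact: Kweighted_ge0.
    + by move=> k; exact: Kweighted_ge0.
    + by move=> k; apply: mule_ge0; [exact: wtE|exact: mule_ge0].
    move=> i k ik; have [kj|/ltW jk] := leP k j; [right|left]; split.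
    + by rewrite ik.
    + apply: lft; first exact: ha1.
      by apply: up (k1 k); [exact: M2|exact: mule_ge0].
    + by rewrite ik.
    + apply: lft; first exact: ha1.
      by apply: up (k1' k jk); [exact: M3|exact: Kf0].
  apply: (le_trans H); rewrite [(M * _)%:E]EFinM -[leRHS]muleA.
  have Q0 : 0 <= highpart f j by exact: seqnorm_ge0.
  apply: lee_wpmul2l; first by rewrite lee_fin ltW.
  apply: (@le_trans _ _ (highpart f j + D%:E * highpart f j)); first by apply: leeD2l; exact: hD.
  rewrite -[X in X + _]mul1e -ge0_muleDl ?lee_fin ?ler01 ?(ltW D0)// -EFinD.
  by apply: lee_wpmul2r => //; rewrite lee_fin lerD2r lerDl ltW.
Qed.

Lemma YY_nneg : nneg_couple YY.
Proof. by split=> f _; apply: tnorm_ge0. Qed.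

Let es0 := spaceR_es hX th0 ha0 F0 (SV_gt0 hb0) (SV_regvar hb0) E0.
Let es1 := spaceR_es hX th1 ha1 F1 (SV_gt0 hb1) (SV_regvar hb1) E1.

(** When the right-hand side is finite, the pieces produced by [holmstedt_upper]
    do belong to [Y0] and [Y1]. *)
Lemma Kfun_YY :
  eqsim (fun p : T * int => Kfun YY (rho_log p.2%:~R) (sval p.1))
        (fun p => lowpart p.1 p.2 + (rho_log p.2%:~R)%:E * highpart p.1 p.2).
Proof.
have [[A A0 hA] [A' A'0 hA']] := es0; have [[B B0 hB] [B' B'0 hB']] := es1.
split.
- have [C C0 hC] := holmstedt_upper.
  exists ((A + B) * C)%R => [|[f j] /=]; first by rewrite mulr_gt0// addr_gt0.
  have AB : (0 < (A + B) * C)%R by rewrite mulr_gt0// addr_gt0.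
  have [x0 [x1 [fE h0 h1]]] := hC f j.
  have [PQ|] := eqVneq (lowpart f j + (rho_log j%:~R)%:E * highpart f j) +oo.
    by rewrite PQ gt0_muley ?leey// lte_fin.
  rewrite -ltey => PQ.
  have Pfin : lowpart f j < +oo by apply: le_lt_trans PQ; exact: leeDl.
  have Qfin : highpart f j < +oo.
    rewrite ltey; apply/eqP => Qoo; move: PQ; rewrite Qoo gt0_muley ?lte_fin//.
    by rewrite addey ?ltxx// gt_eqF// (lt_le_trans _ (lowpart0 f j))// ltNyr.
  have h0' : qnorm YY.1 (sval x0) <= (A * C)%:E * lowpart f j.
    apply: (le_trans (hA x0)); rewrite EFinM -muleA; apply: lee_wpmul2l => //.
    by rewrite lee_fin ltW.
  have h1' : qnorm YY.2 (sval x1) <= (B * C)%:E * highpart f j.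
    apply: (le_trans (hB x1)); rewrite EFinM -muleA; apply: lee_wpmul2l => //.
    by rewrite lee_fin ltW.
  have AC0 : 0 <= (A * C)%:E by rewrite lee_fin mulr_ge0// ltW.
  have BC0 : 0 <= (B * C)%:E by rewrite lee_fin mulr_ge0// ltW.
  have lt0 : qnorm YY.1 (sval x0) < +oo.
    by apply: (le_lt_trans h0'); apply: lte_mul_pinfty; [exact: AC0|by []|exact: Pfin].
  have lt1 : qnorm YY.2 (sval x1) < +oo.
    by apply: (le_lt_trans h1'); apply: lte_mul_pinfty; [exact: BC0|by []|exact: Qfin].
  have dYY : decomp YY (sval f) (sval x0, sval x1).
    split; [exact: (conj (svalP x0) lt0)|exact: (conj (svalP x1) lt1)|exact: fE].
  apply: (le_trans (Kfun_le _ dYY)).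
  have AC : (0 < A * C)%R by exact: mulr_gt0.
  have BC : (0 < B * C)%R by exact: mulr_gt0.
  by rewrite mulrDl; apply: (sum_scale_le AC BC (ltW (rho0 _)) (lowpart0 f j) (highpart0 f j) h0' h1').
- have [C C0 hC] := holmstedt_lower.
  have AB : (0 < A' + B')%R by rewrite addr_gt0.
  have CAB : (0 < C * (A' + B'))%R by exact: mulr_gt0.
  exists (C * (A' + B'))%R => [//|[f j] /=].
  rewrite [leRHS]muleC -(lee_pdivrMr _ _ CAB); apply: le_ereal_inf_tmp => _ [p dp <-].
  have [[d0p f0p] [d1p f1p] fE] := dp.
  rewrite (lee_pdivrMr _ _ CAB) [leRHS]muleC.
  pose x0 : T := exist _ p.1 d0p; pose x1 : T := exist _ p.2 d1p.
  apply: (le_trans (hC f j x0 x1 fE)); rewrite [(C * _)%:E]EFinM -[leRHS]muleA.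
  apply: lee_wpmul2l; first by rewrite lee_fin ltW.
  have n0 : 0 <= qnorm YY.1 p.1 by apply: tnorm_ge0.
  have n1 : 0 <= qnorm YY.2 p.2 by apply: tnorm_ge0.
  exact: (sum_scale_le A'0 B'0 (ltW (rho0 _)) n0 n1 (hA' x0) (hB' x1)).
Qed.

Lemma decompYY (f : V) : decomp YY f !=set0 -> decomp XX f !=set0.
Proof.
move=> [p [[d0p _] [d1p _] ->]]; exact: (decompD hX d0p d1p).
Qed.

(** * Reiteration *)

Section outer.
Variables (th : R) (b : R -> R) (E : ri_space R).
Hypothesis hb : SV b.

(* This is [rho^(- theta) b(rho)]. *)
Let W (s : R) : R := weight th b (ln (rho_log s)).

Let rvW : regvar (- th * (th1 - th0)) W.
Proof. exact: (regvar_comp (weight_regvar th (SV_regvar hb)) rho_log_regvar). Qed.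

Let W0 s : (0 < W s)%R. Proof. by case: rvW. Qed.
Let WE0 s : 0 <= (W s)%:E. Proof. by rewrite lee_fin ltW. Qed.

(** The change of variable u = rho(e^j) in the outer norm. *)
Lemma qnormK_discrete :
  eqsim (fun f : T => qnorm (spaceK YY th b E) (sval f))
        (fun f => seqnorm E (fun j => (W j%:~R)%:E * Kfun YY (rho_log j%:~R) (sval f))).
Proof.
pose H (f : T) (s : R) := (weight th b s)%:E * Kfun YY (expR s) (sval f).
have rvwt := weight_regvar th (SV_regvar hb).
have wt0 s : 0 <= (weight th b s)%:E by rewrite lee_fin ltW//; case: rvwt.
have K0 s f : 0 <= Kfun YY (expR s) (sval f).
  by apply: Kfun_ge0; [exact: YY_nneg|exact: expR_ge0].
have H0 f s : 0 <= H f s by exact: mule_ge0.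
have HD (D : R) : exists2 C : R, (0 < C)%R & forall f (s r : R), (`|s - r| <= D)%R ->
     H f s <= C%:E * H f r.
  have [C C0 hC] := regvar_near D rvwt; exists (C * expR D)%R => [|f s r sr].
    by rewrite mulr_gt0// expR_gt0.
  rewrite EFinM muleACA; apply: lee_pmul => //.
    by rewrite -EFinM lee_fin; exact: hC.
  by apply: (Kfun_near YY_nneg).
apply: (@es_trans _ _ _ (fun f : T => seqnorm E (fun k : int => H f k%:~R))).
  apply: (@tnorm_es _ T E (fun f t => Kweight th b (Kfun YY ^~ (sval f)) t)
    (fun f k => H f k%:~R)).
  - by move=> f t t0; rewrite -(lnK t0) Kweight_expR; exact: H0.
  - by move=> f k; exact: H0.
  have [C C0 hC] := HD 1%R.
  split; (exists C; first exact: C0) => -[f s] /=; rewrite Kweight_expR; apply: hC.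
    exact: near_floor.
  by rewrite distrC; exact: near_floor.
apply: (es_trans (change_var E H0 HD d0 rho_log_regvar)).
apply: es_eq => f; congr (seqnorm E _); apply/funext => j.
by rewrite /H (lnK (rho0 _)).
Qed.

Lemma qnormK_holmstedt :
  eqsim (fun f : T => qnorm (spaceK YY th b E) (sval f))
        (fun f => seqnorm E (fun j => (W j%:~R)%:E * (lowpart f j + (rho_log j%:~R)%:E * highpart f j))).
Proof.
apply: (es_trans qnormK_discrete).
have K0 f j : 0 <= Kfun YY (rho_log j%:~R) (sval f).
  by apply: Kfun_ge0; [exact: YY_nneg|exact: ltW].
apply: es_seqnorm.
- by move=> f j; exact: mule_ge0.
- by move=> f j; apply: mule_ge0 => //; exact: adde_ge0.
apply: esM.
- by move=> p; exact: WE0.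
- by move=> p; exact: K0.
- by move=> p; exact: WE0.
- by move=> p; exact: adde_ge0.
- exact: es_refl.
- exact: Kfun_YY.
Qed.

Local Notation lownorm := (fun f : T => seqnorm E (fun j => (W j%:~R)%:E * lowpart f j)).
Local Notation highnorm := (fun f : T =>
  seqnorm E (fun j => (W j%:~R)%:E * ((rho_log j%:~R)%:E * highpart f j))).
Local Notation midnorm := (fun f : T =>
  seqnorm E (fun j => (W j%:~R)%:E * ((w0 j%:~R)%:E * Kseq f j))).

Let wK0 f j : 0 <= (w0 j%:~R)%:E * Kseq f j.
Proof. by apply: mule_ge0; [exact: w0E|exact: Kseq_ge0]. Qed.

Lemma midnorm_le_low : midnorm <~ lownorm.
Proof.
have [C C0 hC] := lowpart_ge.
apply: ls_seqnorm; [by move=> f j; exact: mule_ge0..|].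
apply: lsM; [by move=> p; exact: WE0|by move=> p; exact: wK0|exact: ls_refl|].
by exists C => // -[f j]; exact: hC.
Qed.

Lemma midnorm_le_high : midnorm <~ highnorm.
Proof.
have [C C0 hC] := highpart_ge.
apply: ls_seqnorm; [by move=> f j; exact: mule_ge0..|].
apply: lsM; [by move=> p; exact: WE0|by move=> p; exact: wK0|exact: ls_refl|].
exists C => // -[f j] /=.
have -> : w0 j%:~R = (rho_log j%:~R * w1 j%:~R)%R by rewrite /rho_log divfK// gt_eqF.
rewrite [X in X * _]EFinM -[leLHS]muleA [leRHS]muleCA.
by apply: lee_wpmul2l => //; exact: hC.
Qed.

(** [lowpart f j] is a sum of [w_0 K] over the indices below j, and the weight
    decays exponentially as theta > 0. *)
Lemma lownorm_le_mid : (0 < th)%R -> lownorm <~ midnorm.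
Proof.
move=> hth; have [C C0 hC] := lowpart_series.
have Wneg : (- th * (th1 - th0) < 0)%R by rewrite mulNr oppr_lt0 mulr_gt0.
have [B B0 [e e0 hB]] := regvar_fwd rvW Wneg.
apply: (@hardy _ _ E (fun m => - m%:Z)%R e _ _ e0).
- by move=> f j; exact: mule_ge0.
- by move=> f j; exact: mule_ge0.
exists (C * B)%R => [|[f j] /=]; first exact: mulr_gt0.
apply: (le_trans (lee_wpmul2l (WE0 _) (hC f j))).
rewrite [leLHS]muleCA [(C * B)%:E]EFinM -[leRHS]muleA.
apply: lee_wpmul2l; first by rewrite lee_fin ltW.
have t0 m : 0 <= (expR (- e * m%:R))%:E *
    ((W (j - m%:Z)%:~R)%:E * ((w0 (j - m%:Z)%:~R)%:E * Kseq f (j - m%:Z)%R)).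
  by apply: mule_ge0; [rewrite lee_fin expR_ge0|exact: (mule_ge0 (WE0 _) (wK0 _ _))].
rewrite -[leLHS]nneseriesZl; last by move=> m _; exact: wK0.
rewrite -[leRHS]nneseriesZl; last by move=> m _; exact: t0.
apply: lee_nneseries => m _; first by move=> _; exact: (mule_ge0 (WE0 _) (wK0 _ _)).
rewrite [leRHS]mulEE [leRHS]mulEE; apply: lee_wpmul2r; first exact: wK0.
have h := hB (j - m%:Z)%R m; rewrite subrK in h.
rewrite lee_fin -[leRHS]mulrA; exact: h.
Qed.

(** [rho highpart] is a sum over the indices above j, and the weight times rho
    grows exponentially as theta < 1. *)
Lemma highnorm_le_mid : (th < 1)%R -> highnorm <~ midnorm.
Proof.
move=> hth; have [C C0 hC] := highpart_series.
have rvWr := regvarM rvW rho_log_regvar.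
have Wpos : (0 < - th * (th1 - th0) + (th1 - th0))%R.
  by rewrite mulNr addrC -{1}[(th1 - th0)%R]mul1r -mulrBl mulr_gt0// subr_gt0.
have [B B0 [e e0 hB]] := regvar_bwd rvWr Wpos.
apply: (@hardy _ _ E (fun m => m%:Z)%R e _ _ e0).
- by move=> f j; exact: mule_ge0.
- by move=> f j; exact: mule_ge0.
exists (C * B)%R => [|[f j] /=]; first exact: mulr_gt0.
rewrite [leLHS]mulEE.
have Wr0 : 0 <= (W j%:~R * rho_log j%:~R)%:E by rewrite lee_fin mulr_ge0// ltW.
apply: (le_trans (lee_wpmul2l Wr0 (hC f j))).
rewrite [leLHS]muleCA [(C * B)%:E]EFinM -[leRHS]muleA.
apply: lee_wpmul2l; first by rewrite lee_fin ltW.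
have t0 m : 0 <= (expR (- e * m%:R))%:E *
    ((W (j + m%:Z)%:~R)%:E * ((w0 (j + m%:Z)%:~R)%:E * Kseq f (j + m%:Z)%R)).
  by apply: mule_ge0; [rewrite lee_fin expR_ge0|exact: (mule_ge0 (WE0 _) (wK0 _ _))].
have w1K m : 0 <= (w1 (j + m%:Z)%:~R)%:E * Kseq f (j + m%:Z)%R.
  by apply: mule_ge0; [rewrite lee_fin ltW|exact: Kseq_ge0].
rewrite -[leLHS]nneseriesZl; last by move=> m _; exact: w1K.
rewrite -[leRHS]nneseriesZl; last by move=> m _; exact: t0.
apply: lee_nneseries => m _; first by move=> _; exact: (mule_ge0 Wr0 (w1K _)).
set k := (j + m%:Z)%R.
have -> : w0 k%:~R = (rho_log k%:~R * w1 k%:~R)%R by rewrite /rho_log divfK// gt_eqF.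
rewrite [(rho_log _ * _)%:E]EFinM -[X in _ <= _ * (_ * (_ * X))]muleA.
rewrite [X in _ <= _ * (_ * X)]mulEE [X in _ <= _ * X]mulEE [leRHS]mulEE.
apply: lee_wpmul2r; first exact: w1K.
have h := hB k m; rewrite {1 2}/k addrK in h.
by rewrite lee_fin.
Qed.

End outer.

Section all_theta.
Variables (b : R -> R) (E : ri_space R).
Hypothesis hb : SV b.
Let W th (s : R) : R := weight th b (ln (rho_log s)).
Let rvW th : regvar (- th * (th1 - th0)) (W th).
Proof. exact: (regvar_comp (weight_regvar th (SV_regvar hb)) rho_log_regvar). Qed.
Let W0 th s : (0 < W th s)%R. Proof. by case: (rvW th). Qed.
Let WE0 th s : 0 <= (W th s)%:E. Proof. by rewrite lee_fin ltW. Qed.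

Let WPQ th := qnormK_holmstedt th E hb.

(** Otherwise the K-functional of the couple [(Y0, Y1)] would be identically
    infinite. *)
Lemma spaceYY_decomp th (f : V) : decomp XX f !=set0 ->
  qnorm (spaceK YY th b E) f < +oo -> decomp YY f !=set0.
Proof.
move=> dX nf; apply/set0P/negP => /eqP d0e.
have [_ [C C0 hC]] := qnormK_discrete th E hb.
have := hC (exist _ f dX).
rewrite [X in seqnorm E X](_ : _ = fun=> +oo); last first.
  apply/funext => j /=; rewrite /Kfun -/YY d0e image_set0 ereal_inf0.
  by rewrite gt0_muley// lte_fin; exact: (W0 th).
rewrite seqnorm_oo leye_eq => /eqP h.
suff : C%:E * qnorm (spaceK YY th b E) f < +oo by rewrite h ltxx.
by apply: lte_mul_pinfty; [rewrite lee_fin ltW|by []|exact: nf].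
Qed.

Let same (th : R) (Y : qspace V) :
  (forall f : V, carrier Y f <-> decomp XX f !=set0 /\ qnorm Y f < +oo) ->
  (forall f : V, 0 <= qnorm Y f) ->
  eqsim (fun f : T => qnorm (spaceK YY th b E) (sval f)) (fun f => qnorm Y (sval f)) ->
  same_space (spaceK YY th b E) Y.
Proof.
move=> hY Y0 hE; apply: (@same_space_of _ _ XX YY); [|exact: hY| | | |exact: Y0|exact: hE].
- by move=> f; split.
- exact: decompYY.
- exact: spaceYY_decomp.
- by move=> f; apply: tnorm_ge0.
Qed.

Local Notation lownorm th := (fun f : T =>
  seqnorm E (fun j => (W th j%:~R)%:E * lowpart f j)).
Local Notation highnorm th := (fun f : T =>
  seqnorm E (fun j => (W th j%:~R)%:E * ((rho_log j%:~R)%:E * highpart f j))).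
Local Notation midnorm th := (fun f : T =>
  seqnorm E (fun j => (W th j%:~R)%:E * ((w0 j%:~R)%:E * Kseq f j))).
Local Notation sumnorm th := (fun f : T =>
  seqnorm E (fun j => (W th j%:~R)%:E * (lowpart f j + (rho_log j%:~R)%:E * highpart f j))).

Let hKP th := midnorm_le_low th E hb.
Let hKQ th := midnorm_le_high th E hb.
Let hPK th := @lownorm_le_mid th b E hb.
Let hQK th := @highnorm_le_mid th b E hb.

Let sumnorm_le th (h : T -> \bar R) :
  lownorm th <~ h -> highnorm th <~ h -> sumnorm th <~ h.
Proof.
move=> hP hQ; apply: (ls_trans _ (lsD hP hQ)); apply: ls_le => f.
have WP j : 0 <= (W th j%:~R)%:E * lowpart f j by exact: mule_ge0.
have WQ j : 0 <= (W th j%:~R)%:E * ((rho_log j%:~R)%:E * highpart f j) by exact: mule_ge0.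
apply: (le_trans _ (seqnormD E WP WQ)); apply: seqnorm_le => j.
  by apply: mule_ge0; [exact: WE0|exact: adde_ge0].
by rewrite ge0_muleDr.
Qed.

Let lownorm_le_sum th : lownorm th <~ sumnorm th.
Proof.
apply: ls_le => f; apply: seqnorm_le => j; first exact: mule_ge0.
by apply: lee_wpmul2l; [exact: WE0|exact: leeDl].
Qed.

Let highnorm_le_sum th : highnorm th <~ sumnorm th.
Proof.
apply: ls_le => f; apply: seqnorm_le => j; first exact: mule_ge0.
by apply: lee_wpmul2l; [exact: WE0|exact: leeDr].
Qed.

Lemma reiteration_interior (th : R) (thm : R) (B : R -> R) : (0 < th)%R -> (th < 1)%R ->
  regvar 0 (fun s => B (expR s)) -> (forall s, weight thm B s = (W th s * w0 s)%R) ->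
  same_space (spaceK YY th b E) (spaceK XX thm B E).
Proof.
move=> hth hth' hB BE; apply: same; [by move=> f; split|by move=> f; apply: tnorm_ge0|].
apply: (es_trans (WPQ th)); apply: es_sym; apply: (es_trans (spaceK_es hX thm hB E)).
apply: (@es_trans _ _ _ (midnorm th)).
  apply: es_eq => f; congr (seqnorm E _); apply/funext => j.
  by rewrite /Kweighted BE EFinM muleA.
split; first exact: (ls_trans (hKP th) (lownorm_le_sum th)).
by apply: sumnorm_le; [exact: hPK|exact: hQK].
Qed.

Variable c : R -> R.
Hypothesis c0 : forall t, (0 < t)%R -> (0 < c t)%R.
Hypothesis cE : forall s, c (expR s) = b (rho_log s).

Let rvc : regvar 0 (fun s => c (expR s)).
Proof.
have := regvar_comp (SV_regvar hb) rho_log_regvar; rewrite mul0r; apply: regvar_ext => s.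
by rewrite cE (lnK (rho0 s)).
Qed.

Lemma reiteration_left :
  same_space (spaceK YY 0 b E) (spaceRL XX th0 c E b0 E0 a0 F0).
Proof.
apply: same; [by move=> f; split|by move=> f; apply: tnorm_ge0|].
apply: (es_trans (WPQ 0%R)); apply: es_sym.
apply: (es_trans (spaceRL_es hX th0 ha0 F0 (SV_gt0 hb0) (SV_regvar hb0) c0 rvc E E0)).
apply: (@es_trans _ _ _ (lownorm 0%R)).
  apply: es_eq => f; congr (seqnorm E _); apply/funext => j.
  by congr (_%:E * _); rewrite /W /weight cE (lnK (rho0 _)) oppr0 mul0r expR0 mul1r.
split; first exact: lownorm_le_sum.
apply: sumnorm_le; first exact: ls_refl.
by apply: (ls_trans _ (hKP 0%R)); exact: hQK.
Qed.

Let n1E s : 0 <= (cumfun E1 b1 (expR s))%:E.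
Proof. by rewrite lee_fin ltW//; exact: cumfun_gt0. Qed.

Let bs1E k : 0 <= (bs1 k)%:E. Proof. by rewrite lee_fin ltW. Qed.
Let tl (f : T) j := tailnorm F1 (Kweighted th1 a1 f) j.
Let Dn f j := iternorm E1 bs1 F1 (fun i k => (i <= k) && (j <= i))%R (Kweighted th1 a1 f).

(** On this range the inner norm does not depend on the outer index. *)
Lemma iternorm_corner f j :
  iternorm E1 bs1 F1 (fun i k => (i <= j) && (j <= k))%R (Kweighted th1 a1 f) =
  cumnorm E1 bs1 j * tl f j.
Proof.
rewrite muleC -seqnormZe; last 3 first.
- by move=> k; exact: restr_ge0.
- exact: seqnorm_ge0.
- exact: cumnorm_gt0.
congr (seqnorm E1 _); apply/funext => i; rewrite [RHS]muleC [X in _ = X * _]/restr.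
have [ij|ij] := boolP (i <= j)%R.
  by congr (_ * seqnorm F1 _); apply/funext => k; rewrite /restr.
rewrite mul0e (_ : restr _ _ = (fun k : int => 0%R%:E * 0)).
  by rewrite (seqnormZ F1 (lexx _) (fun=> lexx _)) mul0e mule0.
by apply/funext => k; rewrite mul0e /restr.
Qed.

(** Cut the outer norm at j. *)
Lemma highpart_split :
  eqsim (fun p : T * int => highpart p.1 p.2)
        (fun p => (cumfun E1 b1 (expR p.2%:~R))%:E * tl p.1 p.2 + Dn p.1 p.2).
Proof.
have [[C C0 hC] [D D0 hD]] := cumnorm_es hb1 b1fin.
have wK0 f k : 0 <= Kweighted th1 a1 f k by exact: Kweighted_ge0.
have t0 f j : 0 <= tl f j by exact: seqnorm_ge0.
have Dn0 f j : 0 <= Dn f j by exact: seqnorm_ge0.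
have nt0 f j : 0 <= (cumfun E1 b1 (expR j%:~R))%:E * tl f j by exact: (mule_ge0 (n1E _) (t0 f j)).
split.
- exists (C + 1)%R => [|[f j] /=]; first exact: addr_gt0.
  apply: (@le_trans _ _ (1%:E * (iternorm E1 bs1 F1 (fun i k => (i <= j) && (j <= k))%R (Kweighted th1 a1 f)
     + Dn f j))).
    apply: (iternorm_split E1 F1 bs10 ltr01 (wK0 f) (wK0 f) (wK0 f)) => i k /andP[ik jk].
    have [ij|/ltW ji] := leP i j; [left|right]; rewrite mul1e; split.
    + exact: jk.
    + exact: lexx.
    + by rewrite ik ji.
    + exact: lexx.
  rewrite mul1e iternorm_corner (ge0_muleDr _ (nt0 f j) (Dn0 f j)); apply: leeD.
    rewrite [leRHS]muleA; apply: lee_wpmul2r; first exact: t0.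
    apply: (le_trans (hC j)).
    by apply: lee_wpmul2r; [exact: n1E|rewrite lee_fin lerDl].
  rewrite -[leLHS]mul1e; apply: lee_wpmul2r; first exact: Dn0.
  by rewrite lee_fin lerDr ltW.
- apply: lsD.
  + exists D => // -[f j] /=.
    apply: (@le_trans _ _ (D%:E * (cumnorm E1 bs1 j * tl f j))).
      by rewrite [leRHS]muleA; apply: lee_wpmul2r; [exact: t0|exact: hD].
    apply: lee_wpmul2l; first by rewrite lee_fin ltW.
    rewrite -iternorm_corner -[leRHS]mul1e.
    apply: (iternorm_le E1 F1 bs10 ltr01 (wK0 f) (wK0 f)) => i k /andP[ij jk].
    by rewrite mul1e jk (le_trans ij jk).
  + apply: ls_le => -[f j] /=; rewrite -[leRHS]mul1e.
    apply: (iternorm_le E1 F1 bs10 ltr01 (wK0 f) (wK0 f)) => i k /andP[ik ji].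
    by rewrite mul1e ik (le_trans ji ik).
Qed.

Let W1 s : (W 1 s * rho_log s = b (rho_log s))%R.
Proof.
by rewrite /W /weight mulN1r expRN !(lnK (rho0 s)) mulrAC mulVf ?mul1r// gt_eqF.
Qed.

Variable n1 : R -> R.
Hypothesis n1_cum : forall t, n1 t = cumfun E1 b1 t.

Lemma reiteration_right :
  same_space (spaceK YY 1 b E)
    (qspaceI (spaceR XX th1 (fun u => n1 u * c u)%R E a1 F1)
             (spaceRR XX th1 c E b1 E1 a1 F1)).
Proof.
have t0 f j : 0 <= tl f j by exact: seqnorm_ge0.
have Dn0 f j : 0 <= Dn f j by exact: seqnorm_ge0.
have cE0 s : 0 <= (c (expR s))%:E by rewrite lee_fin ltW// c0// expR_gt0.
apply: same.
- by apply: qspaceI_carrier => f; split.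
- by move=> f; rewrite le_max; apply/orP; left; apply: tnorm_ge0.
have nc0 t : (0 < t)%R -> (0 < n1 t * c t)%R.
  move=> t0'; rewrite mulr_gt0 ?c0// n1_cum -(lnK t0'); exact: cumfun_gt0.
have rvnc : regvar 0 (fun s => n1 (expR s) * c (expR s))%R.
  have := regvarM (cumfun_regvar hb1 b1fin) rvc; rewrite addr0; apply: regvar_ext => s.
  by rewrite n1_cum.
have e1 := spaceR_es hX th1 ha1 F1 nc0 rvnc E.
have e2 := spaceRR_es hX th1 ha1 F1 (SV_gt0 hb1) (SV_regvar hb1) c0 rvc E E1.
pose n0' (f : T) := seqnorm E (fun j => (c (expR j%:~R))%:E * highpart f j).
have highnormE : highnorm 1%R = n0'.
  apply/funext => f; congr (seqnorm E _); apply/funext => j.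
  by rewrite mulEE W1 cE.
pose m1 (f : T) := seqnorm E (fun j => (n1 (expR j%:~R) * c (expR j%:~R))%:E * tl f j).
pose m2 (f : T) := seqnorm E (fun j => (c (expR j%:~R))%:E * Dn f j).
have ncE j : 0 <= (n1 (expR j%:~R) * c (expR j%:~R))%:E.
  rewrite lee_fin; apply: ltW; apply: nc0; exact: expR_gt0.
apply: (es_trans (WPQ 1%R)).
apply: (@es_trans _ _ _ n0').
  rewrite -highnormE; split; last exact: highnorm_le_sum.
  apply: sumnorm_le; last exact: ls_refl.
  by apply: (ls_trans _ (hKQ 1%R)); exact: hPK.
have [q1 q2] := highpart_split.
have s0 f j : 0 <= (c (expR j%:~R))%:E * ((cumfun E1 b1 (expR j%:~R))%:E * tl f j + Dn f j).
  apply: mule_ge0; first exact: cE0.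
  exact: (adde_ge0 (mule_ge0 (n1E _) (t0 f j)) (Dn0 f j)).
have h1 : n0' <~ (fun f => m1 f + m2 f).
  apply: (@ls_trans _ _ _ (fun f => seqnorm E (fun j => (c (expR j%:~R))%:E *
     ((cumfun E1 b1 (expR j%:~R))%:E * tl f j + Dn f j)))).
    apply: ls_seqnorm; [by move=> f j; exact: (mule_ge0 (cE0 _) (highpart0 f j))|exact: s0|].
    by apply: lsM; [move=> p; exact: cE0|move=> p; exact: highpart0|exact: ls_refl|exact: q1].
  apply: ls_le => f.
  apply: (le_trans _ (seqnormD E (fun j => mule_ge0 (ncE j) (t0 f j))
     (fun j => mule_ge0 (cE0 _) (Dn0 f j)))).
  apply: seqnorm_le => j; first exact: s0.
  rewrite (ge0_muleDr _ (mule_ge0 (n1E _) (t0 f j)) (Dn0 f j)).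
  by rewrite mulEE [(c _ * _)%R]mulrC n1_cum.
have h2 : m1 <~ n0'.
  apply: ls_seqnorm; [by move=> f j; exact: (mule_ge0 (ncE j) (t0 f j))|
    by move=> f j; exact: (mule_ge0 (cE0 _) (highpart0 f j))|].
  have h : (fun p : T * int => (cumfun E1 b1 (expR p.2%:~R))%:E * tl p.1 p.2) <~
      (fun p => highpart p.1 p.2).
    by apply: (ls_trans _ q2); apply: ls_le => p; apply: leeDl; exact: Dn0.
  apply: (@ls_trans _ _ _ (fun p : T * int => (c (expR p.2%:~R))%:E *
     ((cumfun E1 b1 (expR p.2%:~R))%:E * tl p.1 p.2))).
    by apply: ls_le => p; rewrite mulEE n1_cum mulrC.
  apply: lsM; [by move=> p; exact: cE0| |exact: ls_refl|exact: h].
  by move=> p; exact: (mule_ge0 (n1E _) (t0 p.1 p.2)).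
have h3 : m2 <~ n0'.
  apply: ls_seqnorm; [by move=> f j; exact: (mule_ge0 (cE0 _) (Dn0 f j))|
    by move=> f j; exact: (mule_ge0 (cE0 _) (highpart0 f j))|].
  have h : (fun p : T * int => Dn p.1 p.2) <~ (fun p => highpart p.1 p.2).
    apply: (ls_trans _ q2); apply: ls_le => p; apply: leeDr.
    exact: (mule_ge0 (n1E _) (t0 p.1 p.2)).
  by apply: lsM; [move=> p; exact: cE0|move=> p; exact: Dn0|exact: ls_refl|exact: h].
split.
- apply: (ls_trans h1); apply: lsD.
  + apply: (ls_trans e1.2); apply: ls_le => f; rewrite /= le_max; apply/orP; left; exact: lexx.
  + apply: (ls_trans e2.2); apply: ls_le => f; rewrite /= le_max; apply/orP; right; exact: lexx.
- apply: (ls_trans _ (lsD (ls_trans e1.1 h2) (ls_trans e2.1 h3))); apply: ls_le => f.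
  rewrite /= ge_max; apply/andP; split; [apply: leeDl|apply: leeDr]; apply: tnorm_ge0.
Qed.

End all_theta.
End holmstedt.

Section rho.
Context {R : realType}.
Variables (th0 th1 : R) (E0 E1 : ri_space R) (a0 a1 b0 b1 : R -> R).
Hypotheses (ha0 : SV a0) (ha1 : SV a1) (hb0 : SV b0) (hb1 : SV b1).
Hypothesis b0fin : (tnorm_on E0 `]0%R, 1%R[ (EFin \o b0) < +oo)%E.
Hypothesis b1fin : (tnorm_on E1 `]0%R, 1%R[ (EFin \o b1) < +oo)%E.
Local Notation rho := (rho_log th0 th1 E0 E1 a0 a1 b0 b1).
Local Notation A0 s := (a0 (expR s) * cumfun E0 b0 (expR s)).
Local Notation A1 s := (a1 (expR s) * cumfun E1 b1 (expR s)).

Let A00 s : 0 < A0 s.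
Proof. by rewrite mulr_gt0 ?(SV_gt0 ha0) ?expR_gt0// cumfun_gt0. Qed.
Let A10 s : 0 < A1 s.
Proof. by rewrite mulr_gt0 ?(SV_gt0 ha1) ?expR_gt0// cumfun_gt0. Qed.

Lemma rho_log_expR s : rho s = expR ((th1 - th0) * s + ln (A0 s) - ln (A1 s)).
Proof.
have -> : (th1 - th0) * s = - th0 * s - - th1 * s by ring.
rewrite 2!expRD expRD !expRN !lnK ?posrE ?A00 ?A10// /rho_log /cumweight /weight.
by rewrite -!(mulrA (expR _)) invfM mulrACA -!mulrA; congr (_ * _); rewrite mulrCA.
Qed.

Lemma rho_log_powR s : rho s = expR s `^ (th1 - th0) * (A0 s / A1 s).
Proof.
rewrite rho_log_expR /powR gt_eqF ?expR_gt0// expRK -addrA expRD expRB.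
by rewrite !lnK ?posrE ?A00 ?A10.
Qed.

(** This is how [B_theta] arises: it is the product of [w_0] and
    [rho^(- theta) b(rho)] freed from its power of u. *)
Lemma weight_interior (th s : R) (b B : R -> R) :
  B (expR s) = (A0 s) `^ (1 - th) * (A1 s) `^ th * b (rho s) ->
  weight ((1 - th) * th0 + th * th1) B s =
  weight th b (ln (rho s)) * cumweight E0 b0 a0 th0 s.
Proof.
move=> BE; rewrite /cumweight /weight BE.
have -> : b (expR (ln (rho s))) = b (rho s).
  by rewrite lnK// posrE rho_log_expR expR_gt0.
have -> : ln (rho s) = (th1 - th0) * s + ln (A0 s) - ln (A1 s).
  by rewrite rho_log_expR expRK.
rewrite -[expR _ * _ * cumfun _ _ _]mulrA -{3}(lnK (A00 s)).
rewrite /powR !gt_eqF//.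
set l0 := ln (A0 s); set l1 := ln (A1 s).
rewrite [LHS]mulrA -!expRD [RHS]mulrAC -expRD.
by congr (expR _ * _); ring.
Qed.

End rho.

Theorem theorem4p3 (R : realType) (V : topologicalLmodType R)
  (XX : qspace V * qspace V) (hXX : compatible_couple XX)
  (th0 th1 : R) (hth0 : 0 < th0) (hth01 : th0 < th1) (hth1 : th1 < 1)
  (E E0 E1 F0 F1 : ri_space R) (a0 a1 b b0 b1 : R -> R)
  (ha0 : SV a0) (ha1 : SV a1) (hb : SV b) (hb0 : SV b0) (hb1 : SV b1)
  (hb0E0 : (tnorm_on E0 `]0%R, 1%R[ (EFin \o b0) < +oo)%E)
  (hb1E1 : (tnorm_on E1 `]0%R, 1%R[ (EFin \o b1) < +oo)%E) :
  let n0 u := fine (tnorm_on E0 `]0, u[ (EFin \o b0)) in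
  let n1 u := fine (tnorm_on E1 `]0, u[ (EFin \o b1)) in
  let rho u := u `^ (th1 - th0) * ((a0 u * n0 u) / (a1 u * n1 u)) in
  let YY := (spaceR XX th0 b0 E0 a0 F0, spaceR XX th1 b1 E1 a1 F1) in
  [/\ forall th : R, 0 < th -> th < 1 ->
        same_space (spaceK YY th b E)
          (spaceK XX ((1 - th) * th0 + th * th1)
            (fun u => (a0 u * n0 u) `^ (1 - th) * (a1 u * n1 u) `^ th *
                      b (rho u)) E),
      (tnorm_on E `]1%R, +oo[ (EFin \o b) < +oo)%E ->
        same_space (spaceK YY 0 b E)
          (spaceRL XX th0 (b \o rho) E b0 E0 a0 F0)
    & (tnorm_on E `]0%R, 1%R[ (EFin \o b) < +oo)%E ->
        same_space (spaceK YY 1 b E)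
          (qspaceI (spaceR XX th1 (fun u => n1 u * b (rho u)) E a1 F1)
                   (spaceRR XX th1 (b \o rho) E b1 E1 a1 F1))].
Proof.
move=> n0 n1 rho YY.
have ra0 := SV_regvar ha0; have ra1 := SV_regvar ha1.
pose r := rho_log th0 th1 E0 E1 a0 a1 b0 b1.
have rvrho : regvar (th1 - th0) r by exact: rho_log_regvar.
have r0 s : 0 < r s by case: rvrho.
have rhoE s : rho (expR s) = r s by rewrite /r rho_log_powR.
have cE s : (b \o rho) (expR s) = b (r s) by rewrite /= rhoE.
have c0 t : 0 < t -> 0 < (b \o rho) t.
  by move=> t0; rewrite -(lnK t0) cE; apply: (SV_gt0 hb).
split=> [th th_gt0 th_lt1|_|_].
- pose B u := (a0 u * n0 u) `^ (1 - th) * (a1 u * n1 u) `^ th * b (rho u).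
  have wE s : weight ((1 - th) * th0 + th * th1) B s =
      weight th b (ln (r s)) * cumweight E0 b0 a0 th0 s.
    by apply: (weight_interior ha0 ha1 hb0 hb1 hb0E0 hb1E1); rewrite -/r -rhoE.
  have rvB : regvar 0 (fun s => B (expR s)).
    have rvw := regvarM (regvar_comp (weight_regvar th (SV_regvar hb)) rvrho)
      (cumweight_regvar th0 hb0 ra0 hb0E0).
    have := regvarM (regvar_expR ((1 - th) * th0 + th * th1)) rvw.
    rewrite (_ : _ + _ = 0 :> R); last by ring.
    apply: regvar_ext => s; rewrite -wE /weight mulrA -expRD.
    by rewrite mulNr subrr expR0 mul1r.
  exact: (reiteration_interior hXX hth0 hth01 hth1 F0 F1 ra0 ra1 hb0 hb1 hb0E0 hb1E1 E hb
    th_gt0 th_lt1 rvB wE).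
- exact: (reiteration_left hXX hth0 hth01 hth1 F0 F1 ra0 ra1 hb0 hb1 hb0E0 hb1E1 E hb c0 cE).
- apply: (reiteration_right hXX hth0 hth01 hth1 F0 F1 ra0 ra1 hb0 hb1 hb0E0 hb1E1 E hb c0 cE (n1 := n1)).
  by [].
Qed.
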